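(* Let $\Omega_1=(-1,0)$, $\Omega_2=(0,1)$, $T>0$, $\mathcal Q_i=\Omega_i\times(0,T)$, and let the data $\phi_i,\pi_i,\eta_{o,i},\eta_{w,i}$ ($i=1,2$) be as in the context. Let $u_0,v_0\in L^\infty(-1,1)$ with $0\le u_0,v_0\le1$, and let $u,v$ be two weak solutions to the problem $(\mathcal P)$ for the initial data $u_0,v_0$ respectively. If $\partial_x\varphi_i(u_i)$ and $\partial_x\varphi_i(v_i)$ belong to $L^\infty(\mathcal Q_i)$ for $i=1,2$, then for all $t\in[0,T]$, $$\sum_{i=1,2}\int_{\Omega_i}\phi_i\,(u(x,t)-v(x,t))^{\pm}\,dx\le\sum_{i=1,2}\int_{\Omega_i}\phi_i\,(u_0(x)-v_0(x))^{\pm}\,dx$$ (the inequality holds with the positive parts on both sides, and with the negative parts on both sides).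
   Context: Data. For $i=1,2$: $\phi_i\in(0,1)$ is a constant; $\pi_i\in C^1([0,1],\mathbb R)$ with $\pi_i'>0$ on $(0,1)$; $\eta_{o,i}\in C^0([0,1],\mathbb R_+)$ is (strictly) increasing with $\eta_{o,i}(0)=0$; $\eta_{w,i}\in C^0([0,1],\mathbb R_+)$ is (strictly) decreasing with $\eta_{w,i}(1)=0$. Put $\alpha_i=\pi_i(0)$, $\beta_i=\pi_i(1)$, $\lambda_i=\frac{\eta_{o,i}\eta_{w,i}}{\eta_{o,i}+\eta_{w,i}}$ (so $\lambda_i>0$ on $(0,1)$, $\lambda_i(0)=\lambda_i(1)=0$), and $\varphi_i(s)=\int_0^s\lambda_i(a)\pi_i'(a)\,da$, which is $C^1$ and strictly increasing on $[0,1]$. The monotone graph $\tilde\pi_i$ is $\tilde\pi_i(s)=\{\pi_i(s)\}$ for $s\in(0,1)$, $\tilde\pi_i(0)=(-\infty,\alpha_i]$, $\tilde\pi_i(1)=[\beta_i,+\infty)$. Weak solution to $(\mathcal P)$ with initial datum $u_0$: a function $u\in L^\infty((-1,1)\times(0,T))$ with $0\le u\le1$ a.e. such that, $u_i$ denoting its restriction to $\Omega_i\times(0,T)$: (i) $\varphi_i(u_i)\in L^2(0,T;H^1(\Omega_i))$, $i=1,2$; (ii) the traces at $x=0$ (defined by $u_i(0,t)=\varphi_i^{-1}$ of the trace of $\varphi_i(u_i)(\cdot,t)$) satisfy $\tilde\pi_1(u_1(0,t))\cap\tilde\pi_2(u_2(0,t))\neq\emptyset$ for a.e. $t\in(0,T)$;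 (iii) for all smooth $\psi$ compactly supported in $[-1,1]\times[0,T)$, $$\int_0^T\sum_{i=1,2}\int_{\Omega_i}\phi_iu\,\partial_t\psi\,dx\,dt+\sum_{i=1,2}\int_{\Omega_i}\phi_iu_0(x)\psi(x,0)\,dx-\int_0^T\sum_{i=1,2}\int_{\Omega_i}\partial_x\varphi_i(u_i)\,\partial_x\psi\,dx\,dt=0.$$ Values $u(\cdot,t)$ at a given time $t\in[0,T]$ refer to the representative of $u$ that is continuous from $[0,T]$ to $L^\infty(-1,1)$ with the weak-$\star$ topology (it exists by the weak formulation). Here $a^+=\max(a,0)$ and $a^-=\max(-a,0)$. *)

(* Defs.v *)
From HB Require Import structures.
From mathcomp Require Import all_boot all_order all_algebra.
From mathcomp Require Import all_classical all_reals all_analysis.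

Set Implicit Arguments.
Unset Strict Implicit.
Unset Printing Implicit Defensive.

Import Order.TTheory GRing.Theory Num.Theory.
Import numFieldNormedType.Exports.

Local Open Scope classical_set_scope.
Local Open Scope ring_scope.

Definition lebesgue2 (R : realType) :=
  (@lebesgue_measure R \x @lebesgue_measure R)%E.

(* Membership of the class of f in L^p(D): f \_ D is f extended by 0 off D. *)
Definition Lp_on d (X : measurableType d) (R : realType)
    (mu : {measure set X -> \bar R}) (p : \bar R) (D : set X) (f : X -> R) :=
  f \_ D \in Lfun mu p.

(* All directional derivatives up to order k exist and are continuous; in
   finite dimension (only V = R and V = R * R are used) this is C^k. *)
Fixpoint class_C (R : realType) (V : normedModType R) (k : nat) (f : V -> R)
    : Prop :=
  continuous f /\
  if k is k'.+1 then
    forall v : V, (forall x, derivable f x v) /\ class_C k' (fun x => 'D_v f x)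
  else True.

(* Restrictions to D of smooth functions, with compact support inside D.  When
   D contains part of its boundary, e.g. D = [-1, 1] x [0, T), the function
   need not vanish there. *)
Definition test_function (R : realType) (V : normedModType R) (D : set V)
    (psi : V -> R) : Prop :=
  (forall k, class_C k psi) /\
  exists K : set V,
    [/\ compact K, K `<=` D & forall x, D x -> psi x != 0 -> K x].

(* f \in H^1(]a, b[), with weak derivative g. *)
Definition H1_deriv (R : realType) (a b : R) (f g : R -> R) : Prop :=
  [/\ Lp_on (@lebesgue_measure R) 2%:E `]a, b[ f,
      Lp_on (@lebesgue_measure R) 2%:E `]a, b[ g &
      forall psi : R -> R, test_function `]a, b[ psi ->
        \int[@lebesgue_measure R]_(x in `]a, b[) (f x * derive1 psi x)
        = - \int[@lebesgue_measure R]_(x in `]a, b[) (g x * psi x)].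

(* w \in L^2(0, T; H^1(]a, b[)), with weak space derivative g; the arguments of
   w and g are pairs (x, t). *)
Definition L2H1_deriv (R : realType) (a b T : R) (w g : R * R -> R) : Prop :=
  [/\ Lp_on (@lebesgue2 R) 2%:E (`]a, b[ `*` `]0, T[) w,
      Lp_on (@lebesgue2 R) 2%:E (`]a, b[ `*` `]0, T[) g &
      {ae @lebesgue_measure R, forall t, t \in `]0, T[ ->
        H1_deriv a b (fun x => w (x, t)) (fun x => g (x, t))}].

(* c is the trace at the endpoint x0 of f \in H^1(]a, b[): the value at x0 of
   the representative of f that is continuous on [a, b]. *)
Definition is_trace (R : realType) (a b x0 : R) (f : R -> R) (c : R) : Prop :=
  exists fc : R -> R,
    [/\ {within `[a, b], continuous fc},
        {ae @lebesgue_measure R, forall x, x \in `]a, b[ -> fc x = f x} &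
        fc x0 = c].

(* C^1 up to the endpoints: the derivative extends continuously to [a, b].
   derive1 f is two-sided, hence meaningless at a and b. *)
Definition C1_itv (R : realType) (a b : R) (f : R -> R) : Prop :=
  derivable_oo_LRcontinuous f a b /\
  exists2 df : R -> R,
    {within `[a, b], continuous df} & {in `]a, b[, derive1 f =1 df}.

(* The functions are meaningful on [0, 1] only. *)
Record medium (R : realType) := Medium {
  porosity : R;
  capillary : R -> R;
  eta_o : R -> R;
  eta_w : R -> R;
  porosity_itv : 0 < porosity < 1;
  capillary_C1 : C1_itv 0 1 capillary;
  capillary_deriv_gt0 : {in `]0, 1[, forall s, 0 < derive1 capillary s};
  eta_o_continuous : {within `[0, 1], continuous eta_o};
  eta_o_ge0 : {in `[0, 1], forall s, 0 <= eta_o s};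
  eta_o_increasing : {in `[0, 1] &, {homo eta_o : s r / s < r}};
  eta_o_0 : eta_o 0 = 0;
  eta_w_continuous : {within `[0, 1], continuous eta_w};
  eta_w_ge0 : {in `[0, 1], forall s, 0 <= eta_w s};
  eta_w_decreasing : {in `[0, 1] &, {homo eta_w : s r /~ s < r}};
  eta_w_1 : eta_w 1 = 0
}.

Definition mobility (R : realType) (m : medium R) (s : R) : R :=
  eta_o m s * eta_w m s / (eta_o m s + eta_w m s).

(* Extended by 0 off [0, 1], so that its composition with a measurable function
   is measurable. *)
Definition varphi (R : realType) (m : medium R) : R -> R :=
  (fun s => \int[@lebesgue_measure R]_(a in `[0, s])
              (mobility m a * derive1 (capillary m) a)) \_ `[0, 1].

Definition varphi_inv (R : realType) (m : medium R) : R -> R :=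
  'pinv_(fun=> 0) (`[0, 1] : set R) (varphi m).

Definition capillary_graph (R : realType) (m : medium R) (s : R) : set R :=
  if s == 0 then `]-oo, capillary m 0]%classic
  else if s == 1 then `[capillary m 1, +oo[%classic
  else [set capillary m s].

(* Omega_1 = ]-1, 0[ and Omega_2 = ]0, 1[ have indices 0 and 1 in 'I_2. *)
Definition left_end (R : realType) (i : 'I_2) : R := i%:R - 1.
Definition right_end (R : realType) (i : 'I_2) : R := i%:R.
Definition Omega (R : realType) (i : 'I_2) : set R :=
  `]left_end R i, right_end R i[.
Arguments Omega R i : clear implicits.

Definition flux_deriv (R : realType) (m : 'I_2 -> medium R) (T : R)
    (u : R * R -> R) (i : 'I_2) (g : R * R -> R) : Prop :=
  L2H1_deriv (left_end R i) (right_end R i) T (fun p => varphi (m i) (u p)) g.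

Definition weak_formulation (R : realType) (m : 'I_2 -> medium R) (T : R)
    (u0 : R -> R) (u : R * R -> R) (g : 'I_2 -> R * R -> R)
    (psi : R * R -> R) : Prop :=
  \int[@lebesgue_measure R]_(t in `]0, T[)
     (\sum_(i < 2) \int[@lebesgue_measure R]_(x in Omega R i)
        (porosity (m i) * u (x, t) * 'D_(0, 1) psi (x, t)))
  + \sum_(i < 2) \int[@lebesgue_measure R]_(x in Omega R i)
        (porosity (m i) * u0 x * psi (x, 0))
  - \int[@lebesgue_measure R]_(t in `]0, T[)
     (\sum_(i < 2) \int[@lebesgue_measure R]_(x in Omega R i)
        (g i (x, t) * 'D_(1, 0) psi (x, t))) = 0.

Definition saturation (d : measure_display) (X : measurableType d)
    (R : realType) (mu : {measure set X -> \bar R}) (D : set X) (f : X -> R)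
    : Prop :=
  Lp_on mu +oo%E D f /\ {ae mu, forall x, D x -> 0 <= f x <= 1}.

Definition weak_solution (R : realType) (m : 'I_2 -> medium R) (T : R)
    (u0 : R -> R) (u : R * R -> R) : Prop :=
  [/\ saturation (@lebesgue2 R) (`]-1, 1[ `*` `]0, T[) u,
      {ae @lebesgue_measure R, forall t, t \in `]0, T[ -> exists c : 'I_2 -> R,
        (forall i, is_trace (left_end R i) (right_end R i) 0
                     (fun x => varphi (m i) (u (x, t))) (c i)) /\
        (\bigcap_i capillary_graph (m i) (varphi_inv (m i) (c i))) !=set0} &
      exists2 g : 'I_2 -> R * R -> R,
        forall i, flux_deriv m T u i (g i) &
        forall psi : R * R -> R,
          @test_function R (R * R)%type (`[-1, 1] `*` `[0, T[) psi ->
          weak_formulation m T u0 u g psi].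

Definition bounded_flux (R : realType) (m : 'I_2 -> medium R) (T : R)
    (u : R * R -> R) : Prop :=
  forall i : 'I_2, exists2 g : R * R -> R,
    flux_deriv m T u i g & Lp_on (@lebesgue2 R) +oo%E (Omega R i `*` `]0, T[) g.

(* uc t is the value at time t of the representative of u that is continuous
   from [0, T] to L^oo(-1, 1) with the weak-star topology; note the order of
   the arguments, uc t x against u (x, t). *)
Definition weak_star_representative (R : realType) (T : R) (u : R * R -> R)
    (uc : R -> R -> R) : Prop :=
  [/\ forall t, t \in `[0, T] -> Lp_on (@lebesgue_measure R) +oo%E `]-1, 1[ (uc t),
      forall f : R -> R, Lp_on (@lebesgue_measure R) 1%:E `]-1, 1[ f ->
        {within `[0, T], continuous
           (fun t => \int[@lebesgue_measure R]_(x in `]-1, 1[) (uc t x * f x))} &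
      {ae @lebesgue_measure R, forall t, t \in `]0, T[ ->
        {ae @lebesgue_measure R, forall x, x \in `]-1, 1[ -> uc t x = u (x, t)}}].

(* Main.v *)
From HB Require Import structures.
Require Import Defs.
From mathcomp Require Import all_boot all_order all_algebra.
From mathcomp Require Import all_classical all_reals all_analysis.
From mathcomp Require Import measurable_realfun ess_sup_inf ring lra.

(** The proof is Kruzkov's doubling of variables, performed in the time variable
    only. Write [w] for the porosity (constant in each subdomain), [a] and [b]
    for the two saturations, [f] and [g] for their fluxes, that is the space
    derivatives of the transformed saturations, and [z_i = phi_i(a)],
    [zb_i = phi_i(b)] in the i-th subdomain, [phi_i] being the function
    [varphi (m i)].

    - What the hypotheses give ([extraction]). As the flux is bounded, [z_i] is
      Lipschitz in space at almost every time ([potential_exists]), so its trace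
      at the interface is its value there ([trace_value]). Testing the weak
      formulation with a smooth step in space times a smooth cutoff in time, and
      letting the cutoff become sharp, integrates the equation in time: the mass
      stored on the left of a point is the flux accumulated through this point
      ([balance], [stored_mass]). Nothing is known on the time derivative of [a],
      but this integrated form is enough for all that follows.

    - Inside a subdomain ([kato_side]). Take [a] at time [t] and [b] at time [s],
      and a smooth nondecreasing approximation [S] of the Heaviside function. The
      entropy of [a] relative to [b] is the integral of [S (phi y - phi b)] for
      [y] from 0 to [a]; it is convex in [a], and its derivative [S (z - zb)] is
      Lipschitz in space, so it can be paired with the balance between two
      instants ([entropy_step]). This gives an inequality in [t] with [s] frozen
      ([half_kato]). The exchange of the two phases, which replaces a saturation
      by its complement to 1, turns it into the inequality in [s] with [t] frozen
      ([side_sol_flip]). In the sum the fluxes contribute [S' (f - g)^2 >= 0]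
      ([kato_sum]). When [S] tends to the Heaviside function there remains
      (d/dt + d/ds) of the integral of [w (a - b)^+], tested against a cutoff
      [xi] which vanishes at the interface, and the flux of [(z - zb)^+] across
      the layer where [xi] varies.

    - Across the interface ([kato_global]). If neither [z_0 - zb_0] nor
      [z_1 - zb_1] is positive at the interface, the two boundary layers
      contribute with the good sign. If one of them is positive, the capillary
      graphs, which are increasing and meet, force the other to be nonnegative
      ([capillary_graph_lt], [interface_order]); positive parts can then be
      removed at the interface, and the boundary layers contribute at least the
      jump of the mean flux of [a] at time [t] minus that of [b] at time [s].
      Mass conservation makes such a jump tend to 0 weakly in time, because its
      time primitive is of the size of the layer
      ([flux_jump_primitive_small], [small_primitive]). Hence [excess (t, s)], the
      integral of [w (a(t) - b(s))^+], satisfies (d/dt + d/ds) excess <= 0 in the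
      sense of distributions.

    - Conclusion ([contraction]). Test with a kernel in [s - t] times a window in
      [t] which opens just after 0 and closes just after [tau]
      ([doubling_weight]): averages of [excess] near (tau, tau) are at most its
      averages near (0, 0). The latter tend to the initial integral because [a]
      tends strongly to its initial datum, by the entropy inequality with the
      initial datum in the place of [b] ([initial_continuity]). The former have an
      inferior limit at least the integral of [w (uc tau - vc tau)^+], since this
      integral is the value at [tau] of a weakly continuous function of time, the
      one obtained by integrating over the fixed set where [vc tau < uc tau]. The
      extreme times follow by weak continuity, and the negative parts by
      exchanging the two solutions. *)

Set Implicit Arguments.
Unset Strict Implicit.
Unset Printing Implicit Defensive.

Import Order.TTheory GRing.Theory Num.Theory.
Import numFieldNormedType.Exports.

Local Open Scope classical_set_scope.
Local Open Scope ring_scope.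

(** * Bounded measurable functions *)

(** Boundedness is required on the whole space: on a set of finite measure
    such functions are integrable, so that the rules of integration hold
    without integrability conditions. *)
Definition bm (R : realType) d (T : measurableType d) (f : T -> R) : Prop :=
  measurable_fun setT f /\ exists M : R, forall x, `|f x| <= M.

Section bounded_measurable.
Context (R : realType) d (T : measurableType d).
Implicit Types f g : T -> R.

Lemma bm_cst (k : R) : bm (fun _ : T => k).
Proof. by split; [exact: measurable_cst|exists `|k|]. Qed.

Lemma bmD f g : bm f -> bm g -> bm (fun x => f x + g x).
Proof.
move=> [mf [M fM]] [mg [N gN]]; split; first exact: measurable_funD.
by exists (M + N) => x; rewrite (le_trans (ler_normD _ _)) ?lerD.
Qed.

Lemma bmM f g : bm f -> bm g -> bm (fun x => f x * g x).
Proof.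
move=> [mf [M fM]] [mg [N gN]]; split; first exact: measurable_funM.
by exists (M * N) => x; rewrite normrM ler_pM.
Qed.

Lemma bmN f : bm f -> bm (fun x => - f x).
Proof.
move=> [mf [M fM]]; split; first exact: measurableT_comp.
by exists M => x; rewrite normrN.
Qed.

Lemma bmB f g : bm f -> bm g -> bm (fun x => f x - g x).
Proof. by move=> bf bg; apply: bmD => //; exact: bmN. Qed.

Lemma bm_norm f : bm f -> bm (fun x => `|f x|).
Proof.
move=> [mf [M fM]]; split; first exact: measurableT_comp.
by exists M => x; rewrite normr_id.
Qed.

Lemma bm_restrict (D : set T) f : measurable D -> bm f -> bm (f \_ D).
Proof.
move=> mD [mf [M fM]]; split.
  by apply/(measurable_restrictT _ _).1 => //; exact: measurable_funS mf.
exists `|M| => x; rewrite patchE; case: ifP => _.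
  by rewrite (le_trans (fM x))// ler_norm.
by rewrite normr0.
Qed.

Lemma bm_indic (D : set T) : measurable D -> bm (\1_D : T -> R).
Proof.
move=> mD; split; first exact: measurable_indic.
by exists 1 => x; rewrite indicE; case: (_ \in _); rewrite ?normr1 ?normr0.
Qed.

Lemma bm_sum (I : Type) (s : seq I) (F : I -> T -> R) :
  (forall i, bm (F i)) -> bm (fun x => \sum_(i <- s) F i x).
Proof.
move=> bF; elim: s => [|i s IH].
  by under eq_fun do rewrite big_nil; exact: bm_cst.
by under eq_fun do rewrite big_cons; exact: bmD.
Qed.

Lemma bm_continuous_comp (S : R -> R) f :
  continuous S -> bm f -> bm (fun x => S (f x)).
Proof.
move=> cS [mf [M fM]]; split.
  by apply: measurableT_comp => //; exact: continuous_measurable_fun.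
have M0 : - `|M| <= `|M| by rewrite ge0_cp.
have cS' : {within `[(- `|M|), `|M|], continuous S}.
  exact: continuous_subspaceT.
have cN : {within `[(- `|M|), `|M|], continuous (fun x => - S x)}.
  by move=> x; apply: continuousN; exact: cS'.
have [c1 _ Hc1] := EVT_max M0 cS'.
have [c2 _ Hc2] := EVT_min M0 cS'.
exists (`|S c1| + `|S c2|) => x.
have fx : f x \in `[(- `|M|), `|M|].
  rewrite in_itv/= -ler_norml (le_trans (fM x))// ler_norm//.
have /(_ _ fx) h1 := Hc1; have /(_ _ fx) h2 := Hc2.
rewrite ler_norml; apply/andP; split.
  rewrite lerNl (le_trans _ (_ : - S c2 <= _))//; first by rewrite lerN2.
  by rewrite (le_trans (ler_norm _))// normrN lerDr.
by rewrite (le_trans h1)// (le_trans (ler_norm _))// lerDl.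
Qed.

Lemma bm_integrable (mu : {measure set T -> \bar R}) (D : set T) f :
  measurable D -> (mu D < +oo)%E -> bm f -> mu.-integrable D (EFin \o f).
Proof.
move=> mD Dfin [mf [M fM]].
apply: measurable_bounded_integrable => //; first exact: measurable_funS mf.
exists M; split; first exact: num_real.
by move=> N MN x _ /=; rewrite (le_trans (fM x))// ltW.
Qed.

End bounded_measurable.

Lemma bm_comp (R : realType) d d' (T : measurableType d) (T' : measurableType d')
  (f : T' -> R) (h : T -> T') : measurable_fun setT h -> bm f -> bm (fun x => f (h x)).
Proof.
move=> mh [mf [M fM]]; split; first exact: measurableT_comp.
by exists M => x.
Qed.

Section bounded_integral.
Context (R : realType) d (T : measurableType d) (mu : {measure set T -> \bar R})
  (D : set T) (mD : measurable D) (Dfin : (mu D < +oo)%E).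
Implicit Types f g : T -> R.

Lemma bm_le_Rintegral f g : bm f -> bm g -> (forall x, D x -> f x <= g x) ->
  \int[mu]_(x in D) f x <= \int[mu]_(x in D) g x.
Proof. by move=> bf bg fg; apply: le_Rintegral => //; exact: bm_integrable. Qed.

Lemma bm_RintegralD f g : bm f -> bm g ->
  \int[mu]_(x in D) (f x + g x) = \int[mu]_(x in D) f x + \int[mu]_(x in D) g x.
Proof. by move=> bf bg; apply: RintegralD => //; exact: bm_integrable. Qed.

Lemma bm_RintegralB f g : bm f -> bm g ->
  \int[mu]_(x in D) (f x - g x) = \int[mu]_(x in D) f x - \int[mu]_(x in D) g x.
Proof. by move=> bf bg; apply: RintegralB => //; exact: bm_integrable. Qed.

Lemma bm_RintegralZl f k : bm f ->
  \int[mu]_(x in D) (k * f x) = k * \int[mu]_(x in D) f x.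
Proof. by move=> bf; apply: RintegralZl => //; exact: bm_integrable. Qed.

Lemma bm_RintegralZr f k : bm f ->
  \int[mu]_(x in D) (f x * k) = (\int[mu]_(x in D) f x) * k.
Proof. by move=> bf; apply: RintegralZr => //; exact: bm_integrable. Qed.

Lemma bm_RintegralN f : bm f ->
  \int[mu]_(x in D) (- f x) = - \int[mu]_(x in D) f x.
Proof.
move=> bf; rewrite -mulN1r -bm_RintegralZl//.
by apply: eq_Rintegral => x _; rewrite mulN1r.
Qed.

Lemma bm_le_norm_Rintegral f : bm f ->
  `|\int[mu]_(x in D) f x| <= \int[mu]_(x in D) `|f x|.
Proof. by move=> bf; apply: le_normr_Rintegral => //; exact: bm_integrable. Qed.

Lemma Rintegral_bound f M : bm f -> (forall x, D x -> `|f x| <= M) ->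
  `|\int[mu]_(x in D) f x| <= M * fine (mu D).
Proof.
move=> bf fM; rewrite (le_trans (bm_le_norm_Rintegral bf))//.
rewrite -Rintegral_cst//; apply: bm_le_Rintegral => //.
  exact: bm_norm. exact: bm_cst.
Qed.

Lemma ae_eq_Rintegral f g : measurable_fun D f -> measurable_fun D g ->
  {ae mu, forall x, D x -> f x = g x} ->
  \int[mu]_(x in D) f x = \int[mu]_(x in D) g x.
Proof.
move=> mf mg fg; rewrite /Rintegral; congr fine; apply: ae_eq_integral => //.
- exact/measurable_EFinP.
- exact/measurable_EFinP.
- by apply: filterS fg => x fg Dx; rewrite fg.
Qed.

Lemma bm_ae_eq f g : bm f -> bm g -> {ae mu, forall x, D x -> f x = g x} ->
  \int[mu]_(x in D) f x = \int[mu]_(x in D) g x.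
Proof.
by move=> [mf _] [mg _]; apply: ae_eq_Rintegral;
  [exact: measurable_funS mf|exact: measurable_funS mg].
Qed.

Lemma bm_ae_le f g : bm f -> bm g -> {ae mu, forall x, D x -> f x <= g x} ->
  \int[mu]_(x in D) f x <= \int[mu]_(x in D) g x.
Proof.
move=> bf bg fg.
have bmin : bm (fun x => Order.min (f x) (g x)).
  move: bf bg => [mf [M fM]] [mg [N gN]]; split; first exact: measurable_minr.
  exists (M + N) => x; have M0 := le_trans (normr_ge0 _) (fM x).
  have N0 := le_trans (normr_ge0 _) (gN x).
  case: (leP (f x) (g x)) => _; first by rewrite (le_trans (fM x)) ?lerDl.
  by rewrite (le_trans (gN x)) ?lerDr.
rewrite (bm_ae_eq bf bmin) ?bm_le_Rintegral//; last first.
  by apply: filterS fg => x fg Dx; rewrite min_l// fg.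
by move=> x _; rewrite ge_min lexx orbT.
Qed.

Lemma bounded_cvg (f_ : nat -> T -> R) f (M : R) :
  (forall n, measurable_fun setT (f_ n)) -> bm f ->
  (forall n x, D x -> `|f_ n x| <= M) ->
  {ae mu, forall x, D x -> f_ n x @[n --> \oo] --> f x} ->
  \int[mu]_(x in D) f_ n x @[n --> \oo] --> \int[mu]_(x in D) f x.
Proof.
move=> mf_ bf fM cf.
have [|||||] := @dominated_convergence _ T R mu D mD (fun n => EFin \o f_ n) (EFin \o f)
   (cst M%:E).
- by move=> n; apply/measurable_EFinP; exact: measurable_funS (mf_ n).
- by apply/measurable_EFinP; exact: measurable_funS bf.1.
- by apply: filterS cf => x cf Dx; apply/cvg_EFin; [exact: nearW|exact: cf].
- by apply: (@bm_integrable _ _ _ mu D (cst M)) => //; exact: bm_cst.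
- by apply: aeW => x n Dx /=; rewrite lee_fin fM.
move=> intf _ h; rewrite /Rintegral.
apply: fine_cvg; rewrite fineK//; exact: integrable_fin_num.
Qed.

Lemma bounded_cvg_L1 (f_ : nat -> T -> R) f (M : R) :
  (forall n, measurable_fun setT (f_ n)) -> bm f ->
  (forall n x, D x -> `|f_ n x| <= M) ->
  {ae mu, forall x, D x -> f_ n x @[n --> \oo] --> f x} ->
  \int[mu]_(x in D) `|f_ n x - f x| @[n --> \oo] --> (0 : R).
Proof.
move=> mf_ bf fM cf; have [mf [N fN]] := bf.
rewrite (_ : 0 = \int[mu]_(x in D) (fun=> 0) x); last by rewrite Rintegral_cst// mul0r.
apply: (@bounded_cvg _ _ (M + N)).
- by move=> n; apply: measurableT_comp => //; exact: measurable_funB.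
- exact: bm_cst.
- by move=> n x Dx; rewrite normr_id (le_trans (ler_normB _ _))// lerD// fM.
- apply: filterS cf => x /[apply] cf.
  by apply/norm_cvg0P; rewrite -(subrr (f x)); apply: cvgB => //; exact: cvg_cst.
Qed.

End bounded_integral.

Section parametric_integral.
Context (R : realType).
Local Notation leb := (@lebesgue_measure R).

(** The positive and negative parts have measurable partial integrals by
    Tonelli's theorem, and the real integral is obtained from them by
    measurable operations. *)
Lemma measurable_Rintegral_param d (T : measurableType d) (F : T * R -> R) (D : set R) :
  measurable D -> measurable_fun setT F ->
  measurable_fun setT (fun x => \int[leb]_(y in D) F (x, y)).
Proof.
move=> mD mF.
pose G := fun p : T * R => ((F p * \1_D p.2)%:E)%E.
have mG : measurable_fun setT G.
  apply/measurable_EFinP/measurable_funM => //.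
  by apply: measurableT_comp => //; exact: measurable_indic.
have -> : (fun x => \int[leb]_(y in D) F (x, y)) =
    (fun x => fine (\int[leb]_y (G^\+ (x, y)) - \int[leb]_y (G^\- (x, y)))%E).
  apply/funext => x; rewrite Rintegral_mkcond /Rintegral integralE.
  congr (fine (_ - _)%E); apply: eq_integral => y _.
    rewrite !funeposE /G /=; congr (maxe _ _); congr (_%:E).
    by rewrite patchE indicE; case: ifP => _; rewrite ?mulr1 ?mulr0.
  rewrite !funenegE /G /=; congr (maxe _ _); congr (- _%:E)%E.
  by rewrite patchE indicE; case: ifP => _; rewrite ?mulr1 ?mulr0.
apply: measurableT_comp => //.
apply: emeasurable_funB.
- apply: (@measurable_fun_fubini_tonelli_F _ _ T (measurableTypeR R) R leb (G^\+)%E).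
    exact: measurable_funepos.
  by move=> p; exact: funepos_ge0.
- apply: (@measurable_fun_fubini_tonelli_F _ _ T (measurableTypeR R) R leb (G^\-)%E).
    exact: measurable_funeneg.
  by move=> p; exact: funeneg_ge0.
Qed.

Lemma bm_param d (T : measurableType d) (F : T * R -> R) (D : set R) :
  measurable D -> (leb D < +oo)%E -> bm F ->
  bm (fun x => \int[leb]_(y in D) F (x, y)).
Proof.
move=> mD Dfin bF; split; first exact: measurable_Rintegral_param bF.1.
have [mF [M FM]] := bF; exists (M * fine (leb D)) => x.
apply: Rintegral_bound => //; apply: (bm_comp _ bF).
exact: measurable_pair1.
Qed.

Lemma bm_swap (F : R * R -> R) (D1 D2 : set R) :
  measurable D1 -> (leb D1 < +oo)%E -> measurable D2 -> (leb D2 < +oo)%E ->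
  bm F ->
  \int[leb]_(x in D1) (\int[leb]_(y in D2) F (x, y)) =
  \int[leb]_(y in D2) (\int[leb]_(x in D1) F (x, y)).
Proof.
move=> mD1 D1fin mD2 D2fin bF.
have mD : measurable (D1 `*` D2) by exact: measurableX.
have bG : bm (fun p : R * R => F p * \1_(D1 `*` D2) p).
  by apply: bmM => //; exact: bm_indic.
have h12 : (leb \x leb)%E.-integrable setT
    (EFin \o (fun p : R * R => F p * \1_(D1 `*` D2) p)).
  have : (leb \x leb)%E.-integrable (D1 `*` D2) (EFin \o F).
    apply: bm_integrable => //.
    rewrite (_ : (_ (D1 `*` D2) = leb D1 * leb D2)%E); last exact: product_measure1E.
    by rewrite lte_mul_pinfty// ge0_fin_numE.
  rewrite integrable_mkcond// => /eq_integrable; apply => //.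
  move=> p _; rewrite /= patchE indicE; case: ifP => _; rewrite /= ?mulr1//.
  by rewrite mulr0.
have := Fubini h12.
rewrite /fubini_F /fubini_G.
have E1 x : (\int[leb]_y (F (x, y) * \1_(D1 `*` D2) (x, y))%:E)%E =
    (((fun x => \int[leb]_(y in D2) F (x, y)) \_ D1) x)%:E.
  rewrite patchE; case: ifP => xD1.
    rewrite /Rintegral fineK; last first.
      apply: integrable_fin_num => //; apply: bm_integrable => //.
      by apply: (bm_comp _ bF); exact: measurable_pair1.
    rewrite [RHS]integral_mkcond; apply: eq_integral => y _.
    rewrite patchE indicE in_setX/= xD1/=.
    by case: (y \in D2); rewrite ?mulr1 ?mulr0.
  apply: integral0_eq => y _.
  by rewrite indicE in_setX/= xD1/= mulr0.
have E2 y : (\int[leb]_x (F (x, y) * \1_(D1 `*` D2) (x, y))%:E)%E =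
    (((fun y => \int[leb]_(x in D1) F (x, y)) \_ D2) y)%:E.
  rewrite patchE; case: ifP => yD2.
    rewrite /Rintegral fineK; last first.
      apply: integrable_fin_num => //; apply: bm_integrable => //.
      by apply: (bm_comp _ bF); exact: measurable_pair2.
    rewrite [RHS]integral_mkcond; apply: eq_integral => x _.
    rewrite patchE indicE in_setX/= yD2 andbT.
    by case: (x \in D1); rewrite ?mulr1 ?mulr0.
  apply: integral0_eq => x _.
  by rewrite indicE in_setX/= yD2 andbF mulr0.
move=> E; rewrite [LHS]Rintegral_mkcond [RHS]Rintegral_mkcond /Rintegral; congr fine.
apply: etrans (etrans _ E) _; first by apply: eq_integral => x _; rewrite -E1.
by apply: eq_integral => y _; rewrite -E2.
Qed.

Lemma measurable_addr (h : R) :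
  measurable_fun setT ((fun x : R => x + h) : measurableTypeR R -> measurableTypeR R).
Proof. by apply: measurable_funD => //; exact: measurable_cst. Qed.

Lemma lebesgue_measure_translate (h : R) (A : set R) : measurable A ->
  leb ((fun x => x + h) @^-1` A) = leb A.
Proof.
move=> mA; have mh := measurable_addr h.
rewrite [RHS](@lebesgue_measure_unique R
  (pushforward leb ((fun x => x + h) : measurableTypeR R -> measurableTypeR R)))//.
move=> _ [[a b] _ <-] /=; rewrite /pushforward.
rewrite (_ : _ @^-1` _ = `]a - h, b - h]%classic).
  by rewrite !lebesgue_measure_itv/= !lte_fin ltrD2r !EFinN; case: ifP => // _;
    rewrite -!EFinB; congr (_%:E); lra.
by apply/seteqP; split => x /=; rewrite !in_itv/= => /andP[? ?]; apply/andP; split; lra.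
Qed.

Lemma ae_translate (h : R) (P : R -> Prop) : {ae leb, forall x, P x} ->
  {ae leb, forall x, P (x + h)}.
Proof.
move=> [N [mN N0 PN]]; exists ((fun x => x + h) @^-1` N); split.
- by rewrite -[X in measurable X]setTI; exact: measurable_addr.
- by rewrite lebesgue_measure_translate.
- by move=> x /= nP; exact: PN.
Qed.

Lemma Rintegral_translate (h : R) (D : set R) (f : R -> R) :
  measurable D -> (leb D < +oo)%E -> bm f ->
  \int[leb]_(x in (fun x => x + h) @^-1` D) f (x + h) = \int[leb]_(x in D) f x.
Proof.
move=> mD Dfin bf; have mh := measurable_addr h.
have mD' : measurable ((fun x => x + h) @^-1` D).
  by rewrite -[X in measurable X]setTI; exact: mh.
rewrite /Rintegral; congr fine.
have := @integral_pushforward _ _ _ _ _ _ mh leb D (EFin \o f).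
rewrite /= => <-//.
- apply: eq_measure_integral => A mA _ /=.
  by rewrite /pushforward lebesgue_measure_translate.
- by apply/measurable_EFinP; exact: bf.1.
- apply: (@bm_integrable _ _ _ leb _ (fun x => f (x + h))) => //.
    apply: le_lt_trans Dfin; rewrite le_eqVlt; apply/orP; left; apply/eqP.
    exact: lebesgue_measure_translate.
  exact: bm_comp bf.
Qed.

(** The measures of the sections of a null set have integral 0. *)
Lemma ae_section (P : R * R -> Prop) :
  {ae (leb \x leb)%E, forall p, P p} ->
  {ae leb, forall t, {ae leb, forall x, P (x, t)}}.
Proof.
move=> [N [mN N0 PN]].
have : (\int[leb]_t leb (ysection N t) = 0)%E.
  rewrite -[RHS]N0.
  by apply/esym/(@product_measure_unique _ _ _ _ _ leb leb (leb \x^ leb)%E) => // A B mA mB; exact: product_measure2E.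
move=> I0.
have mf : measurable_fun setT (fun t => leb (ysection N t)).
  exact: measurable_fun_ysection.
have I0' : (\int[leb]_t `|leb (ysection N t)| = 0)%E.
  by rewrite -[RHS]I0; apply: eq_integral => t _; rewrite gee0_abs.
move/(ae_eq_integral_abs leb measurableT mf) : I0'.
apply: filterS => t /(_ I) /= Nt0; exists (ysection N t); split => //.
  exact: measurable_ysection.
by move=> x /= nP; rewrite /ysection/= inE; apply: PN.
Qed.

End parametric_integral.

(** * Functions with a bounded derivative *)

Section intervals.
Context (R : realType).
Local Notation leb := (@lebesgue_measure R).

Lemma leb_itv_lty (b1 b2 : bool) (a b : R) :
  (leb [set` Interval (BSide b1 a) (BSide b2 b)] < +oo)%E.
Proof.
by rewrite lebesgue_measure_itv/=; case: ifP => // _; rewrite -EFinB ltry.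
Qed.

Lemma fine_leb_itv (b1 b2 : bool) (a b : R) : a <= b ->
  fine (leb [set` Interval (BSide b1 a) (BSide b2 b)]) = b - a.
Proof.
rewrite le_eqVlt => /predU1P[->|ab].
  by rewrite lebesgue_measure_itv/= lte_fin ltxx subrr.
by rewrite lebesgue_measure_itv/= lte_fin ab.
Qed.

Lemma Rintegral_itv_closed (b1 b2 : bool) (a b : R) (f : R -> R) : bm f ->
  \int[leb]_(x in [set` Interval (BSide b1 a) (BSide b2 b)]) f x =
  \int[leb]_(x in `[a, b]) f x.
Proof.
move=> bf.
have intf (c1 c2 : bool) : leb.-integrable [set` Interval (BSide c1 a) (BSide c2 b)] (EFin \o f).
  by apply: bm_integrable => //; exact: leb_itv_lty.
have -> : \int[leb]_(x in [set` Interval (BSide b1 a) (BSide b2 b)]) f x =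
    \int[leb]_(x in [set` Interval (BSide b1 a) (BRight b)]) f x.
  by case: b2 => //; rewrite Rintegral_itv_bndo_bndc.
by case: b1 => //; rewrite Rintegral_itv_obnd_cbnd.
Qed.

Lemma Rintegral_itv_cat (a b c : R) (f : R -> R) : bm f -> a <= b -> b <= c ->
  \int[leb]_(x in `[a, c]) f x =
  \int[leb]_(x in `[a, b]) f x + \int[leb]_(x in `[b, c]) f x.
Proof.
move=> bf ab bc; apply/esym/eqP; rewrite addrC eq_sym -subr_eq; apply/eqP.
rewrite Rintegral_itvB ?bnd_simp//; last first.
  by apply: bm_integrable => //; exact: leb_itv_lty.
exact: Rintegral_itv_closed.
Qed.

Lemma Rintegral_itv_bound (a b M : R) (f : R -> R) : bm f -> a <= b ->
  (forall x, a <= x <= b -> `|f x| <= M) ->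
  `|\int[leb]_(x in `[a, b]) f x| <= M * (b - a).
Proof.
move=> bf ab fM; rewrite -(fine_leb_itv true false ab).
apply: Rintegral_bound => //; first exact: leb_itv_lty.
Qed.

Lemma Rintegral_subset (D E : set R) (f : R -> R) :
  D `<=` E -> (forall x, E x -> ~ D x -> f x = 0) ->
  \int[leb]_(x in D) f x = \int[leb]_(x in E) f x.
Proof.
move=> DE f0; rewrite [LHS]Rintegral_mkcond [RHS]Rintegral_mkcond.
apply: eq_Rintegral => x _; rewrite !patchE.
have [xD|xD] := boolP (x \in D).
  by rewrite (mem_set (DE _ (set_mem xD))).
case: ifPn => // xE; rewrite f0//; first exact: set_mem.
by move=> Dx; rewrite (mem_set Dx) in xD.
Qed.

Section interval_integrals.
Context (b1 b2 : bool) (a b : R).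
Local Notation D := [set` Interval (BSide b1 a) (BSide b2 b)].
Implicit Types f g : R -> R.
Let mD : measurable (D : set (measurableTypeR R)). Proof. exact: measurable_itv. Qed.
Let Dfin : (leb D < +oo)%E. Proof. exact: leb_itv_lty. Qed.

Lemma itvD f g : bm f -> bm g ->
  \int[leb]_(x in D) (f x + g x) = \int[leb]_(x in D) f x + \int[leb]_(x in D) g x.
Proof. exact: (bm_RintegralD mD Dfin). Qed.

Lemma itvB f g : bm f -> bm g ->
  \int[leb]_(x in D) (f x - g x) = \int[leb]_(x in D) f x - \int[leb]_(x in D) g x.
Proof. exact: (bm_RintegralB mD Dfin). Qed.

Lemma itvZl k f : bm f ->
  \int[leb]_(x in D) (k * f x) = k * \int[leb]_(x in D) f x.
Proof. exact: (bm_RintegralZl mD Dfin). Qed.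

Lemma itvZr k f : bm f ->
  \int[leb]_(x in D) (f x * k) = (\int[leb]_(x in D) f x) * k.
Proof. exact: (bm_RintegralZr mD Dfin). Qed.

Lemma itvN f : bm f -> \int[leb]_(x in D) (- f x) = - \int[leb]_(x in D) f x.
Proof. exact: (bm_RintegralN mD Dfin). Qed.

Lemma itv_le f g : bm f -> bm g -> (forall x, D x -> f x <= g x) ->
  \int[leb]_(x in D) f x <= \int[leb]_(x in D) g x.
Proof. exact: (bm_le_Rintegral mD Dfin). Qed.

Lemma itv_norm f : bm f ->
  `|\int[leb]_(x in D) f x| <= \int[leb]_(x in D) `|f x|.
Proof. exact: (bm_le_norm_Rintegral mD Dfin). Qed.

Lemma itv_ae_eq f g : bm f -> bm g -> {ae leb, forall x, D x -> f x = g x} ->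
  \int[leb]_(x in D) f x = \int[leb]_(x in D) g x.
Proof. exact: (bm_ae_eq mD). Qed.

Lemma itv_ae_le f g : bm f -> bm g -> {ae leb, forall x, D x -> f x <= g x} ->
  \int[leb]_(x in D) f x <= \int[leb]_(x in D) g x.
Proof. exact: (bm_ae_le mD Dfin). Qed.

End interval_integrals.

End intervals.

Section primitives.
Context (R : realType).
Local Notation leb := (@lebesgue_measure R).

(** Cutting [[a, b]] into n equal pieces bounds [Q a b] by [C (b - a)^2 / n].
    Applied to the defect of the product rule and of the chain rule, this
    proves them for Lipschitz functions without using their differentiability
    almost everywhere. *)
Lemma additive_quadratic_eq0 (Q : R -> R -> R) (C : R) :
  (forall a b c, a <= b -> b <= c -> Q a c = Q a b + Q b c) ->
  (forall a b, a <= b -> `|Q a b| <= C * (b - a) ^+ 2) ->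
  forall a b, a <= b -> Q a b = 0.
Proof.
move=> addQ quadQ a b ab.
have sub (h : R) (n : nat) : 0 <= h -> `|Q a (a + n%:R * h)| <= n%:R * (C * h ^+ 2).
  move=> h0; elim: n => [|n IH].
    by rewrite !mul0r addr0 (le_trans (quadQ _ _ _))// subrr expr0n/= mulr0.
  have nh0 : 0 <= n%:R * h by rewrite mulr_ge0.
  rewrite (addQ _ (a + n%:R * h)); [|by rewrite lerDl|by rewrite lerD2l ler_wpM2r// ler_nat].
  rewrite -addn1 natrD !mulrDl !mul1r (le_trans (ler_normD _ _))// lerD//.
  rewrite (le_trans (quadQ _ _ _))//; first by rewrite addrA lerDl.
  by rewrite (_ : _ - _ = h)//; ring.
apply/eqP; rewrite -normr_le0; apply/ler_addgt0Pr => e e0; rewrite add0r.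
have C0 : 0 <= C.
  have := quadQ 0 1 ler01; rewrite subr0 expr1n mulr1; exact: le_trans.
pose n := (Num.truncn (C * (b - a) ^+ 2 / e)).+1.
have n0 : (0 : R) < n%:R by rewrite ltr0n.
have := sub ((b - a) / n%:R) n; rewrite mulrCA divff ?gt_eqF// mulr1 [a + _]addrC subrK.
move=> /(_ _)/le_trans; apply; first by rewrite divr_ge0// subr_ge0.
rewrite (_ : n%:R * _ = C * (b - a) ^+ 2 / n%:R); last by field; rewrite gt_eqF.
rewrite ler_pdivrMr// [e * _]mulrC -ler_pdivrMr//.
by rewrite ltW// truncnS_gt// divr_ge0 ?mulr_ge0 ?sqr_ge0 // ltW.
Qed.

(** [F] is Lipschitz and [al] is its derivative almost everywhere; only the
    increments of [F] are ever used. *)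
Definition bprim (F al : R -> R) : Prop :=
  [/\ bm F, bm al &
      forall x y, x <= y -> F y - F x = \int[leb]_(z in `[x, y]) al z].

Lemma bprim_lip F al : bprim F al ->
  exists2 K : R, 0 <= K & forall x y, `|F y - F x| <= K * `|y - x|.
Proof.
move=> [_ bal Fal]; have [_ [M alM]] := bal.
exists `|M| => //.
have main x y : x <= y -> `|F y - F x| <= `|M| * `|y - x|.
  move=> xy; rewrite Fal// [`|y - x|]ger0_norm ?subr_ge0//.
  apply: Rintegral_itv_bound => // z _.
  by rewrite (le_trans (alM z))// ler_norm.
move=> x y; case: (leP x y) => [|/ltW]; first exact: main.
by rewrite distrC [`|y - x|]distrC; exact: main.
Qed.

Lemma lip_continuous (F : R -> R) (K : R) :
  (forall x y, `|F y - F x| <= K * `|y - x|) -> continuous F.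
Proof.
move=> FK x; apply/cvgrPdist_le => e e0.
have K0 : 0 <= K.
  by have := FK 0 1; rewrite subr0 normr1 mulr1; exact: le_trans.
have K1 : 0 < K + 1 by lra.
near=> y; rewrite (le_trans (FK _ _))//.
rewrite (@le_trans _ _ ((K + 1) * `|x - y|))//.
  by rewrite ler_wpM2r// lerDl.
rewrite mulrC -ler_pdivlMr//.
near: y; apply: cvgr_dist_le; [exact: cvg_id|exact: divr_gt0].
Unshelve. all: end_near. Qed.

Lemma bprim_continuous F al : bprim F al -> continuous F.
Proof. by move=> /bprim_lip[K _ FK]; exact: lip_continuous FK. Qed.

Lemma bprim_cst (k : R) : bprim (fun=> k) (fun=> 0).
Proof.
split; [exact: bm_cst|exact: bm_cst|].
by move=> x y xy; rewrite subrr Rintegral_cst// mul0r.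
Qed.

Lemma bprimD F al G be : bprim F al -> bprim G be ->
  bprim (fun x => F x + G x) (fun x => al x + be x).
Proof.
move=> [bF bal Fal] [bG bbe Gbe]; split; [exact: bmD|exact: bmD|].
move=> x y xy; rewrite bm_RintegralD//; last exact: leb_itv_lty.
by rewrite -Fal// -Gbe//; ring.
Qed.

Lemma bprimN F al : bprim F al -> bprim (fun x => - F x) (fun x => - al x).
Proof.
move=> [bF bal Fal]; split; [exact: bmN|exact: bmN|].
move=> x y xy; rewrite bm_RintegralN//; last exact: leb_itv_lty.
by rewrite -Fal//; ring.
Qed.

Lemma bprimB F al G be : bprim F al -> bprim G be ->
  bprim (fun x => F x - G x) (fun x => al x - be x).
Proof. by move=> Fal Gbe; apply: bprimD => //; exact: bprimN. Qed.

(** The defect of the formula on an interval is additive, and quadratic in the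
    length because both factors are Lipschitz. *)
Lemma bprimM F al G be : bprim F al -> bprim G be ->
  bprim (fun x => F x * G x) (fun x => al x * G x + F x * be x).
Proof.
move=> Fal Gbe; have [K K0 FK] := bprim_lip Fal; have [L L0 GL] := bprim_lip Gbe.
have [bF bal HF] := Fal; have [bG bbe HG] := Gbe.
have [_ [A alA]] := bal; have [_ [B beB]] := bbe.
have A0 : 0 <= A by exact: le_trans (alA 0).
have B0 : 0 <= B by exact: le_trans (beB 0).
have bc : bm (fun x => al x * G x + F x * be x).
  by apply: bmD; exact: bmM.
split => //; first exact: bmM.
move=> x y xy; apply/eqP; rewrite -subr_eq0; apply/eqP.
pose Q a b := F b * G b - F a * G a - \int[leb]_(z in `[a, b]) (al z * G z + F z * be z).
apply: (@additive_quadratic_eq0 Q (A * L + K * B)) xy => {x y}.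
  by move=> a b c ab bc'; rewrite /Q (Rintegral_itv_cat bc ab bc'); ring.
move=> a b ab; have Dfin := leb_itv_lty true false a b.
have -> : Q a b = \int[leb]_(z in `[a, b]) (al z * (G b - G z) + (F a - F z) * be z).
  rewrite /Q.
  have -> : F b * G b - F a * G a = (F b - F a) * G b + F a * (G b - G a) by ring.
  rewrite HF// HG// -bm_RintegralZr// -bm_RintegralZl//.
  have b1 : bm (fun z => al z * G b) by apply: bmM => //; exact: bm_cst.
  have b2 : bm (fun z => F a * be z) by apply: bmM => //; exact: bm_cst.
  rewrite -bm_RintegralD// -bm_RintegralB//; last exact: bmD.
  by apply: eq_Rintegral => z _; ring.
rewrite (_ : _ * _ = ((A * L + K * B) * (b - a)) * (b - a)); last by ring.
apply: Rintegral_itv_bound => //.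
  by apply: bmD; apply: bmM => //; apply: bmB => //; exact: bm_cst.
move=> z /andP[az zb]; rewrite (le_trans (ler_normD _ _))// !normrM mulrDl lerD//.
  rewrite -mulrA ler_pM// (le_trans (GL _ _))// ler_wpM2l//.
  by rewrite ger0_norm ?subr_ge0// lerD2l lerN2.
rewrite mulrAC ler_pM// (le_trans (FK _ _))// ler_wpM2l// distrC.
by rewrite ger0_norm ?subr_ge0// lerD2r.
Qed.

(** First order expansions with uniform quadratic remainder: the form in which
    the smoothness of [S] enters the chain rule. *)
Definition C11 (S S1 : R -> R) : Prop :=
  exists2 C : R, forall u v, `|S v - S u - S1 u * (v - u)| <= C * (v - u) ^+ 2
               & forall u v, `|S1 v - S1 u| <= C * `|v - u|.

Lemma C11_continuous' S S1 : C11 S S1 -> continuous S1.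
Proof. by case=> C _ /lip_continuous. Qed.

Lemma C11_continuous S S1 : C11 S S1 -> continuous S.
Proof.
move=> [C SC _] u.
have C0 : 0 <= C.
  by have := SC 0 1; rewrite subr0 expr1n !mulr1; exact: le_trans.
apply/cvgrPdist_le => e e0.
have K1 : 0 < `|S1 u| + C + 1 by rewrite ltr_wpDl// addr_ge0.
near=> v.
have uv1 : `|u - v| <= 1.
  by near: v; apply: cvgr_dist_le => //; exact: cvg_id.
have uve : `|u - v| <= e / (`|S1 u| + C + 1).
  by near: v; apply: cvgr_dist_le; [exact: cvg_id|exact: divr_gt0].
rewrite distrC (_ : S v - S u = (S v - S u - S1 u * (v - u)) + S1 u * (v - u)); last ring.
rewrite (le_trans (ler_normD _ _))// normrM.
rewrite (le_trans (lerD (SC _ _) (lexx _)))//.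
rewrite -real_normK ?num_real// expr2 distrC.
rewrite ler_pdivlMr// in uve; apply: le_trans uve.
rewrite mulrDr mulr1 mulrDr ler_wpDr// addrC lerD//; first by rewrite mulrC.
by rewrite mulrC ler_pM// ?mulr_ge0// ler_piMr.
Unshelve. all: end_near. Qed.

(** Here too the defect on an interval is additive and quadratic in the
    length. *)
Lemma bprim_comp S S1 F al : C11 S S1 -> bprim F al ->
  bprim (fun x => S (F x)) (fun x => S1 (F x) * al x).
Proof.
move=> SS Fal; have [K K0 FK] := bprim_lip Fal; have [bF bal HF] := Fal.
have [C SC S1C] := SS; have [_ [A alA]] := bal.
have A0 : 0 <= A by exact: le_trans (alA 0).
have C0 : 0 <= C.
  by have := S1C 0 1; rewrite subr0 normr1 !mulr1; exact: le_trans.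
have bS1F : bm (fun x => S1 (F x)).
  by apply: bm_continuous_comp => //; exact: C11_continuous' SS.
have bc : bm (fun x => S1 (F x) * al x) by exact: bmM.
split => //; first by apply: bm_continuous_comp => //; exact: C11_continuous SS.
move=> x y xy; apply/eqP; rewrite -subr_eq0; apply/eqP.
pose Q a b := S (F b) - S (F a) - \int[leb]_(z in `[a, b]) (S1 (F z) * al z).
apply: (@additive_quadratic_eq0 Q (C * K ^+ 2 + C * K * A)) xy => {x y}.
  by move=> a b c ab bc'; rewrite /Q (Rintegral_itv_cat bc ab bc'); ring.
move=> a b ab; have Dfin := leb_itv_lty true false a b.
have -> : Q a b = (S (F b) - S (F a) - S1 (F a) * (F b - F a)) +
    \int[leb]_(z in `[a, b]) ((S1 (F a) - S1 (F z)) * al z).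
  have -> : \int[leb]_(z in `[a, b]) ((S1 (F a) - S1 (F z)) * al z) =
    \int[leb]_(z in `[a, b]) (S1 (F a) * al z) - \int[leb]_(z in `[a, b]) (S1 (F z) * al z).
    rewrite -bm_RintegralB//; last by apply: bmM => //; exact: bm_cst.
    by apply: eq_Rintegral => z _; ring.
  by rewrite bm_RintegralZl// -HF// /Q; ring.
rewrite (le_trans (ler_normD _ _))// mulrDl lerD//.
  rewrite (le_trans (SC _ _))// -mulrA ler_wpM2l//.
  rewrite -exprMn -[leLHS]real_normK ?num_real// ler_pXn2r// ?nnegrE ?mulr_ge0 ?subr_ge0//.
  by rewrite (le_trans (FK _ _))// ger0_norm// subr_ge0.
rewrite (_ : _ * _ = ((C * K * A) * (b - a)) * (b - a)); last by ring.
apply: Rintegral_itv_bound => //.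
  by apply: bmM => //; apply: bmB => //; exact: bm_cst.
move=> z /andP[az zb]; rewrite normrM [leRHS]mulrAC ler_pM//.
rewrite (le_trans (S1C _ _))// -mulrA ler_wpM2l// (le_trans (FK _ _))// ler_wpM2l//.
by rewrite distrC ger0_norm ?subr_ge0// lerD2r.
Qed.

(** No boundary term, as one of the factors vanishes at both ends. *)
Lemma bprim_parts F al G be (a b : R) : a <= b -> bprim F al -> bprim G be ->
  F a = 0 -> F b = 0 ->
  \int[leb]_(z in `[a, b]) (al z * G z) = - \int[leb]_(z in `[a, b]) (F z * be z).
Proof.
move=> ab Fal Gbe Fa Fb; have [_ _ /(_ _ _ ab)] := bprimM Fal Gbe.
rewrite Fa Fb !mul0r subrr => /esym/eqP.
have [bF bal _] := Fal; have [bG bbe _] := Gbe.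
rewrite bm_RintegralD//; [|exact: leb_itv_lty|exact: bmM|exact: bmM].
by rewrite addr_eq0 => /eqP.
Qed.

Lemma bm_indefinite d (T : measurableType d) (c e : R) (f : T * R -> R) : bm f ->
  (forall p, p.2 < c \/ e < p.2 -> f p = 0) ->
  bm (fun p : T * R => \int[leb]_(y in `[c, p.2]) f (p.1, y)).
Proof.
move=> bf f0.
pose A : set ((T * R) * R) := [set q | q.2 <= q.1.2].
have -> : (fun p : T * R => \int[leb]_(y in `[c, p.2]) f (p.1, y)) =
  (fun p : T * R => \int[leb]_(y in `[c, e]) (fun q : (T * R) * R => (f (q.1.1, q.2) * \1_A q)) (p, y)).
  apply/funext => -[t x]/=.
  rewrite [LHS]Rintegral_mkcond [RHS]Rintegral_mkcond; apply: eq_Rintegral => y _.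
  have HA : ((t, x, y) \in A) = (y <= x) by apply/idP/idP; rewrite inE.
  rewrite !patchE indicE HA !mem_setE !in_itv/=.
  have [cy|cy] := leP c y => //=.
  have [ye|ye] := leP y e => /=.
    by case: (y <= x); rewrite ?mulr1 ?mulr0.
  by case: ifP => // _; rewrite f0//; right.
apply: (@bm_param R _ _ (fun q => f (q.1.1, q.2) * \1_A q)) => //; first exact: leb_itv_lty.
apply: bmM.
  apply: (bm_comp (h := fun q : (T * R) * R => (q.1.1, q.2))) bf.
  apply/measurable_fun_pairP; split; last exact: measurable_snd.
  exact: (measurableT_comp measurable_fst measurable_fst).
apply: bm_indic; rewrite -[X in measurable X]setTI.
have := @measurable_fun_ler _ _ R setT (fun q : (T * R) * R => q.2) (fun q => q.1.2).
move=> /(_ _ _ measurableT [set true]); apply => //.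
  exact: measurable_snd.
exact: (measurableT_comp measurable_snd measurable_fst).
Qed.

Lemma bprim_indefinite (c e : R) (al : R -> R) : bm al ->
  (forall y, y < c \/ e < y -> al y = 0) ->
  bprim (fun x => \int[leb]_(y in `[c, x]) al y) al.
Proof.
move=> bal al0; split => //.
  have bF := @bm_indefinite _ R c e (fun p => al p.2).
  apply: (bm_comp (h := (fun x => (0, x)) : R -> R * R) _ (bF _ _)).
  - exact: measurable_pair1.
  - by apply: (bm_comp _ bal); exact: measurable_snd.
  - by move=> -[? y]/=; exact: al0.
have small z : z < c -> \int[leb]_(y in `[c, z]) al y = 0.
  by move=> zc; rewrite set_itv_ge ?Rintegral_set0// bnd_simp -ltNge.
move=> x y xy; have [cx|xc] := leP c x.
  by rewrite (Rintegral_itv_cat bal cx xy); ring.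
rewrite (small _ xc) subr0.
have [cy|yc] := leP c y.
  rewrite (Rintegral_itv_cat bal (ltW xc) cy) -(Rintegral_itv_closed true true x c bal).
  rewrite [X in _ = X + _](eq_Rintegral _ _ (g := fun=> 0)) ?Rintegral_cst ?mul0r ?add0r//.
  by move=> z; rewrite inE/= in_itv/= => /andP[_ zc]; rewrite al0//; left.
rewrite small// (eq_Rintegral _ _ (g := fun=> 0)) ?Rintegral_cst ?mul0r//.
by move=> z; rewrite inE/= in_itv/= => /andP[_ zc]; rewrite al0//; left; apply: le_lt_trans yc.
Qed.

(** The kernel is at most [C] times the uniform kernel of the same width, so
    the error is at most [C] times the mean oscillation at a Lebesgue point.
    *)
Lemma cvg_kernel (al : R -> R) (ka : nat -> R -> R) (C x : R) : bm al ->
  (forall n, bm (ka n)) -> (forall n y, `|ka n y| <= C * n.+1%:R) ->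
  (forall n, \int[leb]_(y in `[x - n.+1%:R^-1, x + n.+1%:R^-1]) ka n y = 1) ->
  lebesgue_pt al x ->
  \int[leb]_(y in `[x - n.+1%:R^-1, x + n.+1%:R^-1]) (ka n y * al y) @[n --> \oo]
    --> al x.
Proof.
move=> bal bka kaC ka1 alx.
pose I n := `[x - n.+1%:R^-1, x + n.+1%:R^-1]%classic.
pose dav (n : nat) := n.+1%:R / 2 * \int[leb]_(y in I n) `|al y - al x|.
have bd : bm (fun y => `|al y - al x|) by apply: bm_norm; apply: bmB => //; exact: bm_cst.
have dav0 : dav n @[n --> \oo] --> (0 : R).
  have h0 := (cvge_at_rightP _ _ _).1 alx (fun n => n.+1%:R^-1).
  have /fine_cvg : davg al x n.+1%:R^-1 @[n --> \oo] --> 0%:E.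
    by apply: h0; split; [move=> n; rewrite invr_gt0|exact: cvg_harmonic].
  apply: cvg_trans; apply: near_eq_cvg; apply: nearW => n /=.
  rewrite /davg /iavg lebesgue_measure_ball// ?invr_ge0//.
  rewrite ball_itv.
  rewrite (_ : integral _ _ _ = (\int[leb]_(y in `](x - n.+1%:R^-1), (x + n.+1%:R^-1)[) `|al y - al x|)%:E).
    have hn : n.+1%:R^-1 *+ 2 != 0 :> R by rewrite mulrn_eq0/= invr_eq0 pnatr_eq0.
    rewrite inver (negbTE hn) -EFinM/= -[_ *+ 2]mulr_natr invfM invrK.
    by rewrite Rintegral_itv_closed// /dav /I; congr (_ * _).
  rewrite /Rintegral fineK.
    by apply: eq_integral => y _.
  apply: integrable_fin_num => //; apply: (@bm_integrable _ _ _ leb) => //.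
  exact: leb_itv_lty.
apply/cvgrPdist_le => e e0.
have C0 : 0 <= C by have := kaC 0%N 0; rewrite mulr1; exact: le_trans.
have C2 : 0 < 2 * C + 1 by lra.
near=> n.
have davn : `|dav n| <= e / (2 * C + 1).
  rewrite -[dav n]subr0 distrC; near: n.
  by move/cvgrPdist_le : dav0; apply; exact: divr_gt0.
have In : x - n.+1%:R^-1 <= x + n.+1%:R^-1.
  by rewrite lerD2l -subr_ge0 opprK addr_ge0.
have Dfin := leb_itv_lty true false (x - n.+1%:R^-1) (x + n.+1%:R^-1).
have bk1 : bm (fun y => ka n y * al y) by exact: bmM.
have bk2 : bm (fun y => ka n y * al x) by apply: bmM => //; exact: bm_cst.
have E : al x = \int[leb]_(y in I n) (ka n y * al x).
  by rewrite (bm_RintegralZr _ Dfin (al x) (bka n)) ?ka1 ?mul1r//; exact: measurable_itv.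
rewrite {1}E -(bm_RintegralB _ Dfin bk2 bk1); last exact: measurable_itv.
apply: le_trans (bm_le_norm_Rintegral _ Dfin (bmB bk2 bk1)) _; first exact: measurable_itv.
apply: (@le_trans _ _ (2 * C * dav n)); last first.
  rewrite ler_pdivlMr// in davn; apply: le_trans davn.
  rewrite mulrC ler_pM// ?ler_norm//; first by rewrite mulr_ge0 ?divr_ge0 ?Rintegral_ge0.
    by rewrite mulr_ge0.
  by lra.
have -> : 2 * C * dav n = (C * n.+1%:R) * \int[leb]_(y in I n) `|al y - al x|.
  by rewrite /dav; field.
rewrite /I -(itvZl true false _ _ _ bd).
apply: itv_le.
- by apply: bm_norm; exact: bmB.
- by apply: bmM => //; exact: bm_cst.
- by move=> y _; rewrite -mulrBr normrM distrC ler_wpM2r.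
Unshelve. all: end_near. Qed.

Lemma bm_lebesgue_pt (al : R -> R) : bm al -> {ae leb, forall x, lebesgue_pt al x}.
Proof.
move=> bal; apply: lebesgue_differentiation; split; [exact: bal.1|exact: openT|].
move=> K _ cK; have [mal [M alM]] := bal.
have mK : measurable K by exact: compact_measurable.
have := @bm_integrable _ _ _ leb K al mK (compact_finite_measure cK) bal.
by move/integrableP => [_]; under eq_integral do rewrite /=.
Qed.

Lemma cvg_backward_average (al : R -> R) (x : R) : bm al -> lebesgue_pt al x ->
  n.+1%:R * \int[leb]_(y in `[x - n.+1%:R^-1, x]) al y @[n --> \oo] --> al x.
Proof.
move=> bal alx.
pose ka (n : nat) y : R := n.+1%:R * \1_(`[x - n.+1%:R^-1, x]%classic) y.
have bka n : bm (ka n) by apply: bmM; [exact: bm_cst|exact: bm_indic].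
have sub n (f : R -> R) : \int[leb]_(y in `[x - n.+1%:R^-1, x + n.+1%:R^-1]) (ka n y * f y) =
    \int[leb]_(y in `[x - n.+1%:R^-1, x]) (n.+1%:R * f y).
  rewrite [LHS]Rintegral_mkcond [RHS]Rintegral_mkcond; apply: eq_Rintegral => y _.
  rewrite !patchE /ka indicE !mem_setE !in_itv/=.
  have [h1|h1] := leP (x - n.+1%:R^-1) y => //=.
  have [h2|h2] := leP y x; first by rewrite (le_trans h2) ?mulr1// lerDl.
  by case: ifP => // _; rewrite mulr0 mul0r.
have := @cvg_kernel al ka 1 x bal bka; move=> /(_ _ _ alx)/=.
have -> : (fun n => \int[leb]_(y in `[x - n.+1%:R^-1, x + n.+1%:R^-1]) (ka n y * al y)) =
  (fun n => n.+1%:R * \int[leb]_(y in `[x - n.+1%:R^-1, x]) al y).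
  apply/funext => n; rewrite sub bm_RintegralZl//; exact: leb_itv_lty.
apply.
- move=> n y; rewrite mul1r /ka normrM ger0_norm// ler_piMr// indicE.
  by case: (_ \in _); rewrite ?normr1 ?normr0.
- move=> n; have := sub n (fun=> 1).
  under eq_Rintegral do rewrite mulr1.
  move=> ->; rewrite mulr1 Rintegral_cst// fine_leb_itv; last by rewrite gerBl.
  by rewrite opprB addrC subrK mulfV.
Qed.

End primitives.

(** * Smooth test functions *)

Section class_C_closure.
Context (R : realType).

Lemma class_CS (V : normedModType R) k (f : V -> R) : class_C k.+1 f -> class_C k f.
Proof.
elim: k f => [|k IH] f; first by case.
by case=> cf df; split => // v; have [dfv Cv] := df v; split => //; exact: IH.
Qed.

Lemma class_C_cst (V : normedModType R) k (c : R) : class_C k (fun _ : V => c).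
Proof.
elim: k c => [|k IH] c; first by split => //; exact: cst_continuous.
split; first exact: cst_continuous.
move=> v; split; first by move=> x; exact: derivable_cst.
by under eq_fun do rewrite derive_cst; exact: IH.
Qed.

Lemma class_C_add (V : normedModType R) k (f g : V -> R) : class_C k f -> class_C k g ->
  class_C k (fun x => f x + g x).
Proof.
elim: k f g => [|k IH] f g Cf Cg.
  by split => //; move=> x; apply: cvgD; [exact: Cf.1|exact: Cg.1].
split.
  by move=> x; apply: cvgD; [exact: Cf.1|exact: Cg.1].
move=> v; have [dfv Cfv] := Cf.2 v; have [dgv Cgv] := Cg.2 v; split.
  by move=> x; exact: (derivableD (dfv x) (dgv x)).
have -> : (fun x => 'D_v (fun x => f x + g x) x) = (fun x => 'D_v f x + 'D_v g x).
  by apply/funext => x; exact: (deriveD (dfv x) (dgv x)).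
exact: IH.
Qed.

Lemma class_C_mul (V : normedModType R) k (f g : V -> R) : class_C k f -> class_C k g ->
  class_C k (fun x => f x * g x).
Proof.
elim: k f g => [|k IH] f g Cf Cg.
  by split => //; move=> x; apply: cvgM; [exact: Cf.1|exact: Cg.1].
split.
  by move=> x; apply: cvgM; [exact: Cf.1|exact: Cg.1].
move=> v; have [dfv Cfv] := Cf.2 v; have [dgv Cgv] := Cg.2 v; split.
  by move=> x; exact: (derivableM (dfv x) (dgv x)).
have -> : (fun x => 'D_v (fun x => f x * g x) x) =
    (fun x => f x * 'D_v g x + g x * 'D_v f x).
  by apply/funext => x; exact: (deriveM (dfv x) (dgv x)).
by apply: class_C_add; apply: IH => //; exact: class_CS.
Qed.

(** A derivative of [f \o A] in the direction [v] is a derivative of [f] in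
    the direction [L v], where [L] is the linear part of [A]; this is what the
    induction on the order of smoothness needs. *)
Lemma class_C_affine (V W : normedModType R) k (f : W -> R) (A L : V -> W) :
  continuous A -> (forall p v (h : R), A (h *: v + p) = h *: L v + A p) ->
  class_C k f -> class_C k (fun x => f (A x)).
Proof.
move=> cA AL; elim: k f => [|k IH] f Cf.
  by split => // x; apply: continuous_comp; [exact: cA|exact: Cf.1].
split.
  by move=> x; apply: continuous_comp; [exact: cA|exact: Cf.1].
have E v x : (fun h : R => h^-1 *: (((fun y => f (A y)) \o shift x) (h *: v) - f (A x))) =
    (fun h : R => h^-1 *: ((f \o shift (A x)) (h *: L v) - f (A x))).
  by apply/funext => h /=; rewrite AL.
move=> v; have [dfv Cfv] := Cf.2 (L v); split.
  by move=> x; rewrite /derivable E; exact: dfv.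
have -> : (fun x => 'D_v (fun y => f (A y)) x) = (fun x => 'D_(L v) f (A x)).
  by apply/funext => x; rewrite /derive E.
exact: (IH _ Cfv).
Qed.

Lemma derive_scale (f : R -> R) (x v : R) : derivable f x 1 ->
  derivable f x v /\ 'D_v f x = v * 'D_1 f x.
Proof.
move=> df; have /derivable1_diffP Df := df.
split; first exact: diff_derivable.
by rewrite !deriveE// -[v in LHS]mulr1 -[v * 1]/(v *: 1) linearZ.
Qed.

Lemma class_C_step k (f g : R -> R) : (forall x : R, is_derive x (1 : R) f (g x)) ->
  class_C k g -> class_C k.+1 f.
Proof.
move=> fg Cg; split.
  move=> x; have [df _] := fg x.
  by apply/differentiable_continuous/derivable1_diffP.
move=> v; have H x : derivable f x v /\ 'D_v f x = v * g x.
  have [df <-] := fg x; exact: derive_scale.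
split; first by move=> x; exact: (H x).1.
under eq_fun do rewrite (H _).2.
by apply: class_C_mul => //; exact: class_C_cst.
Qed.

End class_C_closure.

Section flat_function.
Context (R : realType).

(** Differentiating [e^(-1/x)] multiplies it by polynomials in [1/x]. Keeping
    this polynomial as a parameter gives a family closed under
    differentiation, hence smooth. *)
Definition flat (P : {poly R}) (x : R) : R :=
  if x <= 0 then 0 else P.[x^-1] * expR (- x^-1).

Lemma monomial_expR_le (n : nat) : exists2 C : R, 0 <= C &
  forall y : R, 0 <= y -> y ^+ n * expR (- y) <= C.
Proof.
exists (n.+1%:R ^+ n.+1 + 1).
  by rewrite addr_ge0// exprn_ge0.
move=> y y0.
have [y1|/ltW y1] := leP y 1.
  rewrite (@le_trans _ _ 1)//; last by rewrite lerDr exprn_ge0.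
  by rewrite mulr_ile1// ?exprn_ge0 ?expR_ge0 ?exprn_ile1// expR_le1 oppr_le0.
rewrite (@le_trans _ _ (y ^+ n.+1 * expR (- y)))//.
  by rewrite ler_wpM2r ?expR_ge0// exprS ler_peMl// exprn_ge0.
rewrite expRN ler_pdivrMr ?expR_gt0//.
have h : (y / n.+1%:R) ^+ n.+1 <= expR y.
  rewrite [X in expR X](_ : y = n.+1%:R * (y / n.+1%:R)); last by rewrite mulrC divfK ?pnatr_eq0.
  rewrite expRM_natl lerXn2r ?nnegrE ?expR_ge0 ?divr_ge0//.
  by rewrite (le_trans _ (expR_ge1Dx _))// lerDr.
rewrite expr_div_n ler_pdivrMr ?exprn_gt0// in h.
by rewrite (le_trans h)// mulrDl mul1r mulrC lerDl expR_ge0.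
Qed.

Lemma poly_expR_le (P : {poly R}) : exists2 C : R, 0 <= C &
  forall y : R, 0 <= y -> `|P.[y]| * expR (- y) <= C.
Proof.
elim/poly_ind: P => [|P c _].
  by exists 0 => // y _; rewrite horner0 normr0 mul0r.
pose Q := P * 'X + c%:P.
have /choice[C HC] : forall i : nat, exists C : R, 0 <= C /\
    forall y : R, 0 <= y -> y ^+ i * expR (- y) <= C.
  by move=> i; have [C C0 HC] := monomial_expR_le i; exists C.
exists (\sum_(i < size Q) `|Q`_i| * C i).
  by apply: sumr_ge0 => i _; rewrite mulr_ge0// (HC i).1.
move=> y y0; rewrite -/Q horner_coef.
rewrite (@le_trans _ _ ((\sum_(i < size Q) `|Q`_i * y ^+ i|) * expR (- y)))//.
  by rewrite ler_wpM2r ?expR_ge0// ler_norm_sum.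
rewrite mulr_suml; apply: ler_sum => i _.
rewrite normrM -mulrA ler_wpM2l// ger0_norm ?exprn_ge0//.
exact: (HC i).2.
Qed.

(** The exponential beats every power of [1/x]; the quadratic bound gives
    derivability at 0. *)
Lemma flat_quadratic (P : {poly R}) : exists2 C : R, 0 <= C &
  forall x : R, `|flat P x| <= C * x ^+ 2.
Proof.
have [C C0 HC] := poly_expR_le (P * 'X^2).
exists C => // x; rewrite /flat; have [x0|x0] := leP x 0.
  by rewrite normr0 mulr_ge0// sqr_ge0.
have := HC x^-1; rewrite invr_ge0 (ltW x0) => /(_ isT).
rewrite hornerM hornerXn normrM [`|x^-1 ^+ 2|]ger0_norm ?sqr_ge0//.
rewrite normrM [`|expR _|]ger0_norm ?expR_ge0// => h.
rewrite -ler_pdivrMr ?exprn_gt0//; apply: le_trans h.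
by rewrite mulrAC exprVn.
Qed.

Lemma is_derive_flat (P : {poly R}) (x : R) :
  is_derive x (1 : R) (flat P) (flat ('X^2 * (P - P^`())) x).
Proof.
have [x0|x0|->] := ltrgtP x 0.
- have E : \forall y \near x, cst 0 y = flat P y.
    near=> y; rewrite /flat (_ : y <= 0)//; near: y.
    exact: lt_le_nbhsl.
  rewrite {2}/flat (ltW x0).
  exact: near_eq_is_derive E (is_derive_cst _ _ _).
- pose f (y : R) := P.[y^-1] * expR (- y^-1).
  have E : \forall y \near x, f y = flat P y.
    near=> y; rewrite /flat leNgt (_ : 0 < y)//; near: y.
    exact: lt_nbhsr.
  have Df : is_derive x (1 : R) f (flat ('X^2 * (P - P^`())) x).
    have x0' : x != 0 by rewrite gt_eqF.
    have d1 : is_derive x (1 : R) (fun y : R => y^-1) (- x ^- 2).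
      by have := is_deriveV x0' (is_derive_id x (1 : R)); rewrite scaler1; apply.
    have d2 := is_derive1_comp (is_derive_poly P x^-1) d1.
    have dN : is_derive x (1 : R) (fun y : R => - y^-1) (- (- x ^- 2)) := is_deriveN d1.
    have d3 : is_derive x (1 : R) (expR \o (fun y : R => - y^-1)) (expR (- x^-1) * (- - x ^- 2)).
      exact: is_derive1_comp.
    have := is_deriveM d2 d3.
    rewrite (_ : _ *: _ + _ *: _ = flat ('X^2 * (P - P^`())) x)//.
    rewrite /flat leNgt x0/= hornerM hornerXn hornerD hornerN /GRing.scale/=.
    by field.
  exact: near_eq_is_derive E Df.
- rewrite {2}/flat lexx; have [C C0 HC] := flat_quadratic P.
  have F0 : flat P 0 = 0 by rewrite /flat lexx.
  have L : h^-1 *: ((flat P \o shift 0) (h *: (1 : R)) - flat P 0) @[h --> (0 : R)^'] --> (0 : R).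
    apply/cvgrPdist_le => e e0; have C1 : 0 < C + 1 by lra.
    near=> h.
    have h0 : h != 0 by near: h; exact: nbhs_dnbhs_neq.
    rewrite /= F0 subr0 addr0 sub0r normrN /GRing.scale/= mulr1 normrM normfV.
    rewrite mulrC ler_pdivrMr ?normr_gt0// (le_trans (HC _))//.
    rewrite -real_normK ?num_real// expr2 mulrA ler_wpM2r//.
    rewrite (@le_trans _ _ ((C + 1) * `|h|))//; first by rewrite ler_wpM2r// lerDl.
    rewrite mulrC -ler_pdivlMr//; near: h.
    by apply: dnbhs0_le; exact: divr_gt0.
  apply: DeriveDef; first by apply/cvg_ex; exists 0.
  exact: cvg_lim L.
Unshelve. all: end_near. Qed.

Lemma class_C_flat k (P : {poly R}) : class_C k (flat P).
Proof.
elim: k P => [|k IH] P.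
  by apply: class_CS; apply: class_C_step (is_derive_flat P) _; split => // x;
    have [d _] := is_derive_flat ('X^2 * (P - P^`())) x;
    apply/differentiable_continuous/derivable1_diffP.
exact: class_C_step (is_derive_flat P) (IH _).
Qed.

End flat_function.

Section smooth_step.
Context (R : realType).
Local Notation leb := (@lebesgue_measure R).

Lemma C11_derive (f f1 f2 : R -> R) (C : R) :
  (forall x, is_derive x (1 : R) f (f1 x)) ->
  (forall x, is_derive x (1 : R) f1 (f2 x)) ->
  (forall x, `|f2 x| <= C) -> C11 f f1.
Proof.
move=> d1 d2 f2C.
have mvt (g g1 : R -> R) (u v : R) : (forall x, is_derive x (1 : R) g (g1 x)) ->
    exists2 c, `|c - u| <= `|v - u| & g v - g u = g1 c * (v - u).
  move=> dg.
  have cg : continuous g.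
    move=> x; have [dgx _] := dg x.
    by apply/differentiable_continuous/derivable1_diffP.
  have main a b : a <= b -> exists2 c, c \in `[a, b] & g b - g a = g1 c * (b - a).
    by move=> ab; apply: MVT_segment => //; exact: continuous_subspaceT.
  have [uv|/ltW vu] := leP u v.
    have [c + ->] := main _ _ uv; rewrite in_itv/= => /andP[uc cv].
    by exists c => //; rewrite !ger0_norm ?subr_ge0// lerD2r.
  have [c + E] := main _ _ vu; rewrite in_itv/= => /andP[vc cu].
  exists c; last by rewrite -[LHS]opprB E; ring.
  by rewrite distrC [`|v - u|]distrC !ger0_norm ?subr_ge0// lerD2l lerN2.
have C0 : 0 <= C by exact: le_trans (f2C 0).
have lip1 u v : `|f1 v - f1 u| <= C * `|v - u|.
  by have [c _ ->] := mvt _ _ u v d2; rewrite normrM ler_wpM2r.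
exists C => // u v; have [c cu ->] := mvt _ _ u v d1.
rewrite -mulrBl normrM -[(v - u) ^+ 2]real_normK ?num_real// expr2 mulrA ler_wpM2r//.
by rewrite (le_trans (lip1 _ _))// ler_wpM2l.
Qed.

Lemma bm_compact_support (g : R -> R) : continuous g ->
  (forall x, x < 0 \/ 1 < x -> g x = 0) -> bm g.
Proof.
move=> cg g0.
have bclamp : bm (fun x : R => Order.max 0 (Order.min x 1)).
  split; first by apply: measurable_maxr => //; exact: measurable_minr.
  exists 1 => x; rewrite ger0_norm; last by rewrite le_max lexx.
  by rewrite ge_max ler01 ge_min lexx orbT.
have [_ [M gM]] := bm_continuous_comp cg bclamp.
split; first exact: continuous_measurable_fun.
exists M => x; have [x0|x0] := ltP x 0.
  by rewrite g0; [rewrite normr0; exact: le_trans (gM 0)|left].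
have [x1|x1] := ltP 1 x.
  by rewrite g0; [rewrite normr0; exact: le_trans (gM 0)|right].
by have := gM x; rewrite min_l// max_r.
Qed.

Lemma derive1_outside (f g : R -> R) : (forall x, is_derive x (1 : R) f (g x)) ->
  (forall x, x < 0 \/ 1 < x -> f x = 0) -> (forall x, x < 0 \/ 1 < x -> g x = 0).
Proof.
move=> fg f0 x x01; have [_ <-] := fg x.
have E : \forall y \near x, f y = cst 0 y.
  case: x01 => x01; near=> y; rewrite f0//; [left|right]; near: y.
    exact: lt_nbhsl.
  exact: lt_nbhsr.
by rewrite (near_eq_derive _ E) derive_cst.
Unshelve. all: end_near. Qed.

(** [ka] is the derivative of [sg]. The step serves as a cutoff in space and
    in time, and rescalings of [ka] serve as averaging kernels. *)
Record smooth_step (sg ka : R -> R) : Prop := SmoothStep {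
  step_smooth : forall k, class_C k sg;
  kern_smooth : forall k, class_C k ka;
  step_derive : forall x, is_derive x (1 : R) sg (ka x);
  step_left : forall x, x <= 0 -> sg x = 0;
  step_right : forall x, 1 <= x -> sg x = 1;
  step_itv : forall x, 0 <= sg x <= 1;
  kern_ge0 : forall x, 0 <= ka x;
  kern_out : forall x, x <= 0 \/ 1 <= x -> ka x = 0;
  step_bm : bm sg;
  kern_bm : bm ka;
  step_C11 : C11 sg ka;
  kern_C11 : exists2 ka1, bm ka1 & C11 ka ka1 }.

(** The kernel is the normalised product of [e^(-1/x)] and [e^(-1/(1-x))], and
    the step is its primitive. *)
Lemma smooth_step_exists : exists sg ka, smooth_step sg ka.
Proof.
pose e := @flat R 1.
have Ce k : class_C k e by exact: class_C_flat.
have e0 x : x <= 0 -> e x = 0 by move=> x0; rewrite /e /flat x0.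
have egt0 x : 0 < x -> 0 < e x.
  by move=> x0; rewrite /e /flat leNgt x0/= hornerC mul1r expR_gt0.
have ege0 x : 0 <= e x.
  by have [/e0->//|/egt0/ltW] := leP x 0.
pose b x := e x * e (1 - x).
have Cb k : class_C k b.
  apply: class_C_mul => //.
  apply: (@class_C_affine R R R k e (fun x => 1 - x) (fun x => - x)) => //.
    by move=> x; apply: cvgB; [exact: cvg_cst|exact: cvg_id].
  by move=> p v h; rewrite /GRing.scale/=; ring.
have cb : continuous b by exact: (Cb 0%N).1.
have b0 x : x <= 0 \/ 1 <= x -> b x = 0.
  rewrite /b; case=> h; first by rewrite e0// mul0r.
  by rewrite (e0 (1 - x)) ?mulr0// subr_le0.
have b0' x : x < 0 \/ 1 < x -> b x = 0.
  by move=> h; apply: b0; case: h => /ltW; [left|right].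
have bge0 x : 0 <= b x by rewrite mulr_ge0.
have bb : bm b by exact: bm_compact_support.
pose B x := \int[leb]_(y in `[-1, x]) b y.
have prB : bprim B b.
  apply: (@bprim_indefinite _ (-1) 1) => // y [y0|y1]; apply: b0'; last by right.
  by left; rewrite (lt_trans y0)// ltrN10.
have [bB _ BE] := prB.
have BE0 x : x <= 0 -> B x = 0.
  move=> x0; rewrite /B (eq_Rintegral _ _ (g := fun=> 0)) ?Rintegral_cst ?mul0r//.
  by move=> z; rewrite inE/= in_itv/= => /andP[_ zx]; rewrite b0//; left; exact: le_trans x0.
have dB x : is_derive x (1 : R) B (b x).
  have [x0|x0] := ltP x 0.
    have E : \forall y \near x, cst 0 y = B y.
      near=> y; rewrite BE0//; near: y; exact: lt_le_nbhsl.
    rewrite b0'; last by left.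
    exact: near_eq_is_derive E (is_derive_cst _ _ _).
  have xx1 : x < x + 1 by rewrite ltrDl.
  have [|||dF] := @continuous_FTC1 R b (BLeft (-1)) x (x + 1) xx1.
  - by apply: (@bm_integrable _ _ _ leb) => //; exact: leb_itv_lty.
  - by rewrite lte_fin (lt_le_trans _ x0)// ltrN10.
  - exact: cb.
  by rewrite derive1E => E; apply: DeriveDef.
have cB : continuous B by exact: bprim_continuous prB.
have M0 : 0 < B 1.
  have [|c] := @MVT R B b 0 1 ltr01 (fun x _ => dB x).
    exact: continuous_subspaceT.
  rewrite in_itv/= => /andP[c0 c1]; rewrite (BE0 0)// !subr0 mulr1 => ->.
  by rewrite mulr_gt0 ?egt0// subr_gt0.
have B1 x : 1 <= x -> B x = B 1.
  move=> x1; apply/eqP; rewrite -subr_eq0 BE//.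
  rewrite (eq_Rintegral _ _ (g := fun=> 0)) ?Rintegral_cst ?mul0r//.
  by move=> z; rewrite inE/= in_itv/= => /andP[z1 _]; rewrite b0//; right.
have Bmono x y : x <= y -> B x <= B y.
  by move=> xy; rewrite -subr_ge0 BE// Rintegral_ge0.
pose M := (B 1)^-1.
have M0' : 0 <= M by rewrite invr_ge0 ltW.
pose sg x := M * B x; pose ka x := M * b x.
have dsg x : is_derive x (1 : R) sg (ka x).
  have [d E] := dB x.
  apply: DeriveDef; first exact: (derivableM (derivable_cst M x 1) d).
  have := deriveM (derivable_cst M x 1) d.
  by rewrite derive_cst scaler0 addr0 E; apply.
have Cka k : class_C k ka by apply: class_C_mul => //; exact: class_C_cst.
have Dka (f : R -> R) : (forall k, class_C k f) -> forall x, is_derive x (1 : R) f ('D_1 f x).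
  by move=> Cf x; apply: DeriveDef => //; have [_ /(_ 1)[]] := Cf 1%N.
have CD (f : R -> R) : (forall k, class_C k f) -> forall k, class_C k (fun x => 'D_1 f x).
  by move=> Cf k; have [_ /(_ 1)[]] := Cf k.+1.
have ka0 x : x <= 0 \/ 1 <= x -> ka x = 0 by move=> /b0; rewrite /ka => ->; rewrite mulr0.
have ka0' x : x < 0 \/ 1 < x -> ka x = 0.
  by move=> h; apply: ka0; case: h => /ltW; [left|right].
pose ka1 x := 'D_1 ka x; pose ka2 x := 'D_1 ka1 x.
have Cka1 := CD _ Cka; have Cka2 := CD _ Cka1.
have dka := Dka _ Cka; have dka1 := Dka _ Cka1.
have ka10 := derive1_outside dka ka0'; have ka20 := derive1_outside dka1 ka10.
have bka1 : bm ka1 by apply: bm_compact_support => //; exact: (Cka1 0%N).1.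
have bka2 : bm ka2 by apply: bm_compact_support => //; exact: (Cka2 0%N).1.
exists sg, ka; split => //.
- by move=> k; apply: class_CS; exact: class_C_step dsg (Cka k).
- by move=> x x0; rewrite /sg BE0// mulr0.
- by move=> x x1; rewrite /sg B1// /M mulVf// gt_eqF.
- move=> x; rewrite /sg /M; apply/andP; split.
    rewrite mulr_ge0//; have [/BE0->//|x0] := leP x 0.
    by rewrite -(BE0 0)// Bmono// ltW.
  rewrite mulrC ler_pdivrMr// mul1r; have [/Bmono//|/ltW/B1->//] := leP x 1.
- by move=> x; rewrite mulr_ge0.
- by apply: bmM => //; exact: bm_cst.
- by apply: bmM => //; exact: bm_cst.
- by have [_ [C HC]] := bka1; exact: C11_derive dsg dka HC.
- by exists ka1 => //; have [_ [C HC]] := bka2; exact: C11_derive dka dka1 HC.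
Unshelve. all: end_near. Qed.

End smooth_step.

Section step_consequences.
Context (R : realType).
Local Notation leb := (@lebesgue_measure R).

Lemma C11_bprim (f f1 : R -> R) : bm f -> bm f1 -> C11 f f1 -> bprim f f1.
Proof.
move=> bf bf1 [C fC f1C]; split => // x y xy; apply/eqP; rewrite -subr_eq0; apply/eqP.
have C0 : 0 <= C.
  by have := f1C 0 1; rewrite subr0 normr1 !mulr1; exact: le_trans.
pose Q a b := f b - f a - \int[leb]_(z in `[a, b]) f1 z.
apply: (@additive_quadratic_eq0 _ Q (C + C)) xy => {x y}.
  by move=> a b c ab bc; rewrite /Q (Rintegral_itv_cat bf1 ab bc); ring.
move=> a b ab.
have -> : Q a b = (f b - f a - f1 a * (b - a)) +
    \int[leb]_(z in `[a, b]) (f1 a - f1 z).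
  rewrite itvB//; last exact: bm_cst.
  by rewrite Rintegral_cst// fine_leb_itv// /Q; ring.
rewrite (le_trans (ler_normD _ _))// mulrDl lerD// expr2 mulrA.
apply: Rintegral_itv_bound => //; first by apply: bmB => //; exact: bm_cst.
move=> z /andP[az zb]; rewrite (le_trans (f1C _ _))// ler_wpM2l// distrC.
by rewrite ger0_norm ?subr_ge0// lerD2r.
Qed.

Lemma C11_affine (S S1 : R -> R) (a b : R) : C11 S S1 ->
  C11 (fun x => S (a * x + b)) (fun x => a * S1 (a * x + b)).
Proof.
move=> [C SC S1C]; have C0 : 0 <= C.
  by have := S1C 0 1; rewrite subr0 normr1 !mulr1; exact: le_trans.
exists (C * a ^+ 2) => u v.
  have := SC (a * u + b) (a * v + b).
  rewrite (_ : S1 (a * u + b) * _ = a * S1 (a * u + b) * (v - u)); last ring.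
  by move=> h; apply: le_trans h _; rewrite le_eqVlt; apply/orP; left; apply/eqP; ring.
rewrite -mulrBr normrM -[a ^+ 2]real_normK ?num_real// expr2.
rewrite (_ : _ * _ * `|v - u| = `|a| * (C * (`|a| * `|v - u|))); last ring.
rewrite ler_wpM2l// (le_trans (S1C _ _))// ler_wpM2l// -normrM.
by rewrite le_eqVlt; apply/orP; left; apply/eqP; congr (`|_|); ring.
Qed.

Lemma C11_scale (S S1 : R -> R) (a : R) : C11 S S1 ->
  C11 (fun x => a * S x) (fun x => a * S1 x).
Proof.
move=> [C SC S1C]; exists (`|a| * C) => u v.
  by rewrite -mulrA -!mulrBr normrM -mulrA ler_wpM2l.
by rewrite -mulrBr normrM -mulrA ler_wpM2l.
Qed.

Variables (sg ka : R -> R) (sk : smooth_step sg ka).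

Lemma step_mono : {homo sg : x y / x <= y}.
Proof.
move=> x y xy; rewrite -subr_ge0.
have [_ _ ->//] := C11_bprim (step_bm sk) (kern_bm sk) (step_C11 sk).
by apply: Rintegral_ge0 => z _; exact: kern_ge0 sk z.
Qed.

Definition stepn (n : nat) (y x : R) : R := sg (n.+1%:R * (x - y)).
Definition kernn (n : nat) (y x : R) : R := n.+1%:R * ka (n.+1%:R * (x - y)).

Lemma stepn_left n y x : x <= y -> stepn n y x = 0.
Proof. by move=> xy; apply: (step_left sk); rewrite mulr_ge0_le0// subr_le0. Qed.

Lemma stepn_right n y x : y + n.+1%:R^-1 <= x -> stepn n y x = 1.
Proof.
by move=> xy; apply: (step_right sk); rewrite mulrC -ler_pdivrMr// div1r lerBrDl.
Qed.

Lemma kernn_out n y x : x <= y \/ y + n.+1%:R^-1 <= x -> kernn n y x = 0.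
Proof.
move=> h; rewrite /kernn (kern_out sk) ?mulr0//.
case: h => xy; [left|right]; first by rewrite mulr_ge0_le0// subr_le0.
by rewrite mulrC -ler_pdivrMr// div1r lerBrDl.
Qed.

Lemma kernn_ge0 n y x : 0 <= kernn n y x.
Proof. by rewrite mulr_ge0// (kern_ge0 sk). Qed.

Let affineE n y x : n.+1%:R * (x - y) = n.+1%:R * x + (- n.+1%:R * y) :> R.
Proof. ring. Qed.

Let measurable_affine (a b : R) : measurable_fun setT (fun x : R => a * x + b).
Proof.
by apply: measurable_funD => //; apply: measurable_funM => //; exact: measurable_cst.
Qed.

Lemma stepn_bm n y : bm (stepn n y).
Proof.
rewrite (_ : stepn n y = fun x => sg (n.+1%:R * x + (- n.+1%:R * y))).
  exact: bm_comp (step_bm sk).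
by apply/funext => x; rewrite /stepn affineE.
Qed.

Lemma kernn_bm n y : bm (kernn n y).
Proof.
rewrite (_ : kernn n y = fun x => n.+1%:R * ka (n.+1%:R * x + (- n.+1%:R * y))).
  by apply: bmM; [exact: bm_cst|exact: bm_comp (kern_bm sk)].
by apply/funext => x; rewrite /kernn affineE.
Qed.

Lemma stepn_C11 n y : C11 (stepn n y) (kernn n y).
Proof.
have := C11_affine n.+1%:R (- n.+1%:R * y) (step_C11 sk).
rewrite (_ : (fun x => sg _) = stepn n y).
  by rewrite (_ : (fun x => _ * ka _) = kernn n y)//; apply/funext => x; rewrite /kernn affineE.
by apply/funext => x; rewrite /stepn affineE.
Qed.

Lemma stepn_bprim n y : bprim (stepn n y) (kernn n y).
Proof. apply: C11_bprim; [exact: stepn_bm|exact: kernn_bm|exact: stepn_C11]. Qed.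

Lemma kernn_bound : exists2 C : R, 0 <= C & forall n y x, `|kernn n y x| <= C * n.+1%:R.
Proof.
have [_ [C HC]] := kern_bm sk; exists C; first exact: le_trans (HC 0).
by move=> n y x; rewrite normrM ger0_norm// mulrC ler_wpM2r.
Qed.

Lemma kernn_int1 n y :
  \int[leb]_(x in `[y - n.+1%:R^-1, y + n.+1%:R^-1]) kernn n y x = 1.
Proof.
have [_ _ <-] := stepn_bprim n y.
  by rewrite stepn_right// stepn_left ?subr0// gerBl.
by rewrite (@le_trans _ _ y)// ?gerBl ?lerDl.
Qed.

(** The kernel lives on the right of [y]; a Lebesgue point allows such
    one-sided averages. *)
Lemma cvg_kernn (al : R -> R) (y a b : R) : bm al -> lebesgue_pt al y ->
  a < y -> y < b ->
  \int[leb]_(x in `[a, b]) (kernn n y x * al x) @[n --> \oo] --> al y.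
Proof.
move=> bal aly ay yb; have [C C0 HC] := kernn_bound.
have := cvg_kernel bal (fun n => kernn_bm n y) (fun n => HC n y) (fun n => kernn_int1 n y) aly.
apply: cvg_trans; apply: near_eq_cvg; near=> n.
have n1 : n.+1%:R^-1 <= y - a.
  near: n; have : n.+1%:R^-1 @[n --> \oo] --> (0 : R) by exact: cvg_harmonic.
  move/cvgrPdist_le => /(_ (y - a)); rewrite subr_gt0 => /(_ ay).
  by apply: filterS => n; rewrite sub0r normrN ger0_norm.
have n2 : n.+1%:R^-1 <= b - y.
  near: n; have : n.+1%:R^-1 @[n --> \oo] --> (0 : R) by exact: cvg_harmonic.
  move/cvgrPdist_le => /(_ (b - y)); rewrite subr_gt0 => /(_ yb).
  by apply: filterS => n; rewrite sub0r normrN ger0_norm.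
apply: Rintegral_subset.
  move=> x /=; rewrite !in_itv/=; move: (n.+1%:R^-1 : R) n1 n2 => i n1 n2 /andP[h1 h2].
  by apply/andP; split; lra.
move=> x /=; rewrite !in_itv/= => /andP[h1 h2] /negP; rewrite negb_and -!ltNge => /orP[] h.
  by rewrite kernn_out ?mul0r//; left; rewrite ltW// (lt_le_trans h)// gerBl.
by rewrite kernn_out ?mul0r//; right; rewrite ltW.
Unshelve. all: end_near. Qed.

Lemma stepn_class_C k n y : class_C k (stepn n y).
Proof.
rewrite (_ : stepn n y = fun x => sg (n.+1%:R * x + (- n.+1%:R * y))); last first.
  by apply/funext => x; rewrite /stepn affineE.
apply: (@class_C_affine R R R k sg (fun x => n.+1%:R * x + (- n.+1%:R * y)) (fun x => n.+1%:R * x)).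
- by move=> x; apply: cvgD; [apply: cvgM; [exact: cvg_cst|exact: cvg_id]|exact: cvg_cst].
- by move=> p v h; rewrite /GRing.scale/=; ring.
- exact: step_smooth sk k.
Qed.

Lemma kernn_class_C k n y : class_C k (kernn n y).
Proof.
rewrite (_ : kernn n y = fun x => n.+1%:R * ka (n.+1%:R * x + (- n.+1%:R * y))); last first.
  by apply/funext => x; rewrite /kernn affineE.
apply: class_C_mul; first exact: class_C_cst.
apply: (@class_C_affine R R R k ka (fun x => n.+1%:R * x + (- n.+1%:R * y)) (fun x => n.+1%:R * x)).
- by move=> x; apply: cvgD; [apply: cvgM; [exact: cvg_cst|exact: cvg_id]|exact: cvg_cst].
- by move=> p v h; rewrite /GRing.scale/=; ring.
- exact: kern_smooth sk k.
Qed.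

Lemma stepn_derive n y x : is_derive x (1 : R) (stepn n y) (kernn n y x).
Proof.
have d : is_derive x (1 : R) (fun x => n.+1%:R * (x - y)) (n.+1%:R * (1 - 0)).
  move: (n.+1%:R : R) => N.
  have d1 : is_derive x (1 : R) (fun x : R => x - y) (1 - 0).
    exact: is_deriveB (is_derive_id _ _) (is_derive_cst _ _ _).
  have [dd dE] := d1.
  apply: DeriveDef; first exact: (derivableM (derivable_cst N x 1) dd).
  have := deriveM (derivable_cst N x 1) dd.
  by rewrite derive_cst scaler0 addr0 dE; apply.
have := @is_derive1_comp R sg (fun x => n.+1%:R * (x - y)) x _ _ (step_derive sk (n.+1%:R * (x - y))) d.
by rewrite subr0 mulr1 mulrC; apply.
Qed.

End step_consequences.

Section tensor_test_function.
Context (R : realType).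

Lemma class_C_tensor k (X Z : R -> R) : class_C k X -> class_C k Z ->
  class_C k (fun p : R * R => X p.1 * Z p.2).
Proof.
move=> CX CZ; apply: class_C_mul.
  apply: (@class_C_affine R (R * R)%type R k X fst fst) => //.
  by move=> p; exact: cvg_fst.
apply: (@class_C_affine R (R * R)%type R k Z snd snd) => //.
by move=> p; exact: cvg_snd.
Qed.

Lemma derive_tensor2 (X Z : R -> R) (x t z : R) : is_derive t (1 : R) Z z ->
  'D_(0, 1) (fun p : R * R => X p.1 * Z p.2) (x, t) = X x * z.
Proof.
move=> dZ; have [d E] := dZ.
have -> : 'D_(0, 1) (fun p : R * R => X p.1 * Z p.2) (x, t) = 'D_1 (fun s => X x * Z s) t.
  rewrite /derive (_ : (fun h : R => _) = (fun h : R => h^-1 *: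
    (((fun s => X x * Z s) \o shift t) (h *: (1 : R)) - X x * Z t)))//.
  by apply/funext => h /=; rewrite /GRing.scale/= mulr0 add0r.
have := deriveM (derivable_cst (X x) t 1) d.
by rewrite derive_cst scaler0 addr0 E; apply.
Qed.

Lemma derive_tensor1 (X Z : R -> R) (x t z : R) : is_derive x (1 : R) X z ->
  'D_(1, 0) (fun p : R * R => X p.1 * Z p.2) (x, t) = z * Z t.
Proof.
move=> dX; have [d E] := dX.
have -> : 'D_(1, 0) (fun p : R * R => X p.1 * Z p.2) (x, t) = 'D_1 (fun s => X s * Z t) x.
  rewrite /derive (_ : (fun h : R => _) = (fun h : R => h^-1 *:
    (((fun s => X s * Z t) \o shift x) (h *: (1 : R)) - X x * Z t)))//.
  by apply/funext => h /=; rewrite /GRing.scale/= mulr0 add0r.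
have := deriveM d (derivable_cst (Z t) x 1).
by rewrite (derive_cst (Z t)) scaler0 add0r E [z * _]mulrC; apply.
Qed.

End tensor_test_function.

(** [S] approximates the Heaviside function and [Sg] the positive part, at
    distance [dl]. That [S] vanishes up to 0 included is what makes it usable
    in one-sided comparisons. *)
Record ramp (R : realType) (dl : R) (Sg S S1 : R -> R) : Prop := Ramp {
  ramp_prim : C11 Sg S;
  ramp_C11 : C11 S S1;
  ramp_itv : forall r, 0 <= S r <= 1;
  ramp_left : forall r, r <= 0 -> S r = 0;
  ramp_right : forall r, dl <= r -> S r = 1;
  ramp_mono : {homo S : r s / r <= s};
  ramp_deriv_ge0 : forall r, 0 <= S1 r;
  ramp_dist : forall r, `|Sg r - Order.max r 0| <= dl }.

(** Rescaling of the smooth step, which is 0 before 0 and 1 after 1. *)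
Lemma ramp_exists (R : realType) (dl : R) : 0 < dl -> exists Sg S S1, ramp dl Sg S S1.
Proof.
move=> dl0; have [sg [ka sk]] := smooth_step_exists R.
have bsg := step_bm sk.
pose G (x : R) := \int[@lebesgue_measure R]_(z in `[0, x]) sg z.
have G0 x : x <= 0 -> G x = 0.
  rewrite le_eqVlt => /predU1P[->|x0]; first by rewrite /G set_itv1 Rintegral_set1.
  by rewrite /G set_itv_ge ?Rintegral_set0// bnd_simp -ltNge.
have GE x y : x <= y -> G y - G x = \int[@lebesgue_measure R]_(z in `[x, y]) sg z.
  move=> xy.
  have neg a b : a <= b -> b <= 0 -> \int[@lebesgue_measure R]_(z in `[a, b]) sg z = 0.
    move=> ab b0; rewrite (eq_Rintegral _ _ (g := fun=> 0)) ?Rintegral_cst ?mul0r//.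
    move=> z; rewrite inE/= in_itv/= => /andP[_ zb].
    by rewrite (step_left sk)// (le_trans zb).
  have [x0|/ltW x0] := leP 0 x.
    by rewrite /G (Rintegral_itv_cat bsg x0 xy); ring.
  rewrite (G0 _ x0) subr0; have [y0|/ltW y0] := leP 0 y.
    by rewrite (Rintegral_itv_cat bsg x0 y0) neg// add0r.
  by rewrite neg// G0.
have CG : C11 G sg.
  have [C sgC lipC] : C11 sg ka := step_C11 sk.
  have [K K0 sgK] := bprim_lip (C11_bprim bsg (kern_bm sk) (step_C11 sk)).
  exists K => // u v.
  have est a b w : a <= b -> (forall z, a <= z <= b -> `|z - w| <= b - a) ->
      `|\int[@lebesgue_measure R]_(z in `[a, b]) (sg z - sg w)| <= K * (b - a) ^+ 2.
    move=> ab zw; rewrite expr2 mulrA; apply: Rintegral_itv_bound => //.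
      by apply: bmB => //; exact: bm_cst.
    by move=> z /zw h; rewrite (le_trans (sgK _ _))// ler_wpM2l.
  have Eq a b w : a <= b -> G b - G a - sg w * (b - a) =
      \int[@lebesgue_measure R]_(z in `[a, b]) (sg z - sg w).
    move=> ab; rewrite itvB//; last exact: bm_cst.
    by rewrite GE// Rintegral_cst// fine_leb_itv.
  have [uv|/ltW vu] := leP u v.
    rewrite Eq//; apply: est => // z /andP[uz zv].
    by rewrite ger0_norm ?subr_ge0// lerD2r.
  rewrite (_ : _ - _ = - (G u - G v - sg u * (u - v))); last ring.
  rewrite normrN Eq// -[(v - u) ^+ 2]sqrrN opprB; apply: est => // z /andP[vz zu].
  by rewrite distrC ger0_norm ?subr_ge0// lerD2l lerN2.
have Gdist x : `|G x - Order.max x 0| <= 1.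
  have [x0|/ltW x0] := leP x 0; first by rewrite G0// subrr normr0.
  have up : G x <= x.
    rewrite -[leRHS]mul1r -[in leRHS](subr0 x) -(fine_leb_itv true false x0) -Rintegral_cst//.
    by apply: itv_le => //; [exact: bm_cst|move=> z _; have /andP[] := step_itv sk z].
  have lo : x - 1 <= G x.
    have [x1|/ltW x1] := leP x 1.
      by rewrite (@le_trans _ _ 0) ?subr_le0// Rintegral_ge0// => z _; have /andP[] := step_itv sk z.
    rewrite /G (Rintegral_itv_cat bsg ler01 x1) ler_wpDl//.
      by rewrite Rintegral_ge0// => z _; have /andP[] := step_itv sk z.
    rewrite (eq_Rintegral _ _ (g := fun=> 1)).
      by rewrite Rintegral_cst// fine_leb_itv// mul1r.
    by move=> z; rewrite inE/= in_itv/= => /andP[z1 _]; rewrite (step_right sk).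
  by rewrite ler_norml; apply/andP; split; lra.
have dl1 : 0 <= dl^-1 by rewrite invr_ge0 ltW.
exists (fun r => dl * G (dl^-1 * r + 0)), (fun r => sg (dl^-1 * r + 0)),
  (fun r => dl^-1 * ka (dl^-1 * r + 0)); split.
- have := C11_scale dl (C11_affine dl^-1 0 CG).
  rewrite (_ : (fun x => dl * (_ * sg _)) = (fun r => sg (dl^-1 * r + 0)))//.
  by apply/funext => x; rewrite mulrA mulfV ?mul1r// gt_eqF.
- exact: C11_affine (step_C11 sk).
- by move=> r; exact: step_itv sk _.
- by move=> r r0; apply: (step_left sk); rewrite addr0 mulr_ge0_le0.
- by move=> r r1; apply: (step_right sk); rewrite addr0 mulrC ler_pdivlMr// mul1r.
- by move=> r s rs; apply: (step_mono sk); rewrite lerD2r ler_wpM2l.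
- by move=> r; rewrite mulr_ge0// (kern_ge0 sk).
- move=> r; rewrite addr0.
  rewrite (_ : Order.max r 0 = dl * Order.max (dl^-1 * r) 0); last first.
    by rewrite maxr_pMr ?ltW// mulr0 mulrA mulfV ?mul1r// gt_eqF.
  by rewrite -mulrBr normrM gtr0_norm// -[leRHS]mulr1 ler_wpM2l// ltW.
Qed.

(** * The medium *)

Section within_interval.
Context (R : realType).
Local Notation leb := (@lebesgue_measure R).

Lemma max_lip (a x y : R) : `|Order.max y a - Order.max x a| <= `|y - x|.
Proof.
have h3 := ler_norm (y - x); have := ler_norm (x - y); rewrite distrC => h4.
by rewrite ler_norml; have [h1|h1] := leP y a; have [h2|h2] := leP x a; apply/andP; split; lra.
Qed.

Lemma max_continuous (a : R) : continuous (fun y => Order.max y a).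
Proof. by apply: (@lip_continuous _ _ 1) => x y; rewrite mul1r max_lip. Qed.

Lemma within_bounded (a b : R) (f : R -> R) : {within `[a, b], continuous f} ->
  exists M : R, forall x, x \in `[a, b] -> `|f x| <= M.
Proof.
move=> cf; have [ab|ba] := leP a b; last first.
  by exists 0 => x; rewrite in_itv/= => /andP[ax xb]; have := le_trans ax xb; rewrite leNgt ba.
have [c1 _ H1] := EVT_max ab cf; have [c2 _ H2] := EVT_min ab cf.
exists (`|f c1| + `|f c2|) => x xab; rewrite ler_norml; apply/andP; split.
  rewrite lerNl (@le_trans _ _ (- f c2))//; first by rewrite lerN2 H2.
  by rewrite (le_trans (ler_norm _))// normrN lerDr.
by rewrite (le_trans (H1 _ xab))// (le_trans (ler_norm _))// lerDl.
Qed.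

Lemma bm_within (a b : R) (f : R -> R) : {within `[a, b], continuous f} ->
  bm (f \_ `[a, b]).
Proof.
move=> cf; split.
  apply/(measurable_restrictT _ _).1 => //.
  by apply: subspace_continuous_measurable_fun.
have [M HM] := within_bounded cf; exists `|M| => x; rewrite patchE; case: ifPn => [|_].
  by rewrite inE => /HM h; rewrite (le_trans h)// ler_norm.
by rewrite normr0.
Qed.

Lemma withinM (A : set R) (f g : R -> R) : {within A, continuous f} -> {within A, continuous g} ->
  {within A, continuous (fun x => f x * g x)}.
Proof. by move=> cf cg x; apply: cvgM; [exact: cf|exact: cg]. Qed.

(** The integrand is truncated to the open interval, where it is known to be
    positive. *)
Lemma primitive_increasing (G : R -> R) : {within `[0, 1], continuous G} ->
  {in `]0, 1[, forall s, 0 < G s} ->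
  let ph := fun x => \int[leb]_(a in `[0, x]) (G \_ `]0, 1[) a in
  [/\ continuous ph, {homo ph : x y / x <= y} &
      {in `[0, 1] &, {homo ph : x y / x < y}}].
Proof.
move=> cG G0 ph; pose Gr := G \_ `]0, 1[.
have bGr : bm Gr.
  have -> : Gr = (G \_ `[0, 1]) \_ `]0, 1[.
    apply/funext => x; rewrite /Gr !patchE; case: ifPn => // x01.
    rewrite mem_set//; apply: subset_itv_oo_cc; exact: set_mem.
  by apply: bm_restrict => //; exact: bm_within.
have Gr0 x : 0 <= Gr x.
  by rewrite /Gr patchE; case: ifPn => // x01; apply/ltW/G0; rewrite inE in x01.
have Gout y : y < 0 \/ 1 < y -> Gr y = 0.
  move=> h; rewrite /Gr patchE memNset//= in_itv/= => /andP[y0 y1].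
  by case: h => ?; lra.
have pr : bprim ph Gr by exact: bprim_indefinite bGr Gout.
have [_ _ phE] := pr.
have mono x y : x <= y -> ph x <= ph y.
  by move=> xy; rewrite -subr_ge0 phE// Rintegral_ge0.
split => //; first exact: bprim_continuous pr.
move=> x y; rewrite !in_itv/= => /andP[x0 x1] /andP[y0 y1] xy.
pose x' := x + (y - x) / 3; pose y' := y - (y - x) / 3.
have x'y' : x' < y' by rewrite /x' /y'; lra.
have xx' : x < x' by rewrite /x'; lra.
have yy' : y' < y by rewrite /y'; lra.
have cG' : {within `[x', y'], continuous G}.
  apply: continuous_subspaceW cG => z /=; rewrite !in_itv/= => /andP[? ?].
  by apply/andP; split; lra.
have [c cin Hc] := EVT_min (ltW x'y') cG'.
have Gc : 0 < G c.
  by apply: G0; move: cin; rewrite !in_itv/= => /andP[? ?]; apply/andP; split; lra.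
rewrite (le_lt_trans (mono _ _ (ltW xx')))// (lt_le_trans _ (mono _ _ (ltW yy')))//.
rewrite -subr_gt0 phE ?ltW// (@lt_le_trans _ _ (G c * (y' - x')))//.
  by rewrite mulr_gt0// subr_gt0.
rewrite -(fine_leb_itv true false (ltW x'y')) -Rintegral_cst//.
apply: itv_le => //; first exact: bm_cst.
move=> z /= zin; rewrite /Gr patchE mem_set; first exact: Hc.
by move: zin; rewrite /= !in_itv/= => /andP[? ?]; apply/andP; split; lra.
Qed.

(** By compactness [ph (k + eta) - ph k] has a positive minimum. This converts
    closeness of transformed saturations into closeness of saturations,
    although [varphi] may have an arbitrarily flat graph at 0 and 1. *)
Lemma increasing_modulus (ph : R -> R) : continuous ph ->
  {in `[0, 1] &, {homo ph : x y / x < y}} ->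
  forall eta : R, 0 < eta -> exists2 dl : R, 0 < dl &
    forall r k, 0 <= r <= 1 -> 0 <= k <= 1 -> ph r - ph k <= dl -> r - k <= eta.
Proof.
move=> cph iph eta eta0; have [eta1|eta1] := leP 1 eta.
  exists 1 => // r k /andP[r0 r1] /andP[k0 k1] _; lra.
have e1 : 0 <= 1 - eta by lra.
have cq : {within `[0, 1 - eta], continuous (fun k => ph (k + eta) - ph k)}.
  apply: continuous_subspaceT => k; apply: cvgB; last exact: cph.
  by apply: continuous_comp; [apply: cvgD; [exact: cvg_id|exact: cvg_cst]|exact: cph].
have [c] := EVT_min e1 cq; rewrite in_itv/= => /andP[c0 c1] Hc.
have q0 : 0 < ph (c + eta) - ph c.
  rewrite subr_gt0; apply: iph; rewrite ?in_itv/=; last by rewrite ltrDl.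
    by apply/andP; split; lra.
  by apply/andP; split; lra.
exists ((ph (c + eta) - ph c) / 2); first by rewrite divr_gt0.
move=> r k /andP[r0 r1] /andP[k0 k1] h; rewrite leNgt; apply/negP => rk.
have kin : k \in `[0, 1 - eta] by rewrite in_itv/=; apply/andP; split; lra.
have := Hc _ kin.
have : ph (k + eta) < ph r.
  by apply: iph; rewrite ?in_itv/=; try (apply/andP; split); lra.
by move=> h1 h2; lra.
Qed.

End within_interval.

Section medium_theory.
Context (R : realType) (m : medium R).
Local Notation leb := (@lebesgue_measure R).

Lemma mobility_gt0 : {in `]0, 1[, forall s, 0 < mobility m s}.
Proof.
move=> s; rewrite in_itv/= => /andP[s0 s1].
have o : 0 < eta_o m s.
  by rewrite -(eta_o_0 m); apply: eta_o_increasing; rewrite ?in_itv/= ?lexx ?ler01 ?ltW.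
have w : 0 < eta_w m s.
  by rewrite -(eta_w_1 m); apply: eta_w_decreasing; rewrite ?in_itv/= ?lexx ?ler01 ?ltW.
by rewrite /mobility divr_gt0 ?mulr_gt0 ?addr_gt0.
Qed.

Lemma mobility_continuous : {within `[0, 1], continuous (mobility m)}.
Proof.
have co := @eta_o_continuous _ m; have cw := @eta_w_continuous _ m.
have pos s : s \in `[0, 1] -> 0 < eta_o m s + eta_w m s.
  move=> s01; have := s01; rewrite in_itv/= => /andP[s0 s1].
  have [->|sn0] := eqVneq s 0.
    rewrite eta_o_0 add0r.
    have : eta_w m 1 < eta_w m 0.
      by apply: eta_w_decreasing; rewrite ?in_itv/= ?lexx ?ler01 ?ltr01.
    by rewrite eta_w_1.
  rewrite ltr_wpDr ?eta_w_ge0//.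
  rewrite -(eta_o_0 m); apply: eta_o_increasing; rewrite ?in_itv/= ?lexx ?ler01 ?s0 ?s1//.
  by rewrite lt_neqAle eq_sym sn0.
pose D s := eta_o m s + eta_w m s.
have cD : {within `[0, 1], continuous D}.
  by move=> x; apply: cvgD; [exact: co|exact: cw].
have [c c01 Hc] := EVT_min ler01 cD.
have D0 : 0 < D c by exact: pos.
pose S (y : R) := (Order.max y (D c))^-1.
have cS : continuous S.
  move=> y; apply: cvgV; first by rewrite gt_eqF// lt_max D0 orbT.
  exact: max_continuous.
have : {within `[0, 1], continuous (fun s => (eta_o m s * eta_w m s) * S (D s))}.
  apply: withinM; first exact: withinM.
  by move=> x; exact: (cvg_comp _ _ (cD x) (cS (D x))).
apply: subspace_eq_continuous => s s01.
by rewrite /from_subspace/= /S max_l// Hc//; move: s01; rewrite inE.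
Qed.

(** The derivative of the capillary pressure is only meaningful inside the
    unit interval. Its continuous extension changes the integrand at two
    points, and yields a version of [varphi] that is continuous on the whole
    line. *)
Lemma varphi_primitive : exists ph : R -> R,
  [/\ continuous ph, {homo ph : x y / x <= y}, {in `[0, 1] &, {homo ph : x y / x < y}},
      ph 0 = 0 & {in `[0, 1], varphi m =1 ph}].
Proof.
have [_ [df cdf dfE]] := @capillary_C1 _ m.
have cG : {within `[0, 1], continuous (fun s => mobility m s * df s)}.
  by apply: withinM => //; exact: mobility_continuous.
have G0 : {in `]0, 1[, forall s, 0 < mobility m s * df s}.
  move=> s s01; rewrite mulr_gt0 ?mobility_gt0//.
  by rewrite -dfE// capillary_deriv_gt0.
have [cph mono inc] := primitive_increasing cG G0.
exists (fun x => \int[leb]_(a in `[0, x]) ((fun s => mobility m s * df s) \_ `]0, 1[) a); split => //.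
  by rewrite set_itv1 Rintegral_set1.
move=> s s01; have := s01; rewrite in_itv/= => /andP[s0 s1].
rewrite /varphi patchE mem_set//.
have bGr : bm ((fun s => mobility m s * df s) \_ `]0, 1[).
  rewrite (_ : _ \_ _ = ((fun s => mobility m s * df s) \_ `[0, 1]) \_ `]0, 1[).
    by apply: bm_restrict => //; exact: bm_within.
  apply/funext => x; rewrite !patchE; case: ifPn => // x01.
  by rewrite mem_set//; apply: subset_itv_oo_cc; exact: set_mem.
have E : {in `]0, s[%classic, (fun s => mobility m s * df s) \_ `]0, 1[ =1
    (fun a => mobility m a * derive1 (capillary m) a)}.
  move=> a; rewrite inE/= in_itv/= => /andP[a0 as1].
  have a01 : a \in `]0, 1[ by rewrite in_itv/= a0 (lt_le_trans as1).
  by rewrite patchE mem_set// dfE.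
have i1 : leb.-integrable `]0, s[ (EFin \o ((fun s => mobility m s * df s) \_ `]0, 1[)).
  by apply: (@bm_integrable _ _ _ leb) => //; exact: leb_itv_lty.
have i2 : leb.-integrable `]0, s[ (EFin \o (fun a => mobility m a * derive1 (capillary m) a)).
  by apply: eq_integrable i1 => // a ain; rewrite /= E.
have close (f : R -> R) : leb.-integrable `]0, s[ (EFin \o f) ->
    \int[leb]_(x in `[0, s]) f x = \int[leb]_(x in `]0, s[) f x.
  move=> fi; have mf : measurable_fun `]0, s[ (EFin \o f) by case/integrableP : fi.
  rewrite /Rintegral -integral_itv_obnd_cbnd; last first.
    by apply/measurable_EFinP/measurable_fun_itv_bndo_bndcP/measurable_EFinP.
  rewrite -integral_itv_bndo_bndc//.
rewrite close// [RHS]close//; apply: eq_Rintegral => a ain; exact/esym/E.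
Qed.

Lemma capillary_increasing : {in `[0, 1] &, {homo capillary m : x y / x < y}}.
Proof.
have [LR _] := @capillary_C1 _ m.
have cw := derivable_oo_LRcontinuous_within LR; have [dc _ _] := LR.
move=> x y; rewrite !in_itv/= => /andP[x0 x1] /andP[y0 y1] xy.
have [||c] := @MVT R (capillary m) (derive1 (capillary m)) x y xy.
- move=> z; rewrite in_itv/= => /andP[xz zy].
  have z01 : z \in `]0, 1[ by rewrite in_itv/=; apply/andP; split; lra.
  by rewrite derive1E; apply: DeriveDef => //; exact: dc.
- apply: continuous_subspaceW cw => z /=; rewrite !in_itv/= => /andP[? ?].
  by apply/andP; split; lra.
rewrite in_itv/= => /andP[xc cy] E; rewrite -subr_gt0 E mulr_gt0 ?subr_gt0//.
by apply: capillary_deriv_gt0; rewrite in_itv/=; apply/andP; split; lra.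
Qed.

(** The half-lines added to the graph at 0 and 1 extend it downwards and
    upwards respectively, so the graph is strictly increasing as a multivalued
    map. *)
Lemma capillary_graph_lt (r q p p' : R) : 0 <= r <= 1 -> 0 <= q <= 1 ->
  capillary_graph m r p -> capillary_graph m q p' -> q < r -> p' < p.
Proof.
move=> /andP[r0 r1] /andP[q0 q1] rp qp qr.
have rn0 : r != 0 by rewrite gt_eqF// (le_lt_trans q0).
have qn1 : q != 1 by rewrite lt_eqF// (lt_le_trans qr).
have p1 : capillary m r <= p.
  move: rp; rewrite /capillary_graph (negbTE rn0); case: eqP => [->|_] /=.
    by rewrite in_itv/= andbT.
  by move=> ->.
have p2 : p' <= capillary m q.
  move: qp; rewrite /capillary_graph; case: eqP => [->|_] /=.
    by rewrite in_itv/=.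
  by rewrite (negbTE qn1) /= => ->.
apply: (le_lt_trans p2); apply: lt_le_trans p1.
by apply: capillary_increasing; rewrite ?in_itv/= ?q0 ?r0.
Qed.

End medium_theory.

(** * Relative entropies *)

Section almost_everywhere_line.
Context (R : realType).
Local Notation leb := (@lebesgue_measure R).
Implicit Types P Q V : R -> Prop.

Let aeF : Filter (nbhs (almost_everywhere leb)).
Proof. exact: (ae_filter_ringOfSetsType leb). Qed.

Lemma ae1 P V : {ae leb, forall x, P x} -> (forall x, P x -> V x) ->
  {ae leb, forall x, V x}.
Proof. by move=> hP h; apply: filterS hP. Qed.

Lemma ae2 P Q V : {ae leb, forall x, P x} -> {ae leb, forall x, Q x} ->
  (forall x, P x -> Q x -> V x) -> {ae leb, forall x, V x}.
Proof. by move=> hP hQ h; apply: filterS2 hP hQ. Qed.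

Lemma ae_all P : (forall x, P x) -> {ae leb, forall x, P x}.
Proof. by move=> h; apply: filterE. Qed.

End almost_everywhere_line.

Section entropy.
Context (R : realType).
Local Notation leb := (@lebesgue_measure R).
Variables (S : R -> R) (ph : R -> R).
Hypothesis cS : continuous S.
Hypothesis S01 : forall r, 0 <= S r <= 1.
Hypothesis S0 : forall r, r <= 0 -> S r = 0.
Hypothesis monoS : {homo S : r s / r <= s}.
Hypothesis cph : continuous ph.
Hypothesis incph : {in `[0, 1] &, {homo ph : x y / x < y}}.

(** The variable [y] runs over saturations but is compared with [k] through
    [ph]: the derivative of the entropy is a function of the transformed
    saturations, which are Lipschitz in space while saturations are merely
    bounded. *)
Definition entropy (r k : R) : R :=
  \int[leb]_(y in `[0, r]) (S (ph y - ph k) * \1_(`[0, 1]%classic) y).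

Let incph' x y : 0 <= x <= 1 -> 0 <= y <= 1 -> x <= y -> ph x <= ph y.
Proof.
move=> x01 y01; rewrite le_eqVlt => /predU1P[->//|xy].
by apply/ltW/incph; rewrite ?in_itv.
Qed.

Let mS : measurable_fun setT S. Proof. exact: continuous_measurable_fun. Qed.
Let mph : measurable_fun setT ph. Proof. exact: continuous_measurable_fun. Qed.

Let bS d (T : measurableType d) (f : T -> R) : measurable_fun setT f -> bm (fun x => S (f x)).
Proof.
move=> mf; split; first exact: measurableT_comp.
by exists 1 => x; have /andP[s0 s1] := S01 (f x); rewrite ger0_norm.
Qed.

Let bint k : bm (fun y => S (ph y - ph k) * \1_(`[0, 1]%classic) y).
Proof.
apply: bmM; last exact: bm_indic.
by apply: bS; apply: measurable_funB => //; exact: measurable_cst.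
Qed.

Lemma entropy_bm d (T : measurableType d) (r k : T -> R) :
  measurable_fun setT r -> measurable_fun setT k ->
  bm (fun x => entropy (r x) (k x)).
Proof.
move=> mr mk.
have b1 : bm (fun p : R * R => \int[leb]_(y in `[0, p.2])
    (S (ph y - ph p.1) * \1_(`[0, 1]%classic) y)).
  apply: (@bm_indefinite R _ R 0 1 (fun q => S (ph q.2 - ph q.1) * \1_(`[0, 1]%classic) q.2)).
    apply: bmM.
      apply: bS; apply: measurable_funB.
        by apply: measurableT_comp => //; exact: measurable_snd.
      by apply: measurableT_comp => //; exact: measurable_fst.
    by apply: (bm_comp (h := snd)); [exact: measurable_snd|exact: bm_indic].
  move=> [k0 y] /= h; rewrite indicE memNset ?mulr0//= in_itv/= => /andP[y0 y1].
  by case: h => ?; lra.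
apply: (bm_comp (h := fun x => (k x, r x)) _ b1).
exact: measurable_fun_pair.
Qed.

Lemma entropyB (r r' k : R) : 0 <= r' -> r' <= r -> entropy r k - entropy r' k =
  \int[leb]_(y in `[r', r]) (S (ph y - ph k) * \1_(`[0, 1]%classic) y).
Proof.
by move=> r0 rr; rewrite /entropy (Rintegral_itv_cat (bint k) r0 rr); ring.
Qed.

(** The integrand [S (ph y - ph k)] is nondecreasing in [y], so on the
    interval between [r'] and [r] its value at [r] is extremal. *)
Lemma entropy_convex (r r' k : R) : 0 <= r <= 1 -> 0 <= r' <= 1 ->
  entropy r k - entropy r' k <= (r - r') * S (ph r - ph k).
Proof.
move=> r01 r'01; have /andP[r0 r1] := r01; have /andP[r'0 r'1] := r'01.
have ind y : 0 <= y <= 1 -> \1_(`[0, 1]%classic) y = 1 :> R.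
  by move=> y01; rewrite indicE mem_set.
have [rr|/ltW rr] := leP r' r.
  rewrite entropyB// -(fine_leb_itv true false rr) mulrC -Rintegral_cst//.
  apply: itv_le => //; first exact: bm_cst.
  move=> y /=; rewrite in_itv/= => /andP[y0 y1].
  have y01 : 0 <= y <= 1 by apply/andP; split; lra.
  by rewrite ind// mulr1 monoS// lerD2r incph'.
rewrite -opprB entropyB// lerNl -mulNr opprB.
rewrite -(fine_leb_itv true false rr) mulrC -Rintegral_cst//.
apply: itv_le => //; first exact: bm_cst.
move=> y /=; rewrite in_itv/= => /andP[y0 y1].
have y01 : 0 <= y <= 1 by apply/andP; split; lra.
by rewrite ind// mulr1 monoS// lerD2r incph'.
Qed.

(** [S (ph y - ph k)] is 0 for [y <= k], and 1 as soon as [y >= k + eta]. *)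
Lemma entropy_approx (dl eta : R) : 0 <= eta ->
  (forall r, dl <= r -> S r = 1) ->
  (forall r k, 0 <= r <= 1 -> 0 <= k <= 1 -> ph r - ph k <= dl -> r - k <= eta) ->
  forall r k, 0 <= r <= 1 -> 0 <= k <= 1 ->
  `|entropy r k - Order.max (r - k) 0| <= eta.
Proof.
move=> eta0 S1 mod r k r01 k01.
have /andP[r0 r1] := r01; have /andP[k0 k1] := k01.
have ind y : 0 <= y <= 1 -> \1_(`[0, 1]%classic) y = 1 :> R.
  by move=> y01; rewrite indicE mem_set.
have small s : 0 <= s -> s <= k -> entropy s k = 0.
  move=> s0 sk; rewrite /entropy (eq_Rintegral _ _ (g := fun=> 0)) ?Rintegral_cst ?mul0r//.
  move=> y; rewrite inE/= in_itv/= => /andP[y0 ys].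
  rewrite S0 ?mul0r// subr_le0 incph' ?y0//=; lra.
have [rk|kr] := leP r k.
  by rewrite small// max_r ?subrr ?normr0// subr_le0.
rewrite max_l; last by rewrite subr_ge0 ltW.
have E : entropy r k = \int[leb]_(y in `[k, r]) (S (ph y - ph k) * \1_(`[0, 1]%classic) y).
  by rewrite -(entropyB k k0 (ltW kr)) (small k)// subr0.
have up : entropy r k <= r - k.
  rewrite E -[leRHS]mul1r -(fine_leb_itv true false (ltW kr)) -Rintegral_cst//.
  apply: itv_le => //; first exact: bm_cst.
  move=> y /=; rewrite in_itv/= => /andP[y0 y1]; rewrite ind ?mulr1; last by apply/andP; split; lra.
  by have /andP[] := S01 (ph y - ph k).
have lo : r - k - eta <= entropy r k.
  have [h|h] := leP r (k + eta).
    rewrite (@le_trans _ _ 0)//; first by lra.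
    apply: Rintegral_ge0 => y _; by rewrite mulr_ge0//; have /andP[] := S01 (ph y - ph k).
  have h1 : k <= k + eta by lra.
  rewrite E (Rintegral_itv_cat (bint k) h1 (ltW h)) ler_wpDl//.
    apply: Rintegral_ge0 => y _; by rewrite mulr_ge0//; have /andP[] := S01 (ph y - ph k).
  rewrite -[leLHS]mul1r (_ : r - k - eta = r - (k + eta)); last by ring.
  rewrite -(fine_leb_itv true false (ltW h)) -Rintegral_cst//.
  rewrite -(Rintegral_itv_closed false false _ _ (bm_cst _ _)).
  rewrite -(Rintegral_itv_closed false false _ _ (bint k)).
  apply: itv_le => //; first exact: bm_cst.
  move=> y /=; rewrite in_itv/= => /andP[y0 y1].
  have y01 : 0 <= y <= 1 by apply/andP; split; lra.
  rewrite ind// mulr1 S1// leNgt; apply/negP => h2.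
  have := mod y k y01 k01 (ltW h2); lra.
by rewrite ler_norml; apply/andP; split; lra.
Qed.

(** The saturations [al'] and [al] of one solution at two instants are
    compared through the fixed profile [be]. Convexity bounds the increment of
    entropy by the increment of saturation times [S (z - zb)], and the latter,
    multiplied by the cutoff [xi], is Lipschitz; [P], the primitive of the
    increment of saturation, is the flux accumulated between the two instants,
    so one integration by parts concludes. *)
Lemma entropy_step (S1 : R -> R) (l r p : R) (w al al' be z fz zb fb P Pt xi xi1 : R -> R) :
  C11 S S1 -> -1 <= l -> r <= 1 -> 0 <= p ->
  bm w -> (forall x, l < x < r -> w x = p) ->
  bm al -> bm al' -> bm be ->
  (forall x, 0 <= al x <= 1) -> (forall x, 0 <= al' x <= 1) -> (forall x, 0 <= be x <= 1) ->
  bprim z fz -> bprim zb fb ->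
  {ae leb, forall x, l < x < r -> ph (al x) = z x} ->
  {ae leb, forall x, l < x < r -> ph (be x) = zb x} ->
  bprim P (fun x => w x * (al x - al' x)) -> P (-1) = 0 -> P 1 = 0 ->
  bm Pt -> {ae leb, forall x, -1 <= x <= 1 -> P x = Pt x} ->
  bprim xi xi1 -> (forall x, 0 <= xi x) ->
  (forall x, -1 < x < 1 -> ~~ (l < x < r) -> xi x = 0) ->
  \int[leb]_(x in `]l, r[) (p * (entropy (al x) (be x) - entropy (al' x) (be x)) * xi x)
  <= - \int[leb]_(x in `[-1, 1]) (Pt x *
        ((S1 (z x - zb x) * (fz x - fb x)) * xi x + S (z x - zb x) * xi1 x)).
Proof.
move=> SS l1 r1 p0 bw wp bal bal' bbe al01 al'01 be01 pz pzb zE zbE pP P0 P1 bPt PE pxi xi0 xiout.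
have pX := bprimM (bprim_comp SS (bprimB pz pzb)) pxi.
have [bz bfz _] := pz; have [bzb bfb _] := pzb; have [bP _ _] := pP.
have [bxi bxi1 _] := pxi; have [bX bG _] := pX.
set X := (fun x : R => _) in pX bX; set G := (fun x : R => _) in pX bG.
have m11 : (-1 : R) <= 1 by lra.
have parts := bprim_parts m11 pP pX P0 P1.
rewrite (_ : - _ = - \int[leb]_(x in `[-1, 1]) (P x * G x)); last first.
  congr (- _); apply: itv_ae_eq; [exact: bmM|exact: bmM|].
  by apply: ae1 PE _ => x h /=; rewrite in_itv/= => /h ->.
rewrite -parts.
have bphal : bm (fun x => ph (al x)) by exact: bm_continuous_comp.
have bphbe : bm (fun x => ph (be x)) by exact: bm_continuous_comp.
have bSa : bm (fun x => S (ph (al x) - ph (be x))).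
  by apply: bm_continuous_comp => //; exact: bmB.
have be1 : bm (fun x => entropy (al x) (be x)) by apply: entropy_bm; [exact: bal.1|exact: bbe.1].
have be2 : bm (fun x => entropy (al' x) (be x)) by apply: entropy_bm; [exact: bal'.1|exact: bbe.1].
have bY : bm (fun x => p * ((al x - al' x) * S (ph (al x) - ph (be x))) * xi x).
  apply: bmM => //; apply: bmM; first exact: bm_cst.
  by apply: bmM => //; exact: bmB.
apply: (@le_trans _ _ (\int[leb]_(x in `]l, r[)
    (p * ((al x - al' x) * S (ph (al x) - ph (be x))) * xi x))).
  apply: itv_le => //.
    by apply: bmM => //; apply: bmM; [exact: bm_cst|exact: bmB].
  by move=> x _; rewrite ler_wpM2r// ler_wpM2l// entropy_convex.
have bZ : bm (fun x => w x * (al x - al' x) * X x).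
  by apply: bmM => //; apply: bmM => //; exact: bmB.
rewrite (itv_ae_eq (g := fun x => w x * (al x - al' x) * X x)) //; last first.
  apply: ae2 zE zbE _ => x h1 h2 /=; rewrite in_itv/= => lxr.
  by rewrite /X wp// h1// h2//; ring.
rewrite -(Rintegral_itv_closed false true (-1) 1 bZ).
rewrite (@Rintegral_subset _ `]l, r[%classic `]-1, 1[%classic) ?lexx//.
  move=> x /=; rewrite !in_itv/= => /andP[lx xr]; apply/andP; split; lra.
move=> x /=; rewrite !in_itv/= => x11 /negP xlr.
by rewrite /X (xiout _ x11 xlr) !mulr0.
Qed.

End entropy.

(** * Iterated integrals and averages in time *)

Section iterated_integrals.
Context (R : realType).
Local Notation leb := (@lebesgue_measure R).
Variable T : R.
Hypothesis T0 : 0 < T.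

Definition I2 (f : R * R -> R) : R :=
  \int[leb]_(t in `]0, T[) (\int[leb]_(s in `]0, T[) f (t, s)).

Lemma bm_section1 d (X : measurableType d) (f : X * R -> R) (x : X) : bm f -> bm (fun y => f (x, y)).
Proof. by move=> bf; apply: (bm_comp _ bf); exact: measurable_pair1. Qed.

Lemma bm_section2 (f : R * R -> R) (y : R) : bm f -> bm (fun x => f (x, y)).
Proof. by move=> bf; apply: (bm_comp _ bf); exact: measurable_pair2. Qed.

Let b1 (f : R * R -> R) : bm f -> bm (fun t => \int[leb]_(s in `]0, T[) f (t, s)).
Proof. by move=> bf; apply: (bm_param _ _ bf) => //; exact: leb_itv_lty. Qed.

Lemma I2D f g : bm f -> bm g -> I2 (fun p => f p + g p) = I2 f + I2 g.
Proof.
move=> bf bg; rewrite /I2 -itvD; [|exact: b1|exact: b1].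
by apply: eq_Rintegral => t _; rewrite itvD//; exact: bm_section1.
Qed.

Lemma I2N f : bm f -> I2 (fun p => - f p) = - I2 f.
Proof.
move=> bf; rewrite /I2 -itvN; last exact: b1.
by apply: eq_Rintegral => t _; rewrite itvN//; exact: bm_section1.
Qed.

Lemma I2B f g : bm f -> bm g -> I2 (fun p => f p - g p) = I2 f - I2 g.
Proof. by move=> bf bg; rewrite I2D ?I2N//; exact: bmN. Qed.

Lemma I2_ae_le f g (A B : R -> Prop) : bm f -> bm g ->
  {ae leb, forall t, t \in `]0, T[ -> A t} -> {ae leb, forall s, s \in `]0, T[ -> B s} ->
  (forall t s, t \in `]0, T[ -> s \in `]0, T[ -> A t -> B s -> f (t, s) <= g (t, s)) ->
  I2 f <= I2 g.
Proof.
move=> bf bg aA aB fg; apply: itv_ae_le; [exact: b1|exact: b1|].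
apply: ae1 aA _ => t At Jt; apply: itv_ae_le; [exact: bm_section1|exact: bm_section1|].
by apply: ae1 aB _ => s Bs Js; apply: fg => //; [exact: At|exact: Bs].
Qed.

Lemma I2_le f g : bm f -> bm g ->
  (forall t s, t \in `]0, T[ -> s \in `]0, T[ -> f (t, s) <= g (t, s)) -> I2 f <= I2 g.
Proof.
by move=> bf bg fg; apply: (@I2_ae_le f g (fun=> True) (fun=> True)) => //;
  try exact: ae_all; move=> t s Jt Js _ _; exact: fg.
Qed.

Lemma I2_ext f g :
  (forall t s, t \in `]0, T[ -> s \in `]0, T[ -> f (t, s) = g (t, s)) -> I2 f = I2 g.
Proof.
move=> fg; apply: eq_Rintegral => t tJ; apply: eq_Rintegral => s sJ.
by rewrite !inE/= in tJ sJ; exact: fg.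
Qed.

Lemma I2_bound f M : bm f ->
  (forall t s, t \in `]0, T[ -> s \in `]0, T[ -> `|f (t, s)| <= M) ->
  `|I2 f| <= M * T * T.
Proof.
move=> bf fM; have T1 := ltW T0.
have E (K : R) : \int[leb]_(t in `]0, T[) K = K * T.
  by rewrite Rintegral_cst// fine_leb_itv// subr0.
rewrite (le_trans (itv_norm _ _ _ _ (b1 bf)))// -E.
apply: itv_le; [exact: bm_norm (b1 bf)|exact: bm_cst|].
move=> t Jt; rewrite (le_trans (itv_norm _ _ _ _ (bm_section1 t bf)))// -E.
apply: itv_le; [exact: bm_norm (bm_section1 t bf)|exact: bm_cst|].
by move=> s Js; exact: fM.
Qed.

Lemma I2_swap f : bm f -> I2 f = I2 (fun p => f (p.2, p.1)).
Proof. by move=> bf; rewrite /I2 bm_swap//; exact: leb_itv_lty. Qed.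

Lemma bm_swap_args (f : R * R -> R) : bm f -> bm (fun p => f (p.2, p.1)).
Proof.
move=> bf; apply: (bm_comp (h := fun p : R * R => (p.2, p.1)) _ bf).
exact: measurable_fun_pair.
Qed.

(** A discrete integration by parts: the support of [th] leaves room for the
    shift. *)
Lemma shift_test (e th : R -> R) (d h : R) : bm e -> bm th -> 0 <= h -> h < d ->
  (forall t, th t != 0 -> d <= t <= T - d) ->
  \int[leb]_(t in `]0, T[) (e (t - h) * th t) =
  \int[leb]_(t in `]0, T[) (e t * th (t + h)).
Proof.
move=> be bth h0 hd supp.
have mh (k : R) : measurable_fun setT (fun t : R => t + k).
  by apply: measurable_funD => //; exact: measurable_cst.
have bf : bm (fun t => e t * th (t + h)) by apply: bmM => //; exact: bm_comp bth.
have := Rintegral_translate (- h) (measurable_itv `]0, T[) (leb_itv_lty false true 0 T) bf.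
move=> <-.
have out t : ~ (d <= t <= T - d) -> th t = 0.
  by move=> nt; apply/eqP; apply: contra_notT nt; exact: supp.
transitivity (\int[leb]_(t in `[d, T - d]) (e (t - h) * th t)).
  apply/esym/Rintegral_subset.
    by move=> t /=; rewrite !in_itv/= => /andP[? ?]; apply/andP; split; lra.
  by move=> t _ /=; rewrite in_itv/= => /out ->; rewrite mulr0.
transitivity (\int[leb]_(t in `[d, T - d]) (e (t - h) * th (t - h + h))).
  by apply: eq_Rintegral => t _; rewrite subrK.
apply: Rintegral_subset.
  by move=> t /=; rewrite !in_itv/= => /andP[? ?]; apply/andP; split; lra.
by move=> t _ /=; rewrite in_itv/= subrK => /out ->; rewrite mulr0.
Qed.

(** The backward difference quotient of [e], integrated against [th], is the
    forward one of [th] against [e]; the remainder of the expansion of [th]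
    has size [h], the time step. *)
Lemma difference_quotient (e th th1 : R -> R) (d C M : R) (n : nat) :
  bm e -> bm th -> bm th1 -> (n.+1%:R^-1 : R) < d -> (forall t, `|e t| <= M) ->
  (forall t, th t != 0 -> d <= t <= T - d) ->
  (forall t h, `|th (t + h) - th t - h * th1 t| <= C * h ^+ 2) ->
  `|\int[leb]_(t in `]0, T[) (n.+1%:R * (e t - e (t - n.+1%:R^-1)) * th t) +
    \int[leb]_(t in `]0, T[) (e t * th1 t)| <= M * C * T * n.+1%:R^-1.
Proof.
move=> be bth bth1 hd eM supp thC; set h : R := n.+1%:R^-1 in hd *.
have h0 : 0 < h by rewrite invr_gt0.
have nh : n.+1%:R * h = 1 :> R by rewrite mulfV.
have mh (k : R) : measurable_fun setT (fun t : R => t + k).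
  by apply: measurable_funD => //; exact: measurable_cst.
have be' : bm (fun t : R => e (t - h)) by exact: bm_comp be.
have bth' : bm (fun t : R => th (t + h)) by exact: bm_comp bth.
have bn : bm (fun _ : R => (n.+1%:R : R)) by exact: bm_cst.
have -> : \int[leb]_(t in `]0, T[) (n.+1%:R * (e t - e (t - h)) * th t) =
    n.+1%:R * (\int[leb]_(t in `]0, T[) (e t * th t) - \int[leb]_(t in `]0, T[) (e (t - h) * th t)).
  rewrite -itvB; [|exact: bmM|exact: bmM].
  rewrite -itvZl; last by apply: bmB; exact: bmM.
  by apply: eq_Rintegral => t _; ring.
rewrite (shift_test be bth (ltW h0) hd supp).
rewrite -itvB; [|exact: bmM|exact: bmM].
rewrite -itvZl; last by apply: bmB; exact: bmM.
rewrite -itvD; [|apply: bmM => //; apply: bmB; exact: bmM|exact: bmM].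
have M0 : 0 <= M by exact: le_trans (eM 0).
have C0 : 0 <= C.
  have := thC 0 1; rewrite expr1n mulr1; exact: le_trans.
rewrite (Rintegral_itv_closed false true).
  rewrite [leRHS](_ : _ = M * C * h * (T - 0)); last by ring.
  apply: Rintegral_itv_bound; [|exact: ltW|].
    by apply: bmD; [apply: bmM => //; apply: bmB; exact: bmM|exact: bmM].
  move=> t _.
  rewrite (_ : _ + _ = e t * (- n.+1%:R * (th (t + h) - th t - h * th1 t))); last first.
    apply/eqP; rewrite -subr_eq0; apply/eqP.
    by transitivity (e t * th1 t * (1 - n.+1%:R * h)); [ring|rewrite nh subrr mulr0].
  rewrite normrM -mulrA ler_pM// normrM normrN [`|n.+1%:R|]ger0_norm//.
  rewrite (le_trans (ler_wpM2l _ (thC t h)))// mulrCA ler_wpM2l//.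
  by rewrite expr2 mulrA nh mul1r.
by apply: bmD; [apply: bmM => //; apply: bmB; exact: bmM|exact: bmM].
Qed.

End iterated_integrals.

Section steklov.
Context (R : realType).
Local Notation leb := (@lebesgue_measure R).
Variables (T : R) (f : R * R -> R).
Hypotheses (T0 : 0 < T) (bf : bm f) (f0 : forall x t, t < 0 \/ T < t -> f (x, t) = 0).

Definition cumul (p : R * R) : R := \int[leb]_(t in `[0, p.2]) f (p.1, t).

Lemma cumul_bm : bm cumul.
Proof. by apply: (@bm_indefinite R _ R 0 T f) => // -[x t] /=; exact: f0. Qed.

Lemma cumul_bprim x : bprim (fun t => cumul (x, t)) (fun t => f (x, t)).
Proof.
apply: (@bprim_indefinite R 0 T (fun t => f (x, t))); first exact: bm_section1.
by move=> t; exact: f0.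
Qed.

(** Backward average in time, written with the accumulated flux because
    increments of the latter are what the balance provides. *)
Definition steklov (n : nat) (p : R * R) : R :=
  n.+1%:R * (cumul p - cumul (p.1, p.2 - n.+1%:R^-1)).

Lemma steklov_bm n : bm (steklov n).
Proof.
apply: bmM; first exact: bm_cst.
apply: bmB; first exact: cumul_bm.
apply: (bm_comp (h := fun p : R * R => (p.1, p.2 - n.+1%:R^-1)) _ cumul_bm).
apply: measurable_fun_pair => //.
by apply: measurable_funB => //; exact: measurable_cst.
Qed.

Lemma steklovE n x t : steklov n (x, t) =
  n.+1%:R * \int[leb]_(s in `[t - n.+1%:R^-1, t]) f (x, s).
Proof.
have [_ _ <-//] := cumul_bprim x.
by rewrite gerBl invr_ge0.
Qed.

Lemma steklov_bound : exists2 K : R, 0 <= K & (forall p, `|f p| <= K) /\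
  forall n p, `|steklov n p| <= K.
Proof.
have [_ [K fK]] := bf; exists K; first exact: le_trans (fK (0, 0)).
split => // n [x t]; rewrite steklovE normrM ger0_norm//.
rewrite mulrC -ler_pdivlMr ?ltr0n//.
have nt : t - n.+1%:R^-1 <= t by rewrite gerBl invr_ge0.
have h := Rintegral_itv_bound (bm_section1 x bf) nt (fun s _ => fK (x, s)).
by rewrite opprB addrCA subrr addr0 in h.
Qed.

(** Backward averages converge at almost every time, and dominated convergence
    applies twice. *)
Lemma steklov_L1 : \int[leb]_(t in `]0, T[) (\int[leb]_(x in `[-1, 1])
  `|steklov n (x, t) - f (x, t)|) @[n --> \oo] --> (0 : R).
Proof.
have [K K0 [fK sK]] := steklov_bound.
have bd n : bm (fun p => `|steklov n p - f p|).
  by apply: bm_norm; apply: bmB => //; exact: steklov_bm.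
have E n : \int[leb]_(t in `]0, T[) (\int[leb]_(x in `[-1, 1]) `|steklov n (x, t) - f (x, t)|) =
  \int[leb]_(x in `[-1, 1]) (\int[leb]_(t in `]0, T[) `|steklov n (x, t) - f (x, t)|).
  by rewrite [RHS](bm_swap _ _ _ _ (bd n))//; exact: leb_itv_lty.
have I0 : \int[leb]_(x in `[-1, 1]) (fun=> 0) x = 0 :> R by rewrite Rintegral_cst// mul0r.
suff : \int[leb]_(x in `[-1, 1]) (\int[leb]_(t in `]0, T[) `|steklov n (x, t) - f (x, t)|)
    @[n --> \oo] --> \int[leb]_(x in `[-1, 1]) (fun=> 0 : R) x.
  rewrite I0; apply: cvg_trans; apply: near_eq_cvg; apply: nearW => n; exact/esym/E.
apply: (@bounded_cvg _ _ _ leb `[-1, 1]%classic _ _ _ _ ((K + K) * T)) => //.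
- exact: leb_itv_lty.
- by move=> n; apply: (measurable_Rintegral_param _ (bd n).1).
- exact: bm_cst.
- move=> n x _.
  rewrite (Rintegral_itv_closed false true); last exact: bm_section1 (bd n).
  rewrite -[X in _ * X](subr0 T); apply: Rintegral_itv_bound; [|exact: ltW|].
    exact: bm_section1 (bd n).
  by move=> t _; rewrite normr_id (le_trans (ler_normB _ _))// lerD.
- apply: aeW => x _.
  apply: (@bounded_cvg_L1 _ _ _ leb `]0, T[%classic _ _ _ _ K) => //.
  + exact: leb_itv_lty.
  + by move=> n; exact: (bm_section1 x (steklov_bm n)).1.
  + exact: bm_section1.
  + apply: ae1 (bm_lebesgue_pt (bm_section1 x bf)) _ => t lt _.
    under eq_fun do rewrite steklovE.
    by apply: cvg_backward_average => //; exact: bm_section1.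
Qed.

End steklov.

(** * Kato inequality in one time variable *)

(** What is used of a solution in a subdomain [[l, r]] with transform [ph].
    [a] is the saturation, [f] the flux, [z] the Lipschitz version of [ph a],
    and [D] the mass stored on the left of a point since the initial time. [D]
    has derivative [w (a - a0)] on the whole domain, and coincides with the
    accumulated flux at the times that satisfy [good]. *)
Record side_sol (R : realType) (T l r : R) (w ph : R -> R)
    (a f z D : R * R -> R) (good : R -> Prop) : Prop := SideSol {
  ss_bm : bm a;
  ss_itv : forall p, 0 <= a p <= 1;
  ss_fbm : bm f;
  ss_fout : forall x t, t < 0 \/ T < t -> f (x, t) = 0;
  ss_zbm : bm z;
  ss_z : forall t, bprim (fun x => z (x, t)) (fun x => f (x, t) * \1_(`]l, r[%classic) x);
  ss_phz : forall t, good t ->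
    {ae @lebesgue_measure R, forall x, l < x < r -> ph (a (x, t)) = z (x, t)};
  ss_D : exists a0 : R -> R,
    forall t, bprim (fun x => D (x, t)) (fun x => w x * (a (x, t) - a0 x));
  ss_Dl : forall t, D (-1, t) = 0;
  ss_Dr : forall t, good t -> D (1, t) = 0;
  ss_DF : forall t, good t ->
    {ae @lebesgue_measure R, forall x, -1 <= x <= 1 -> D (x, t) = cumul f (x, t)};
  ss_good : {ae @lebesgue_measure R, forall t, t \in `]0, T[ -> good t} }.

(** The derivatives [th1] and [th2] of a weight [th] on the square of times
    are encoded by expansions with quadratic remainder, which is what
    difference quotients require. *)
Record test_weight (R : realType) (T : R) (th th1 th2 : R * R -> R) : Prop := TestWeight {
  tw_bm : bm th;
  tw_bm1 : bm th1;
  tw_bm2 : bm th2;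
  tw_ge0 : forall p, 0 <= th p;
  tw_supp : exists2 d, 0 < d & forall t s, th (t, s) != 0 ->
    (d <= t <= T - d) /\ (d <= s <= T - d);
  tw_deriv : exists C, forall t s h,
    `|th (t + h, s) - th (t, s) - h * th1 (t, s)| <= C * h ^+ 2 /\
    `|th (t, s + h) - th (t, s) - h * th2 (t, s)| <= C * h ^+ 2 }.

Section difference.
Context (R : realType).
Local Notation leb := (@lebesgue_measure R).

Lemma I2_difference (T : R) (e th th1 : R * R -> R) (d C M : R) (n : nat) : 0 < T ->
  bm e -> bm th -> bm th1 -> (n.+1%:R^-1 : R) < d -> (forall q, `|e q| <= M) ->
  (forall t s, th (t, s) != 0 -> d <= t <= T - d) ->
  (forall t s h, `|th (t + h, s) - th (t, s) - h * th1 (t, s)| <= C * h ^+ 2) ->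
  `|I2 T (fun q => n.+1%:R * (e q - e (q.1 - n.+1%:R^-1, q.2)) * th q) +
    I2 T (fun q => e q * th1 q)| <= M * C * T * n.+1%:R^-1 * T.
Proof.
move=> T0 be bth bth1 hd eM supp thC; set h : R := n.+1%:R^-1.
have be' : bm (fun q : R * R => e (q.1 - h, q.2)).
  apply: (bm_comp (h := fun q : R * R => (q.1 - h, q.2)) _ be).
  apply: measurable_fun_pair => //.
  by apply: measurable_funB => //; exact: measurable_cst.
have b1 : bm (fun q : R * R => n.+1%:R * (e q - e (q.1 - h, q.2)) * th q).
  by apply: bmM => //; apply: bmM; [exact: bm_cst|exact: bmB].
have b2 : bm (fun q : R * R => e q * th1 q) by exact: bmM.
rewrite -I2D// I2_swap; last exact: bmD.
have b3 := bm_swap_args (bmD b1 b2).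
have b4 : bm (fun s => \int[leb]_(t in `]0, T[)
    (n.+1%:R * (e (t, s) - e (t - h, s)) * th (t, s) + e (t, s) * th1 (t, s))).
  by apply: (bm_param (F := fun q => _ * (e (q.2, q.1) - e (q.2 - h, q.1)) * th (q.2, q.1) + e (q.2, q.1) * th1 (q.2, q.1))) => //; exact: leb_itv_lty.
rewrite /I2 (Rintegral_itv_closed false true)//.
rewrite -[X in _ * X]subr0; apply: Rintegral_itv_bound => //; first exact: ltW.
move=> s _; rewrite itvD; [|exact: bm_section2 b1|exact: bm_section2 b2].
exact: (@difference_quotient R T T0 (fun t => e (t, s)) (fun t => th (t, s))
  (fun t => th1 (t, s)) d C M n (bm_section2 s be) (bm_section2 s bth)
  (bm_section2 s bth1) hd (fun t => eM (t, s)) (fun t => @supp t s) (fun t => thC t s)).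
Qed.

End difference.

Section time_integration.
Context (R : realType).
Local Notation leb := (@lebesgue_measure R).

Lemma bm_xt (f : R * R -> R) : bm f -> bm (fun q : (R * R) * R => f (q.2, q.1.1)).
Proof.
move=> bf; apply: (bm_comp (h := fun q : (R * R) * R => (q.2, q.1.1)) _ bf).
apply: measurable_fun_pair; first exact: measurable_snd.
exact: (measurableT_comp measurable_fst measurable_fst).
Qed.

Lemma bm_xs (f : R * R -> R) : bm f -> bm (fun q : (R * R) * R => f (q.2, q.1.2)).
Proof.
move=> bf; apply: (bm_comp (h := fun q : (R * R) * R => (q.2, q.1.2)) _ bf).
apply: measurable_fun_pair; first exact: measurable_snd.
exact: (measurableT_comp measurable_snd measurable_fst).
Qed.

Lemma bm_x (f : R -> R) : bm f -> bm (fun q : (R * R) * R => f q.2).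
Proof. by move=> bf; apply: (bm_comp (h := snd) _ bf); exact: measurable_snd. Qed.

(** [e1] satisfies a one-sided estimate of its increments in the first
    variable by the accumulated flux. Dividing by the time step, the flux
    becomes its backward average, which converges in L^1; the increments of
    [e1] are transferred to the weight. *)
Lemma integrate_increments (T : R) (e1 f : R * R -> R) (G : (R * R) * R -> R)
    (gu gv : R -> Prop) (th th1 th2 : R * R -> R) : 0 < T ->
  bm e1 -> bm G -> bm f -> (forall x t, t < 0 \/ T < t -> f (x, t) = 0) ->
  {ae leb, forall t, t \in `]0, T[ -> gu t} -> {ae leb, forall t, t \in `]0, T[ -> gv t} ->
  (forall t t' s, gu t -> gu t' -> gv s -> e1 (t, s) - e1 (t', s) <=
     - \int[leb]_(x in `[-1, 1]) ((cumul f (x, t) - cumul f (x, t')) * G ((t, s), x))) ->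
  test_weight T th th1 th2 ->
  - I2 T (fun q => e1 q * th1 q) <=
  - I2 T (fun q => th q * \int[leb]_(x in `[-1, 1]) (f (x, q.1) * G (q, x))).
Proof.
have aux : forall a b x : R, - x <= a + b -> - b <= a + x by move=> a b x; lra.
move=> T0 be1 bG bf fout gu_ae gv_ae step tw.
have [d d0 supp] := tw_supp tw; have [C thC] := tw_deriv tw.
have bth := tw_bm tw; have bth1 := tw_bm1 tw.
have [_ [M eM]] := be1; have [_ [Mth thM]] := bth; have [_ [MG GM]] := bG.
have M0 : 0 <= M by exact: le_trans (eM (0, 0)).
have Mth0 : 0 <= Mth by exact: le_trans (thM (0, 0)).
have MG0 : 0 <= MG by exact: le_trans (GM ((0, 0), 0)).
have C0 : 0 <= C.
  by have [+ _] := thC 0 0 1; rewrite expr1n mulr1; exact: le_trans.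
have bG' (k : R * R -> R) : bm k ->
    bm (fun q : R * R => \int[leb]_(x in `[-1, 1]) (k (x, q.1) * G (q, x))).
  move=> bk; apply: (@bm_param R _ _ (fun q : (R * R) * R => k (q.2, q.1.1) * G (q.1, q.2))) => //.
    exact: leb_itv_lty.
  apply: bmM; first exact: bm_xt.
  apply: (bm_comp (h := fun q : (R * R) * R => (q.1, q.2)) _ bG).
  exact: measurable_fun_pair.
have bst n : bm (steklov f n) by exact: steklov_bm bf fout n.
pose ep n := \int[leb]_(t in `]0, T[) (\int[leb]_(x in `[-1, 1]) `|steklov f n (x, t) - f (x, t)|).
have ep0 : ep n @[n --> \oo] --> (0 : R) by exact: steklov_L1.
have har0 : n.+1%:R^-1 @[n --> \oo] --> (0 : R) by exact: cvg_harmonic.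
have be1' h : bm (fun q : R * R => e1 (q.1 - h, q.2)).
  apply: (bm_comp (h := fun q : R * R => (q.1 - h, q.2)) _ be1).
  apply: measurable_fun_pair => //.
  by apply: measurable_funB => //; exact: measurable_cst.
have main n : n.+1%:R^-1 < d ->
    - I2 T (fun q => e1 q * th1 q) <=
    - I2 T (fun q => th q * \int[leb]_(x in `[-1, 1]) (f (x, q.1) * G (q, x))) +
    (M * C * T * T * n.+1%:R^-1 + Mth * MG * T * ep n).
  move=> hd; set h : R := n.+1%:R^-1 in hd *.
  have h0 : 0 <= h by rewrite invr_ge0.
  have bL : bm (fun q : R * R => n.+1%:R * (e1 q - e1 (q.1 - h, q.2)) * th q).
    by apply: bmM => //; apply: bmM; [exact: bm_cst|apply: bmB => //; exact: be1'].
  have bRs : bm (fun q => th q * \int[leb]_(x in `[-1, 1]) (steklov f n (x, q.1) * G (q, x))).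
    by apply: bmM => //; exact: bG'.
  have bRf : bm (fun q => th q * \int[leb]_(x in `[-1, 1]) (f (x, q.1) * G (q, x))).
    by apply: bmM => //; exact: bG'.
  (* the increments over a time step, integrated against the weight *)
  have step1 : I2 T (fun q : R * R => n.+1%:R * (e1 q - e1 (q.1 - h, q.2)) * th q) <=
      - I2 T (fun q => th q * \int[leb]_(x in `[-1, 1]) (steklov f n (x, q.1) * G (q, x))).
    rewrite -I2N//.
    apply: (@I2_ae_le R T _ _ (fun t => gu t /\ (t - h \in `]0, T[ -> gu (t - h))) gv) => //.
    - exact: bmN.
    - apply: ae2 gu_ae (ae_translate (- h) gu_ae) _ => t g1 g2 tJ.
      by split; [exact: g1|exact: g2].
    move=> t s; rewrite !in_itv/= => tJ sJ [gut gut'] gvs.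
    have [->|thn0] := eqVneq (th (t, s)) 0; first by rewrite mulr0 mul0r oppr0.
    have [/andP[dt tT] _] := supp _ _ thn0.
    (* the support of the weight stays at distance larger than h from 0 *)
    have {}gut' : gu (t - h) by apply: gut'; apply/andP; split; lra.
    rewrite mulrC -mulrN ler_wpM2l ?(tw_ge0 tw)//.
    have := step _ _ _ gut gut' gvs.
    move=> /(ler_wpM2l (ler0n R n.+1)) H; apply: le_trans H _.
    rewrite mulrN -itvZl; last first.
      apply: bmM; last exact: (bm_section1 (t, s) bG).
      by apply: bmB; exact: (bm_section2 _ (cumul_bm bf fout)).
    rewrite lerN2 le_eqVlt; apply/orP; left; apply/eqP; apply: eq_Rintegral => x _.
    by rewrite /steklov/= -/h; ring.
  have step2 : - I2 T (fun q => e1 q * th1 q) <=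
      I2 T (fun q : R * R => n.+1%:R * (e1 q - e1 (q.1 - h, q.2)) * th q) + M * C * T * T * h.
    have := I2_difference T0 be1 bth bth1 hd eM (fun t s h => (supp t s h).1)
      (fun t s h => (thC t s h).1).
    rewrite ler_norml -/h => /andP[+ _].
    rewrite (_ : M * C * T * h * T = M * C * T * T * h); last ring.
    exact: aux.
  have step3 : - I2 T (fun q => th q * \int[leb]_(x in `[-1, 1]) (steklov f n (x, q.1) * G (q, x))) <=
      - I2 T (fun q => th q * \int[leb]_(x in `[-1, 1]) (f (x, q.1) * G (q, x))) + Mth * MG * T * ep n.
    rewrite -lerBlDl opprK addrC -I2B//.
    have bd : bm (fun p => `|steklov f n p - f p|) by apply: bm_norm; apply: bmB.
    have bV : bm (fun q : R * R => (Mth * MG) * \int[leb]_(x in `[-1, 1]) `|steklov f n (x, q.1) - f (x, q.1)|).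
      apply: bmM; first exact: bm_cst.
      apply: (@bm_param R _ _ (fun q : (R * R) * R => `|steklov f n (q.2, q.1.1) - f (q.2, q.1.1)|)) => //.
        exact: leb_itv_lty.
      exact: (bm_xt bd).
    rewrite (_ : Mth * MG * T * ep n =
        I2 T (fun q : R * R => (Mth * MG) * \int[leb]_(x in `[-1, 1]) `|steklov f n (x, q.1) - f (x, q.1)|)); last first.
      rewrite /I2 /ep -itvZl; last first.
        apply: (bm_param (F := fun q => `|steklov f n (q.2, q.1) - f (q.2, q.1)|)) => //.
          exact: leb_itv_lty.
        exact: bm_swap_args bd.
      apply: eq_Rintegral => t _ /=.
      by rewrite Rintegral_cst// fine_leb_itv ?ltW// subr0; ring.
    apply: I2_le => //; first exact: bmB.
    move=> t s tJ sJ /=.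
    have bGs : bm (fun x => G ((t, s), x)) by exact: (bm_section1 (t, s) bG).
    have bsx : bm (fun x => steklov f n (x, t)) by exact: bm_section2 (bst n).
    have bfx : bm (fun x => f (x, t)) by exact: bm_section2 bf.
    rewrite -mulrBr -itvB; [|exact: bmM|exact: bmM].
    rewrite -mulrA (le_trans (ler_norm _))// normrM ler_pM//.
    rewrite (le_trans (itv_norm _ _ _ _ _))//; first by apply: bmB; exact: bmM.
    rewrite -itvZl; last exact: bm_section2 bd.
    apply: itv_le.
    - by apply: bm_norm; apply: bmB; exact: bmM.
    - by apply: bmM; [exact: bm_cst|exact: bm_section2 bd].
    - by move=> x _; rewrite -mulrBl normrM mulrC distrC ler_wpM2r.
  apply: (le_trans step2); rewrite [X in _ <= _ + X]addrC addrA lerD2r.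
  exact: le_trans step1 step3.
apply/ler_addgt0Pr => e e0.
near \oo => n.
have hn : n.+1%:R^-1 < d.
  near: n; move/cvgrPdist_lt : har0 => /(_ d d0); apply: filterS => n.
  by rewrite sub0r normrN ger0_norm.
apply: le_trans (main n hn) _; rewrite lerD2l.
near: n.
have : (M * C * T * T * n.+1%:R^-1 + Mth * MG * T * ep n) @[n --> \oo] -->
    (M * C * T * T * 0 + Mth * MG * T * 0 : R).
  by apply: cvgD; apply: cvgMr.
rewrite !mulr0 addr0 => /cvgrPdist_le /(_ e e0); apply: filterS => n.
by rewrite sub0r normrN; apply: le_trans; exact: ler_norm.
Unshelve. all: end_near. Qed.

End time_integration.

Section half_kato.
Context (R : realType).
Local Notation leb := (@lebesgue_measure R).
Variables (T l r p : R) (w : R -> R).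
Hypotheses (T0 : 0 < T) (l1 : -1 <= l) (lr : l <= r) (r1 : r <= 1) (p0 : 0 <= p).
Hypotheses (bw : bm w) (wp : forall x, l < x < r -> w x = p).
Variables (dl : R) (Sg S S1 : R -> R) (rmp : ramp dl Sg S S1) (xi xi1 : R -> R).
Hypotheses (pxi : bprim xi xi1) (xi0 : forall x, 0 <= xi x)
  (xiout : forall x, -1 < x < 1 -> ~~ (l < x < r) -> xi x = 0).

(** The space derivative of the test function [S (z - zb) xi]. *)
Definition kato_flux (f z g zb : R * R -> R) (q : (R * R) * R) : R :=
  S1 (z (q.2, q.1.1) - zb (q.2, q.1.2)) *
    (f (q.2, q.1.1) * \1_(`]l, r[%classic) q.2 - g (q.2, q.1.2) * \1_(`]l, r[%classic) q.2) *
    xi q.2 +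
  S (z (q.2, q.1.1) - zb (q.2, q.1.2)) * xi1 q.2.

Definition kato_entropy (ph : R -> R) (a b : R * R -> R) (q : R * R) : R :=
  \int[leb]_(x in `]l, r[) (p * entropy S ph (a (x, q.1)) (b (x, q.2)) * xi x).

Let bS1 : continuous S1. Proof. exact: C11_continuous' (ramp_C11 rmp). Qed.
Let bS : continuous S. Proof. exact: C11_continuous (ramp_C11 rmp). Qed.

Lemma kato_flux_bm f z g zb : bm f -> bm z -> bm g -> bm zb -> bm (kato_flux f z g zb).
Proof.
move=> bf bz bg bzb; have [bxi bxi1 _] := pxi.
have bi : bm (\1_(`]l, r[%classic) : R -> R) by exact: bm_indic.
have bd : bm (fun q : (R * R) * R => z (q.2, q.1.1) - zb (q.2, q.1.2)).
  by apply: bmB; [exact: bm_xt|exact: bm_xs].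
apply: bmD; apply: bmM; [|exact: bm_x|exact: bm_continuous_comp|exact: bm_x].
apply: bmM; first exact: bm_continuous_comp.
by apply: bmB; apply: bmM; [exact: bm_xt|exact: bm_x|exact: bm_xs|exact: bm_x].
Qed.

Lemma kato_entropy_bm ph a b : continuous ph -> bm a -> bm b -> bm (kato_entropy ph a b).
Proof.
move=> cph ba bb; have [bxi bxi1 _] := pxi.
apply: (@bm_param R _ _ (fun q : (R * R) * R =>
   p * entropy S ph (a (q.2, q.1.1)) (b (q.2, q.1.2)) * xi q.2)) => //.
  exact: leb_itv_lty.
apply: bmM; last exact: bm_x.
apply: bmM; first exact: bm_cst.
apply: entropy_bm => //; first exact: ramp_itv rmp.
  exact: (bm_xt ba).1.
exact: (bm_xs bb).1.
Qed.

Section with_solutions.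
Variables (ph : R -> R) (a f z D b g zb Db : R * R -> R) (gu gv : R -> Prop).
Hypotheses (cph : continuous ph) (iph : {in `[0, 1] &, {homo ph : x y / x < y}}).
Hypotheses (su : side_sol T l r w ph a f z D gu) (sv : side_sol T l r w ph b g zb Db gv).

Let e1 := kato_entropy ph a b.
Let G := kato_flux f z g zb.

Let be1 : bm e1. Proof. exact: kato_entropy_bm (ss_bm su) (ss_bm sv). Qed.
Let bG : bm G.
Proof. exact: kato_flux_bm (ss_fbm su) (ss_zbm su) (ss_fbm sv) (ss_zbm sv). Qed.

Lemma kato_step t t' s : gu t -> gu t' -> gv s ->
  e1 (t, s) - e1 (t', s) <=
  - \int[leb]_(x in `[-1, 1]) ((cumul f (x, t) - cumul f (x, t')) * G ((t, s), x)).
Proof.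
move=> gt gt' gs; have [a0 pD] := ss_D su.
have bcu := cumul_bm (ss_fbm su) (ss_fout su).
have bat u : bm (fun x => a (x, u)) by exact: bm_section2 (ss_bm su).
have bbs : bm (fun x => b (x, s)) by exact: bm_section2 (ss_bm sv).
have [bxi _ _] := pxi.
have pP : bprim (fun x => D (x, t) - D (x, t')) (fun x => w x * (a (x, t) - a (x, t'))).
  have := bprimB (pD t) (pD t').
  rewrite (_ : (fun x => _ - w x * _) = (fun x => w x * (a (x, t) - a (x, t'))))//.
  by apply/funext => x; ring.
have PE : {ae leb, forall x, -1 <= x <= 1 -> D (x, t) - D (x, t') = cumul f (x, t) - cumul f (x, t')}.
  by apply: ae2 (ss_DF su gt) (ss_DF su gt') _ => x h1 h2 x1; rewrite h1// h2.
have bPt : bm (fun x => cumul f (x, t) - cumul f (x, t')).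
  by apply: bmB; exact: bm_section2 bcu.
have Pl : D (-1, t) - D (-1, t') = 0 by rewrite !(ss_Dl su) subrr.
have Pr : D (1, t) - D (1, t') = 0 by rewrite !(ss_Dr su)// subrr.
have := @entropy_step R S ph bS (ramp_itv rmp) (ramp_mono rmp) cph iph
  S1 l r p w _ _ _ _ _ _ _ _ _ xi xi1 (ramp_C11 rmp) l1 r1 p0 bw wp (bat t) (bat t') bbs
  (fun x => ss_itv su (x, t)) (fun x => ss_itv su (x, t')) (fun x => ss_itv sv (x, s))
  (ss_z su t) (ss_z sv s) (ss_phz su gt) (ss_phz sv gs) pP Pl Pr bPt PE pxi xi0 xiout.
apply: le_trans; rewrite le_eqVlt; apply/orP; left; apply/eqP.
have be u : bm (fun x => p * entropy S ph (a (x, u)) (b (x, s)) * xi x).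
  apply: bmM => //; apply: bmM; first exact: bm_cst.
  apply: entropy_bm => //; first exact: ramp_itv rmp.
    exact: (bat u).1.
  exact: bbs.1.
rewrite /e1 /kato_entropy /= -itvB//; apply: eq_Rintegral => x _; ring.
Qed.

(** Inequality in the variable [t] of [a], the time [s] of [b] being frozen.
    *)
Lemma half_kato th th1 th2 : test_weight T th th1 th2 ->
  - I2 T (fun q => e1 q * th1 q) <=
  - I2 T (fun q => th q * \int[leb]_(x in `[-1, 1]) (f (x, q.1) * G (q, x))).
Proof.
exact: (integrate_increments T0 be1 bG (ss_fbm su) (ss_fout su) (ss_good su) (ss_good sv) kato_step).
Qed.

End with_solutions.
End half_kato.

(** * Kato inequality in a subdomain *)

Lemma test_weight_swap (R : realType) (T : R) (th th1 th2 : R * R -> R) :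
  test_weight T th th1 th2 ->
  test_weight T (fun q => th (q.2, q.1)) (fun q => th2 (q.2, q.1)) (fun q => th1 (q.2, q.1)).
Proof.
case=> b b1 b2 h0 [d d0 supp] [C hC].
split; [exact: bm_swap_args|exact: bm_swap_args|exact: bm_swap_args|by move=> q|..].
- by exists d => // t s /= /supp[? ?].
- by exists C => t s h /=; have [? ?] := hC s t h.
Qed.

Section flip.
Context (R : realType).
Local Notation leb := (@lebesgue_measure R).

Lemma eq_bprim (F F' al al' : R -> R) : F =1 F' -> al =1 al' -> bprim F al -> bprim F' al'.
Proof. by move=> /funext -> /funext ->. Qed.

(** Exchanging the two phases replaces a saturation by its complement to 1 and
    reverses fluxes. The entropy inequality for the flipped second solution
    relative to the flipped first one is the missing half of the Kato
    inequality. *)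
Lemma side_sol_flip (T l r : R) (w ph : R -> R) (a f z D : R * R -> R) (good : R -> Prop) :
  side_sol T l r w ph a f z D good ->
  side_sol T l r w (fun y => ph 1 - ph (1 - y)) (fun p => 1 - a p) (fun p => - f p)
    (fun p => ph 1 - z p) (fun p => - D p) good.
Proof.
case=> ba a01 bf fout bz pz phz [a0 pD] Dl Dr DF ae_good.
split => //.
- by apply: bmB => //; exact: bm_cst.
- by move=> p; have /andP[? ?] := a01 p; apply/andP; split; lra.
- exact: bmN.
- by move=> x t /fout ->; rewrite oppr0.
- by apply: bmB => //; exact: bm_cst.
- move=> t; apply: eq_bprim (bprimB (bprim_cst (ph 1)) (pz t)) => // x.
  by ring.
- move=> t gt; apply: ae1 (phz t gt) _ => x h /h {}h /=.
  by rewrite subKr h.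
- exists (fun x => 1 - a0 x) => t; apply: eq_bprim (bprimN (pD t)) => // x.
  by ring.
- by move=> t; rewrite Dl oppr0.
- by move=> t gt; rewrite Dr// oppr0.
- move=> t gt; apply: ae1 (DF t gt) _ => x h /h ->.
  by rewrite /cumul/= itvN//; exact: bm_section1.
Qed.

End flip.

Section swap_products.
Context (R : realType) (T : R).

Lemma I2_swapM (F k : R * R -> R) : bm F -> bm k ->
  I2 T (fun q => F q * k (q.2, q.1)) = I2 T (fun q => F (q.2, q.1) * k q).
Proof.
move=> bF bk; rewrite I2_swap; last by apply: bmM => //; exact: bm_swap_args.
exact: I2_ext.
Qed.

Lemma I2_swapMl (k F : R * R -> R) : bm k -> bm F ->
  I2 T (fun q => k (q.2, q.1) * F q) = I2 T (fun q => k q * F (q.2, q.1)).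
Proof.
move=> bk bF; rewrite I2_swap; last by apply: bmM => //; exact: bm_swap_args.
exact: I2_ext.
Qed.

Lemma I2_near (F G : R * R -> R) (K : R) : 0 < T -> bm F -> bm G ->
  (forall t s, `|F (t, s) - G (t, s)| <= K) -> `|I2 T F - I2 T G| <= K * T * T.
Proof.
move=> T0 bF bG FG; rewrite -I2B//; apply: I2_bound => //; exact: bmB.
Qed.

Lemma bm_max0 d (X : measurableType d) (F : X -> R) : bm F -> bm (fun x => Order.max (F x) 0).
Proof. by move=> bF; apply: (bm_continuous_comp (@max_continuous R 0) bF). Qed.

Lemma Rintegral_indic (c d u v : R) (F : R -> R) : u <= c -> d <= v ->
  \int[@lebesgue_measure R]_(x in `[u, v]) (F x * \1_(`[c, d]%classic) x) =
  \int[@lebesgue_measure R]_(x in `[c, d]) F x.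
Proof.
move=> uc dv; transitivity (\int[@lebesgue_measure R]_(x in `[c, d]) (F x * \1_(`[c, d]%classic) x)).
  apply/esym/Rintegral_subset.
    by move=> x /=; rewrite !in_itv/= => /andP[? ?]; apply/andP; split; lra.
  by move=> x _ nx; rewrite indicE memNset// mulr0.
by apply: eq_Rintegral => x xc; rewrite indicE xc mulr1.
Qed.

Lemma near_sub (x1 x2 y1 y2 d eta : R) : `|x1 - y1| <= d -> `|x2 - y2| <= d -> d <= eta ->
  `|x1 - x2 - (y1 - y2)| <= 2 * eta.
Proof. by rewrite !ler_norml => /andP[? ?] /andP[? ?] ?; apply/andP; split; lra. Qed.

Lemma near_combine (x1 x2 y1 y2 u v d1 d2 d3 e : R) : `|x1 - y1| <= d1 -> `|x2 - y2| <= d2 ->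
  `|u - v| <= d3 -> d1 + d2 + d3 <= e -> - x1 - x2 <= - u -> - (y1 + y2) <= - v + e.
Proof.
rewrite !ler_norml => /andP[? ?] /andP[? ?] /andP[? ?] ? ?; lra.
Qed.

End swap_products.

Section kato_side.
Context (R : realType).
Local Notation leb := (@lebesgue_measure R).
Variables (T l r p : R) (w : R -> R).
Hypotheses (T0 : 0 < T) (l1 : -1 <= l) (lr : l <= r) (r1 : r <= 1) (p0 : 0 <= p).
Hypotheses (bw : bm w) (wp : forall x, l < x < r -> w x = p).
Variables (xi xi1 : R -> R).
Hypotheses (pxi : bprim xi xi1) (xi01 : forall x, 0 <= xi x <= 1)
  (xiout : forall x, -1 < x < 1 -> ~~ (l < x < r) -> xi x = 0).
Variables (ph : R -> R) (a f z D b g zb Db : R * R -> R) (gu gv : R -> Prop).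
Hypotheses (cph : continuous ph) (iph : {in `[0, 1] &, {homo ph : x y / x < y}}).
Hypotheses (su : side_sol T l r w ph a f z D gu) (sv : side_sol T l r w ph b g zb Db gv).
Variables (th th1 th2 : R * R -> R).
Hypothesis tw : test_weight T th th1 th2.

Let phf := fun y => ph 1 - ph (1 - y).

Let cphf : continuous phf.
Proof.
move=> y; apply: cvgB; first exact: cvg_cst.
apply: continuous_comp; last exact: cph.
by apply: cvgB; [exact: cvg_cst|exact: cvg_id].
Qed.

Let iphf : {in `[0, 1] &, {homo phf : x y / x < y}}.
Proof.
move=> x y; rewrite !in_itv/= => /andP[? ?] /andP[? ?] xy; rewrite /phf ltrD2l ltrN2.
by apply: iph; rewrite ?in_itv/=; try (apply/andP; split); lra.
Qed.

(** In the sum of the two halves the terms with [S1] form the square of [f -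
    g], with the good sign. *)
Lemma kato_sum (dl : R) (Sg S S1 : R -> R) : ramp dl Sg S S1 ->
  - I2 T (fun q => kato_entropy l r p S xi ph a b q * th1 q)
  - I2 T (fun q => kato_entropy l r p S xi phf (fun q => 1 - b q) (fun q => 1 - a q) (q.2, q.1) * th2 q) <=
  - I2 T (fun q => th q * \int[leb]_(x in `[-1, 1])
      ((f (x, q.1) - g (x, q.2)) * (S (z (x, q.1) - zb (x, q.2)) * xi1 x))).
Proof.
move=> rmp; have bf := ss_fbm su; have bg := ss_fbm sv; have bth := tw_bm tw.
have bz := ss_zbm su; have bzb := ss_zbm sv; have [bxi bxi1 _] := pxi.
have xi0 x : 0 <= xi x by have /andP[] := xi01 x.
have H1 := half_kato T0 l1 r1 p0 bw wp rmp pxi xi0 xiout cph iph su sv tw.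
have H2 := half_kato T0 l1 r1 p0 bw wp rmp pxi xi0 xiout cphf iphf
  (side_sol_flip sv) (side_sol_flip su) (test_weight_swap tw).
have bG : bm (kato_flux l r S S1 xi xi1 f z g zb) by exact: kato_flux_bm rmp _ _ pxi _ _ _ _ bf bz bg bzb.
have bpar (F : (R * R) * R -> R) : bm F -> bm (fun q => \int[leb]_(x in `[-1, 1]) F (q, x)).
  by move=> bF; apply: bm_param => //; exact: leb_itv_lty.
pose G := kato_flux l r S S1 xi xi1 f z g zb.
pose Gf := kato_flux l r S S1 xi xi1 (fun p => - g p) (fun p => ph 1 - zb p)
  (fun p => - f p) (fun p => ph 1 - z p).
have bGf : bm Gf.
  apply: (kato_flux_bm l r rmp pxi); [exact: bmN|apply: bmB => //; exact: bm_cst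
    |exact: bmN|apply: bmB => //; exact: bm_cst].
have GfE q x : Gf ((q.2, q.1), x) = S1 (z (x, q.1) - zb (x, q.2)) *
    (f (x, q.1) * \1_(`]l, r[%classic) x - g (x, q.2) * \1_(`]l, r[%classic) x) * xi x +
    S (z (x, q.1) - zb (x, q.2)) * xi1 x.
  rewrite /Gf /kato_flux /= (_ : ph 1 - zb (x, q.2) - (ph 1 - z (x, q.1)) =
    z (x, q.1) - zb (x, q.2)); last by ring.
  by ring.
have bfG : bm (fun q : (R * R) * R => f (q.2, q.1.1) * G q) by apply: bmM => //; exact: bm_xt.
have sw (F : (R * R) * R -> R) : bm F -> bm (fun q : (R * R) * R => F ((q.1.2, q.1.1), q.2)).
  move=> bF; apply: (bm_comp (h := fun q : (R * R) * R => ((q.1.2, q.1.1), q.2)) _ bF).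
  apply: measurable_fun_pair => //; apply: measurable_fun_pair.
    exact: (measurableT_comp measurable_snd measurable_fst).
  exact: (measurableT_comp measurable_fst measurable_fst).
have bgG : bm (fun q : (R * R) * R => (- g (q.2, q.1.1)) * Gf q).
  by apply: bmM => //; apply: bmN; exact: bm_xt.
have bS : continuous S by exact: C11_continuous (ramp_C11 rmp).
have bC : bm (fun q : (R * R) * R => (f (q.2, q.1.1) - g (q.2, q.1.2)) *
    (S (z (q.2, q.1.1) - zb (q.2, q.1.2)) * xi1 q.2)).
  apply: bmM; first by apply: bmB; [exact: bm_xt|exact: bm_xs].
  apply: bmM; last exact: bm_x.
  by apply: bm_continuous_comp => //; apply: bmB; [exact: bm_xt|exact: bm_xs].
have bA := bpar _ bfG; have bB := bpar _ bgG; have bB' := bpar _ (sw _ bgG).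
have bCC := bpar _ bC.
have bE2 : bm (kato_entropy l r p S xi phf (fun q => 1 - b q) (fun q => 1 - a q)).
  apply: (kato_entropy_bm _ _ _ rmp pxi cphf); apply: bmB; do ?exact: bm_cst.
    exact: ss_bm sv.
  exact: ss_bm su.
rewrite (I2_swapM T bE2 (tw_bm2 tw)) in H2.
rewrite (I2_swapMl T (F := fun q => \int[leb]_(x in `[-1, 1]) (- g (x, q.1) * Gf (q, x))) bth bB) in H2.
apply: (le_trans (lerD H1 H2)).
rewrite -opprD lerN2 -I2D; [|exact: bmM|by apply: bmM => //; exact: bB'].
apply: I2_le => //.
- exact: bmM.
- by apply: bmD; apply: bmM => //; exact: bB'.
move=> t s tJ sJ /=; rewrite -mulrDr ler_wpM2l ?(tw_ge0 tw)//.
rewrite -itvD; [|exact: (bm_section1 (t, s) bfG)|exact: (bm_section1 (t, s) (sw _ bgG))].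
apply: itv_le; [exact: (bm_section1 (t, s) bC)|apply: bmD;
  [exact: (bm_section1 (t, s) bfG)|exact: (bm_section1 (t, s) (sw _ bgG))]|].
move=> x _ /=; rewrite (GfE (t, s)) /= /G /kato_flux /=.
(* the difference of the two sides is S1 (f - g)^2 xi on the subdomain *)
rewrite -subr_ge0.
have := ramp_deriv_ge0 rmp (z (x, t) - zb (x, s)).
set s1 := S1 _; set s0 := S _; set ft := f _; set gs := g _ => s10.
rewrite (_ : _ - _ = s1 * (ft - gs) ^+ 2 * \1_(`]l, r[%classic) x * xi x); last by ring.
have /andP[x0 _] := xi01 x.
by rewrite mulr_ge0// mulr_ge0// mulr_ge0// sqr_ge0.
Qed.

Definition kato_limit (q : R * R) : R :=
  \int[leb]_(x in `]l, r[) (p * Order.max (a (x, q.1) - b (x, q.2)) 0 * xi x).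

Lemma kato_limit_bm : bm kato_limit.
Proof.
have [bxi _ _] := pxi.
apply: (@bm_param R _ _ (fun q : (R * R) * R =>
   p * Order.max (a (q.2, q.1.1) - b (q.2, q.1.2)) 0 * xi q.2)) => //.
  exact: leb_itv_lty.
apply: bmM; last exact: bm_x.
apply: bmM; first exact: bm_cst.
by apply: bm_max0; apply: bmB; [exact: bm_xt (ss_bm su)|exact: bm_xs (ss_bm sv)].
Qed.

(** Both entropies are approximations of the same positive part: the flip
    exchanges the arguments and their signs. *)
Lemma kato_entropy_near (dl eta : R) (Sg S S1 : R -> R) : ramp dl Sg S S1 -> 0 <= eta ->
  (forall r k, 0 <= r <= 1 -> 0 <= k <= 1 -> ph r - ph k <= dl -> r - k <= eta) ->
  forall t s, `|kato_entropy l r p S xi ph a b (t, s) - kato_limit (t, s)| <= p * eta * (r - l) /\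
  `|kato_entropy l r p S xi phf (fun q => 1 - b q) (fun q => 1 - a q) (s, t) - kato_limit (t, s)|
     <= p * eta * (r - l).
Proof.
move=> rmp eta0 mo t s; have [bxi _ _] := pxi.
have ba : bm (fun x => a (x, t)) by exact: bm_section2 (ss_bm su).
have bb : bm (fun x => b (x, s)) by exact: bm_section2 (ss_bm sv).
have bS : continuous S by exact: C11_continuous (ramp_C11 rmp).
have bK : bm (fun x => p * Order.max (a (x, t) - b (x, s)) 0 * xi x).
  apply: bmM => //; apply: bmM; first exact: bm_cst.
  by apply: bm_max0; exact: bmB.
have close (ps : R -> R) (al be : R -> R) : continuous ps ->
    bm al -> bm be -> (forall x, 0 <= al x <= 1) -> (forall x, 0 <= be x <= 1) ->
    {in `[0, 1] &, {homo ps : x y / x < y}} ->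
    (forall r k, 0 <= r <= 1 -> 0 <= k <= 1 -> ps r - ps k <= dl -> r - k <= eta) ->
    (forall x, al x - be x = a (x, t) - b (x, s)) ->
    `|\int[leb]_(x in `]l, r[) (p * entropy S ps (al x) (be x) * xi x) - kato_limit (t, s)|
      <= p * eta * (r - l).
  move=> cps bal bbe al01 be01 ips mps E.
  have bent : bm (fun x => p * entropy S ps (al x) (be x) * xi x).
    apply: bmM => //; apply: bmM; first exact: bm_cst.
    by apply: entropy_bm => //; [exact: ramp_itv rmp|exact: bal.1|exact: bbe.1].
  rewrite -itvB// (Rintegral_itv_closed false true); last exact: bmB.
  apply: Rintegral_itv_bound => //; first exact: bmB.
  move=> x _; rewrite -mulrBl -mulrBr normrM normrM (ger0_norm p0) -E.
  have /andP[x0 x1] := xi01 x; rewrite (ger0_norm x0) -[leRHS]mulr1.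
  rewrite ler_pM// ?mulr_ge0// ler_wpM2l//.
  apply: (entropy_approx bS (ramp_itv rmp) (ramp_left rmp) cps ips
    eta0 (ramp_right rmp) mps) => //.
have a01 x : 0 <= a (x, t) <= 1 by exact: ss_itv su _.
have b01 x : 0 <= b (x, s) <= 1 by exact: ss_itv sv _.
split.
  exact: close.
apply: (close phf (fun x => 1 - b (x, s)) (fun x => 1 - a (x, t))) => //.
- by apply: bmB => //; exact: bm_cst.
- by apply: bmB => //; exact: bm_cst.
- by move=> x; have /andP[? ?] := b01 x; apply/andP; split; lra.
- by move=> x; have /andP[? ?] := a01 x; apply/andP; split; lra.
- move=> r' k /andP[? ?] /andP[? ?] h.
  have := mo (1 - k) (1 - r'); rewrite /phf in h; move=> {}mo.
  have : 1 - k - (1 - r') <= eta by apply: mo; try (apply/andP; split); lra.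
  by lra.
- by move=> x; ring.
Qed.

(** On a subinterval of the subdomain [f - g] is the derivative of [z - zb].
    *)
Lemma flux_average (dl : R) (Sg S S1 : R -> R) (c ep : R) (t s : R) : ramp dl Sg S S1 ->
  0 <= ep -> l <= c -> c + ep <= r ->
  \int[leb]_(x in `[c, c + ep]) ((f (x, t) - g (x, s)) * S (z (x, t) - zb (x, s))) =
  Sg (z (c + ep, t) - zb (c + ep, s)) - Sg (z (c, t) - zb (c, s)).
Proof.
move=> rmp ep0 lc cr.
have pW := bprim_comp (ramp_prim rmp) (bprimB (ss_z su t) (ss_z sv s)).
have [_ bW ->] := pW; last by rewrite lerDl.
have bS : continuous S by exact: C11_continuous (ramp_C11 rmp).
have bft : bm (fun x => f (x, t)) by exact: bm_section2 (ss_fbm su).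
have bgs : bm (fun x => g (x, s)) by exact: bm_section2 (ss_fbm sv).
have b1 : bm (fun x => (f (x, t) - g (x, s)) * S (z (x, t) - zb (x, s))).
  apply: bmM; first exact: bmB.
  apply: bm_continuous_comp => //; apply: bmB.
    exact: bm_section2 (ss_zbm su).
  exact: bm_section2 (ss_zbm sv).
rewrite -(Rintegral_itv_closed false true _ _ b1) -(Rintegral_itv_closed false true _ _ bW).
apply: eq_Rintegral => x; rewrite inE/= in_itv/= => /andP[? ?].
by rewrite indicE mem_set/= ?in_itv/= ?mulr1 1?mulrC//; apply/andP; split; lra.
Qed.

(** The regularisation is removed. The cutoff is affine, with slope [sgn /
    ep], on [[c, c + ep]] and constant elsewhere, so the flux term only sees
    the ends of this interval. *)
Lemma kato_side (c ep sgn : R) : 0 < ep -> l <= c -> c + ep <= r -> `|sgn| <= 1 ->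
  xi1 = (fun x => sgn * ep^-1 * \1_(`[c, c + ep]%classic) x) ->
  - I2 T (fun q => kato_limit q * (th1 q + th2 q)) <=
  - I2 T (fun q => th q * (sgn * ep^-1 *
      (Order.max (z (c + ep, q.1) - zb (c + ep, q.2)) 0 - Order.max (z (c, q.1) - zb (c, q.2)) 0))).
Proof.
move=> ep0 lc cr sgn1 xi1E; apply/ler_addgt0Pr => e e0.
have bth := tw_bm tw; have bth1 := tw_bm1 tw; have bth2 := tw_bm2 tw.
have bK := kato_limit_bm.
have [_ [M0 hM0]] := bth; have [_ [M1 hM1]] := bth1; have [_ [M2 hM2]] := bth2.
have M00 : 0 <= M0 by exact: le_trans (hM0 (0, 0)).
have M10 : 0 <= M1 by exact: le_trans (hM1 (0, 0)).
have M20 : 0 <= M2 by exact: le_trans (hM2 (0, 0)).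
(* [Q] bounds all error terms per unit of [eta]; 1 is added for positivity *)
pose Q := (p * (r - l) * (M1 + M2) + M0 * ep^-1 * 2) * T * T + 1.
have epi : 0 <= ep^-1 by rewrite invr_ge0 ltW.
have rl : 0 <= r - l by rewrite subr_ge0.
have T1 := ltW T0.
have Q0 : 0 < Q.
  by rewrite /Q ltr_pwDr// !mulr_ge0// addr_ge0// !mulr_ge0// addr_ge0.
have eta0 : 0 < e / Q by rewrite divr_gt0.
set eta := e / Q in eta0.
have [dl' dl0' mo'] := increasing_modulus cph iph eta0.
pose dl := Order.min dl' eta.
have dl0 : 0 < dl by rewrite lt_min dl0' eta0.
have dleta : dl <= eta by rewrite ge_min lexx orbT.
have mo r' k : 0 <= r' <= 1 -> 0 <= k <= 1 -> ph r' - ph k <= dl -> r' - k <= eta.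
  by move=> h1 h2 h3; apply: mo' => //; apply: (le_trans h3); rewrite ge_min lexx.
have [Sg [S [S1 rmp]]] := ramp_exists dl0.
have near := kato_entropy_near rmp (ltW eta0) mo.
have H := kato_sum rmp.
have bE1 : bm (kato_entropy l r p S xi ph a b).
  exact: (kato_entropy_bm _ _ _ rmp pxi cph (ss_bm su) (ss_bm sv)).
have bE2 : bm (kato_entropy l r p S xi phf (fun q => 1 - b q) (fun q => 1 - a q)).
  apply: (kato_entropy_bm _ _ _ rmp pxi cphf); apply: bmB; do ?exact: bm_cst.
    exact: ss_bm sv.
  exact: ss_bm su.
have bE2' := bm_swap_args bE2.
have bS : continuous S by exact: C11_continuous (ramp_C11 rmp).
have [_ bxi1 _] := pxi.
have bF : bm (fun q : (R * R) * R => (f (q.2, q.1.1) - g (q.2, q.1.2)) *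
    (S (z (q.2, q.1.1) - zb (q.2, q.1.2)) * xi1 q.2)).
  apply: bmM; first by apply: bmB; [exact: bm_xt (ss_fbm su)|exact: bm_xs (ss_fbm sv)].
  apply: bmM; last exact: bm_x.
  by apply: bm_continuous_comp => //; apply: bmB; [exact: bm_xt (ss_zbm su)|exact: bm_xs (ss_zbm sv)].
have bF' : bm (fun q : R * R => \int[leb]_(x in `[-1, 1])
    ((f (x, q.1) - g (x, q.2)) * (S (z (x, q.1) - zb (x, q.2)) * xi1 x))).
  by apply: (bm_param _ _ bF) => //; exact: leb_itv_lty.
have bsec (y : R) : bm (fun q : R * R => z (y, q.1) - zb (y, q.2)).
  apply: bmB.
    apply: (bm_comp (h := fun q : R * R => (y, q.1)) _ (ss_zbm su)).
    by apply: measurable_fun_pair => //; exact: measurable_cst.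
  apply: (bm_comp (h := fun q : R * R => (y, q.2)) _ (ss_zbm sv)).
  by apply: measurable_fun_pair => //; exact: measurable_cst.
have bA : bm (fun q : R * R => sgn * ep^-1 *
   (Order.max (z (c + ep, q.1) - zb (c + ep, q.2)) 0 - Order.max (z (c, q.1) - zb (c, q.2)) 0)).
  by apply: bmM; [exact: bm_cst|apply: bmB; apply: bm_max0; exact: bsec].
rewrite (_ : I2 T _ = I2 T (fun q => kato_limit q * th1 q) + I2 T (fun q => kato_limit q * th2 q));
  last first.
  by rewrite -I2D; [apply: I2_ext => t s _ _; rewrite mulrDr|exact: bmM|exact: bmM].
apply: (near_combine (d1 := p * eta * (r - l) * M1 * T * T) (d2 := p * eta * (r - l) * M2 * T * T)
   (d3 := M0 * (ep^-1 * (2 * eta)) * T * T) _ _ _ _ H).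
- apply: I2_near => //; [exact: bmM|exact: bmM|move=> t s].
  rewrite -mulrBl normrM; apply: ler_pM; [exact: normr_ge0|exact: normr_ge0| |exact: hM1].
  exact: (near t s).1.
- apply: I2_near => //; [exact: bmM|exact: bmM|move=> t s].
  rewrite -mulrBl normrM; apply: ler_pM; [exact: normr_ge0|exact: normr_ge0| |exact: hM2].
  exact: (near t s).2.
- apply: I2_near => //; [exact: bmM|exact: bmM|move=> t s].
  rewrite -mulrBr normrM ler_pM//=.
  rewrite (_ : \int[leb]_(x in _) _ = sgn * ep^-1 *
    (Sg (z (c + ep, t) - zb (c + ep, s)) - Sg (z (c, t) - zb (c, s)))); last first.
    rewrite -(flux_average _ _ rmp (ltW ep0) lc cr) xi1E.
    rewrite -(Rintegral_indic _ (le_trans l1 lc) (le_trans cr r1)).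
    rewrite -itvZl; last first.
      apply: bmM; last exact: bm_indic.
      apply: bmM; first by apply: bmB; [exact: bm_section2 (ss_fbm su)|exact: bm_section2 (ss_fbm sv)].
      apply: bm_continuous_comp => //.
      by apply: bmB; [exact: bm_section2 (ss_zbm su)|exact: bm_section2 (ss_zbm sv)].
    by apply: eq_Rintegral => x _; ring.
  rewrite -mulrBr normrM normrM (ger0_norm epi) -[leRHS]mul1r -mulrA ler_pM// ?mulr_ge0//.
  rewrite ler_wpM2l//.
  exact: near_sub (ramp_dist rmp _) (ramp_dist rmp _) dleta.
rewrite (_ : _ + _ = eta * (Q - 1)); last by rewrite /Q; ring.
rewrite mulrBr mulr1 /eta divfK ?gt_eqF// lerBlDr lerDl.
exact: ltW.
Qed.

End kato_side.

(** * Kato inequality across the interface *)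

Section weak_convergence.
Context (R : realType).
Local Notation leb := (@lebesgue_measure R).

Lemma bprim_shift (h : R) (F al : R -> R) : bprim F al ->
  bprim (fun t => F (t + h)) (fun t => al (t + h)).
Proof.
case=> bF bal H; split.
- by apply: bm_comp bF; exact: measurable_addr.
- by apply: bm_comp bal; exact: measurable_addr.
move=> x y xy; rewrite H ?lerD2r//.
rewrite -(Rintegral_translate h _ (leb_itv_lty true false _ _) bal)//.
congr (Rintegral _ _ _); apply/seteqP; split => t /=; rewrite !in_itv/= !lerD2r//.
Qed.

Lemma bprimZ (k : R) (F al : R -> R) : bprim F al ->
  bprim (fun t => k * F t) (fun t => k * al t).
Proof.
move=> pF; apply: eq_bprim (bprimM (bprim_cst k) pF) => // t.
by rewrite mul0r add0r.
Qed.

Lemma itv_vanish (x y : R) (X : R -> R) : (forall t, x <= t <= y -> X t = 0) ->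
  \int[leb]_(t in `[x, y]) X t = 0.
Proof.
move=> X0; rewrite (eq_Rintegral _ _ (g := fun=> 0)) ?Rintegral_cst ?mul0r//.
by move=> t; rewrite inE/= in_itv/= => /X0.
Qed.

Definition backward_average (X : R -> R) (n : nat) (t : R) : R :=
  n.+1%:R * \int[leb]_(s in `[t - n.+1%:R^-1, t]) X s.

Lemma backward_average_bprim (n : nat) (X : R -> R) (c e : R) : bm X ->
  (forall t, t < c \/ e < t -> X t = 0) ->
  bprim (backward_average X n) (fun t => n.+1%:R * (X t - X (t - n.+1%:R^-1))).
Proof.
move=> bX Xout; have pxi := bprim_indefinite bX Xout.
apply: eq_bprim (bprimZ n.+1%:R (bprimB pxi (bprim_shift (- n.+1%:R^-1) pxi))) => // t.
by have [_ _ ->//] := pxi; rewrite gerBl invr_ge0.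
Qed.

(** Convergence at Lebesgue points, then dominated convergence. *)
Lemma backward_average_L1 (a b : R) (X : R -> R) (c e : R) : bm X ->
  (forall t, t < c \/ e < t -> X t = 0) ->
  \int[leb]_(t in `]a, b[) `|backward_average X n t - X t| @[n --> \oo] --> (0 : R).
Proof.
move=> bX Xout; have [_ [M XM]] := bX.
apply: (@bounded_cvg_L1 _ _ _ leb `]a, b[%classic _ _ _ _ M) => //.
- exact: leb_itv_lty.
- by move=> n; have [[? _] _ _] := backward_average_bprim n bX Xout.
- move=> n t _; rewrite normrM ger0_norm// mulrC -ler_pdivlMr ?ltr0n//.
  have h := @Rintegral_itv_bound R (t - n.+1%:R^-1) t M X bX.
  by rewrite opprB addrCA subrr addr0 in h; apply: h => //; rewrite gerBl invr_ge0.
- apply: ae1 (bm_lebesgue_pt bX) _ => t lt _.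
  exact: cvg_backward_average.
Qed.

(** Weak convergence to 0 of bounded functions with small primitives: replace
    [X] by a Lipschitz average, uniformly close in L^1, and integrate by
    parts. *)
Lemma small_primitive (T d K : R) (X : R -> R) : 0 < T -> 0 < d -> bm X ->
  (forall t, X t != 0 -> d <= t <= T - d) ->
  forall e : R, 0 < e -> exists2 dl : R, 0 < dl & forall Q P : R -> R, bprim Q P ->
    (forall t, `|P t| <= K) -> {ae leb, forall t, t \in `]0, T[ -> `|Q t| <= dl} ->
    `|\int[leb]_(t in `]0, T[) (X t * P t)| <= e.
Proof.
move=> T0 d0 bX supp e e0; have T1 := ltW T0.
have [K0|K0] := ltP K 0.
  exists 1 => // Q P _ /(_ 0) PK; have := le_trans PK (ltW K0).
  by rewrite normr_le0 => /eqP P0; have := PK; rewrite P0 normr0 leNgt K0.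
have out t : ~ (d <= t <= T - d) -> X t = 0.
  by move=> nt; apply/eqP; apply: contra_notT nt; exact: supp.
have Xout t : t < 0 \/ T < t -> X t = 0.
  by move=> h; apply: out => /andP[? ?]; case: h => ?; lra.
have pXn n := backward_average_bprim n bX Xout.
have XnE n t : backward_average X n t = n.+1%:R * \int[leb]_(s in `[t - n.+1%:R^-1, t]) X s by [].
have L1 := backward_average_L1 0 T bX Xout.
have [_ [M XM]] := bX.
have M0 : 0 <= M by exact: le_trans (XM 0).
pose Xn n := backward_average X n.
pose Xn' n t := n.+1%:R * (X t - X (t - n.+1%:R^-1)).
have har0 : n.+1%:R^-1 @[n --> \oo] --> (0 : R) by exact: cvg_harmonic.
have [n [nd nL]] : exists n : nat, (n.+1%:R^-1 : R) < d /\
    K * \int[leb]_(t in `]0, T[) `|Xn n t - X t| <= e / 2.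
  near \oo => n; exists n; split.
    near: n; move/cvgrPdist_lt : har0 => /(_ d d0); apply: filterS => n.
    by rewrite sub0r normrN ger0_norm.
  near: n.
  have : K * \int[leb]_(t in `]0, T[) `|Xn n t - X t| @[n --> \oo] --> K * (0 : R) by exact: cvgMr.
  rewrite mulr0 => /cvgrPdist_le/(_ (e / 2)).
  rewrite divr_gt0// => /(_ isT); apply: filterS => n.
  by rewrite sub0r normrN => /(le_trans (ler_norm _)).
have aux1 (h t : R) : T - h <= t -> t <= T - d -> d <= h by lra.
pose C := n.+1%:R * (M + M) * T + 1.
have C0 : 0 < C by rewrite /C ltr_pwDr// !mulr_ge0// addr_ge0.
exists (e / 2 / C); first by rewrite !divr_gt0.
move=> Q P pQ PK Qdl; have [bQ bP _] := pQ; have [bXn bXn' _] := pXn n.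
have h0 : 0 <= n.+1%:R^-1 :> R by rewrite invr_ge0.
have E : \int[leb]_(t in `]0, T[) (Xn n t * P t) = - \int[leb]_(t in `]0, T[) (Xn' n t * Q t).
  rewrite !(Rintegral_itv_closed false true)//; [|exact: bmM|exact: bmM].
  rewrite (bprim_parts T1 (pXn n) pQ) ?opprK//.
    by rewrite XnE itv_vanish ?mulr0// => t /andP[? ?]; apply: out => /andP[? ?]; lra.
  rewrite XnE itv_vanish ?mulr0// => t /andP[h1 _]; apply: out => /andP[_ h2].
  by have := lt_le_trans nd (aux1 _ _ h1 h2); rewrite ltxx.
have -> : \int[leb]_(t in `]0, T[) (X t * P t) =
    (- \int[leb]_(t in `]0, T[) (Xn' n t * Q t)) - \int[leb]_(t in `]0, T[) ((Xn n t - X t) * P t).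
  rewrite -E -itvB; [|exact: bmM|by apply: bmM => //; exact: bmB].
  by apply: eq_Rintegral => t _; ring.
have b1 : `|\int[leb]_(t in `]0, T[) ((Xn n t - X t) * P t)| <= e / 2.
  apply: le_trans nL; apply: le_trans (itv_norm _ _ _ _ _) _; first by apply: bmM => //; exact: bmB.
  rewrite -itvZl; last by apply: bm_norm; exact: bmB.
  apply: itv_le.
  - by apply: bm_norm; apply: bmM => //; exact: bmB.
  - by apply: bmM; [exact: bm_cst|apply: bm_norm; exact: bmB].
  - by move=> t _; rewrite normrM mulrC ler_wpM2r.
have b2 : `|\int[leb]_(t in `]0, T[) (Xn' n t * Q t)| <= e / 2.
  have bXQ : bm (fun t => Xn' n t * Q t) by exact: bmM.
  apply: (le_trans (itv_norm _ _ _ _ bXQ)).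
  apply: (@le_trans _ _ (\int[leb]_(t in `]0, T[) (n.+1%:R * (M + M) * (e / 2 / C)))).
    apply: itv_ae_le; [exact: bm_norm|exact: bm_cst|].
    apply: ae1 Qdl _ => t h tJ; rewrite normrM ler_pM//; last exact: h.
    rewrite normrM ger0_norm// ler_wpM2l// (le_trans (ler_normB _ _))// lerD//.
  rewrite Rintegral_cst// fine_leb_itv// subr0.
  rewrite (_ : _ * _ * T = (e / 2 / C) * (C - 1)); last first.
    by rewrite (_ : C - 1 = n.+1%:R * (M + M) * T); [ring|rewrite /C addrK].
  rewrite -[leRHS](divfK (lt0r_neq0 C0)) ler_wpM2l ?gerBl// ltW// divr_gt0// divr_gt0//.
apply: (le_trans (ler_normB _ _)); rewrite normrN [e]splitr.
exact: lerD.
Unshelve. all: end_near. Qed.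

End weak_convergence.

Section interface_flux.
Context (R : realType).
Local Notation leb := (@lebesgue_measure R).
Variables (T : R).
Hypothesis T0 : 0 < T.

Lemma bprim_param (f : R * R -> R) (c d : R) : bm f ->
  (forall x t, t < 0 \/ T < t -> f (x, t) = 0) ->
  bprim (fun t => \int[leb]_(x in `[c, d]) cumul f (x, t))
        (fun t => \int[leb]_(x in `[c, d]) f (x, t)).
Proof.
move=> bf fout; have bcu := cumul_bm bf fout.
split.
- apply: (bm_param (F := fun q => cumul f (q.2, q.1))) => //; first exact: leb_itv_lty.
  exact: bm_swap_args bcu.
- apply: (bm_param (F := fun q => f (q.2, q.1))) => //; first exact: leb_itv_lty.
  exact: bm_swap_args bf.
move=> x y xy; rewrite -itvB; [|exact: bm_section2 bcu|exact: bm_section2 bcu].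
rewrite -(bm_swap (measurable_itv _) (leb_itv_lty _ _ _ _) (measurable_itv _) (leb_itv_lty _ _ _ _) bf).
by apply: eq_Rintegral => u _; have [_ _ ->] := cumul_bprim bf fout u.
Qed.

Variables (l r : R) (w ph : R -> R) (a f z D : R * R -> R) (good : R -> Prop).
Hypotheses (bw : bm w) (su : side_sol T l r w ph a f z D good).

(** Uniform in time, as saturations take values in the unit interval. *)
Lemma ss_lipschitz : exists2 L : R, 0 <= L &
  forall t x y, x <= y -> `|D (y, t) - D (x, t)| <= L * (y - x).
Proof.
have [a0 pD] := ss_D su; have [_ [M wM]] := bw; have [_ b0 _] := pD 0; have [_ [N bN]] := b0.
have M0 : 0 <= M by exact: le_trans (wM 0).
have N0 : 0 <= N by exact: le_trans (bN 0).
exists (M + N); first exact: addr_ge0.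
move=> t x y xy; have [_ bt ->//] := pD t; apply: Rintegral_itv_bound => // v _.
rewrite (_ : w v * _ = w v * (a (v, t) - a (v, 0)) + w v * (a (v, 0) - a0 v)); last by ring.
rewrite (le_trans (ler_normD _ _))// lerD// normrM -[leRHS]mulr1 ler_pM//.
have /andP[? ?] := ss_itv su (v, t); have /andP[? ?] := ss_itv su (v, 0).
by rewrite ler_norml; apply/andP; split; lra.
Qed.

Definition flux_jump (ep t : R) : R :=
  ep^-1 * (\int[leb]_(x in `[0, ep]) f (x, t) - \int[leb]_(x in `[- ep, 0]) f (x, t)).

Lemma flux_jump_bprim ep : bprim (fun t => ep^-1 *
  (\int[leb]_(x in `[0, ep]) cumul f (x, t) - \int[leb]_(x in `[- ep, 0]) cumul f (x, t)))
  (flux_jump ep).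
Proof.
have bf := ss_fbm su; have fout := ss_fout su.
by apply: bprimZ; apply: bprimB; exact: bprim_param.
Qed.

Lemma flux_jump_bound : exists2 K : R, 0 <= K & forall ep t, 0 < ep -> `|flux_jump ep t| <= K.
Proof.
have [_ [K fK]] := ss_fbm su; have K0 : 0 <= K by exact: le_trans (fK (0, 0)).
exists (K + K); first exact: addr_ge0.
move=> ep t ep0; have bft := bm_section2 t (ss_fbm su).
have epi : 0 <= ep^-1 by rewrite invr_ge0 ltW.
rewrite /flux_jump normrM ger0_norm// -ler_pdivlMl ?invr_gt0// invrK.
rewrite (le_trans (ler_normB _ _))// mulrDr lerD//.
  have := @Rintegral_itv_bound R 0 ep K _ bft (ltW ep0) (fun x _ => fK (x, t)).
  by rewrite subr0 mulrC.
have := @Rintegral_itv_bound R (- ep) 0 K _ bft _ (fun x _ => fK (x, t)).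
by rewrite oppr_le0 sub0r opprK mulrC => /(_ (ltW ep0)).
Qed.

(** At good times the accumulated flux is [D], which is Lipschitz in space:
    its means on the two sides of the interface differ from its value there by
    the size of the layer. *)
Lemma flux_jump_primitive_small : exists2 L : R, 0 <= L & forall ep t, 0 < ep -> ep <= 1 -> good t ->
  `|ep^-1 * (\int[leb]_(x in `[0, ep]) cumul f (x, t) - \int[leb]_(x in `[- ep, 0]) cumul f (x, t))|
    <= L * ep.
Proof.
have [L L0 lipD] := ss_lipschitz; exists (L + L); first exact: addr_ge0.
move=> ep t ep0 ep1 gt; have bcu := bm_section2 t (cumul_bm (ss_fbm su) (ss_fout su)).
have [a0 /(_ t) [bD _ _]] := ss_D su.
have epi : 0 <= ep^-1 by rewrite invr_ge0 ltW.
rewrite normrM ger0_norm// -ler_pdivlMl ?invr_gt0// invrK.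
have side c d : -1 <= c -> d <= 1 -> c <= d -> d - c = ep -> (c = 0 \/ d = 0) ->
    `|\int[leb]_(x in `[c, d]) cumul f (x, t) - D (0, t) * ep| <= L * ep * ep.
  move=> c1 d1 cd dc c0.
  rewrite (itv_ae_eq (g := fun x => D (x, t)) bcu bD); last first.
    apply: ae1 (ss_DF su gt) _ => x h /=; rewrite in_itv/= => /andP[? ?].
    by rewrite h//; apply/andP; split; lra.
  rewrite (_ : D (0, t) * ep = \int[leb]_(x in `[c, d]) D (0, t)); last first.
    by rewrite Rintegral_cst// fine_leb_itv// dc.
  rewrite -itvB//; last exact: bm_cst.
  rewrite -{2}dc; apply: Rintegral_itv_bound => //; first by apply: bmB => //; exact: bm_cst.
  move=> x /andP[cx xd]; have [x0|/ltW x0] := leP 0 x.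
    by rewrite (le_trans (lipD _ _ _ x0))// ler_wpM2l//; case: c0 => ?; lra.
  by rewrite distrC (le_trans (lipD _ _ _ x0))// ler_wpM2l//; case: c0 => ?; lra.
have h1 : `|\int[leb]_(x in `[0, ep]) cumul f (x, t) - D (0, t) * ep| <= L * ep * ep.
  by apply: side; try lra; left.
have h2 : `|\int[leb]_(x in `[- ep, 0]) cumul f (x, t) - D (0, t) * ep| <= L * ep * ep.
  by apply: side; try lra; right.
rewrite (_ : ep * ((L + L) * ep) = L * ep * ep + L * ep * ep); last by ring.
move: h1 h2; set y1 := Rintegral _ _ _; set y2 := Rintegral _ _ _; set y3 := _ * ep.
set y4 := L * ep * ep; clearbody y1 y2 y3 y4.
by rewrite !ler_norml => /andP[? ?] /andP[? ?]; apply/andP; split; lra.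
Qed.

Lemma flux_jump_null (d : R) (chi : R * R -> R) : 0 < d -> bm chi ->
  (forall t s, chi (t, s) != 0 -> d <= t <= T - d) ->
  forall e : R, 0 < e -> exists2 ep0 : R, 0 < ep0 & forall ep, 0 < ep -> ep < ep0 ->
    `|I2 T (fun q => chi q * flux_jump ep q.1)| <= e.
Proof.
move=> d0 bchi supp e e0; have [K K0 fK] := flux_jump_bound.
have [L L0 pL] := flux_jump_primitive_small.
pose X t := \int[leb]_(s in `]0, T[) chi (t, s).
have bX : bm X by apply: (bm_param _ _ bchi) => //; exact: leb_itv_lty.
have suppX t : X t != 0 -> d <= t <= T - d.
  move=> Xt; apply: contrapT => nt; move/negP : Xt; apply; apply/eqP.
  rewrite /X (eq_Rintegral _ _ (g := fun=> 0)) ?Rintegral_cst ?mul0r// => s _.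
  by apply/eqP; apply: contra_notT nt; exact: supp.
have [dl dl0 small] := @small_primitive R T d K X T0 d0 bX suppX e e0.
exists (Order.min 1 (dl / (L + 1))); first by rewrite lt_min ltr01 divr_gt0// ltr_wpDl.
move=> ep ep0; rewrite lt_min => /andP[ep1 epdl].
have pj := flux_jump_bprim ep; have [_ bj _] := pj.
rewrite (_ : I2 T _ = \int[leb]_(t in `]0, T[) (X t * flux_jump ep t)); last first.
  by apply: eq_Rintegral => t _ /=; rewrite itvZr//; exact: bm_section1 bchi.
apply: small pj (fK ep ^~ ep0) _.
apply: ae1 (ss_good su) _ => t h /h gt; rewrite (le_trans (pL _ _ ep0 (ltW ep1) gt))//.
move: epdl; rewrite ltr_pdivlMr ?ltr_wpDl// => /ltW; apply: le_trans.
by rewrite mulrC ler_wpM2l ?lerDl// ltW.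
Qed.

End interface_flux.

Section cutoff.
Context (R : realType).
Local Notation leb := (@lebesgue_measure R).

Lemma cutoff_exists (c ep : R) : 0 < ep -> exists h : R -> R,
  [/\ bprim h (fun x => ep^-1 * \1_(`[c, c + ep]%classic) x), forall x, 0 <= h x <= 1,
      forall x, x <= c -> h x = 0 & forall x, c + ep <= x -> h x = 1].
Proof.
move=> ep0; pose k x := ep^-1 * \1_(`[c, c + ep]%classic) x : R.
have epi : 0 <= ep^-1 by rewrite invr_ge0 ltW.
have bk : bm k by apply: bmM; [exact: bm_cst|exact: bm_indic].
have k0 x : 0 <= k x by rewrite mulr_ge0.
have kout x : x < c \/ c + ep < x -> k x = 0.
  by move=> h; rewrite /k indicE memNset ?mulr0//= in_itv/= => /andP[? ?]; case: h => ?; lra.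
pose h x := \int[leb]_(y in `[c, x]) k y.
have ph : bprim h k by exact: bprim_indefinite kout.
have [bh _ hE] := ph.
have hc : h c = 0.
  have := @Rintegral_itv_bound R c c ep^-1 k bk (lexx c).
  rewrite subrr mulr0 normr_le0 => H; apply/eqP/H => x _.
  by rewrite ger0_norm// /k indicE ler_piMr// lern1 leq_b1.
have left x : x <= c -> h x = 0.
  rewrite le_eqVlt => /predU1P[->//|xc].
  have := hE _ _ (ltW xc); rewrite hc sub0r => /eqP; rewrite eqr_oppLR => /eqP ->.
  rewrite -(Rintegral_itv_closed false true _ _ bk) (eq_Rintegral _ _ (g := fun=> 0)) ?Rintegral_cst ?mul0r ?oppr0//.
  by move=> y; rewrite inE/= in_itv/= => /andP[_ yc]; apply: kout; left.
have hce : h (c + ep) = 1.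
  rewrite /h (eq_Rintegral _ _ (g := fun=> ep^-1)); last first.
    by move=> y yc; rewrite /k indicE yc mulr1.
  by rewrite Rintegral_cst// fine_leb_itv ?lerDl 1?ltW// addrC addKr mulVf// gt_eqF.
have right x : c + ep <= x -> h x = 1.
  rewrite le_eqVlt => /predU1P[<-//|xc].
  have := hE _ _ (ltW xc); rewrite hce => /eqP; rewrite subr_eq => /eqP ->.
  rewrite -(Rintegral_itv_closed false true _ _ bk) (eq_Rintegral _ _ (g := fun=> 0)) ?Rintegral_cst ?mul0r ?add0r//.
  by move=> y; rewrite inE/= in_itv/= => /andP[yc _]; apply: kout; right.
have mono x y : x <= y -> h x <= h y.
  by move=> xy; rewrite -subr_ge0 hE//; apply: Rintegral_ge0.
exists h; split => // x; have [xc|/ltW cx] := leP x c; first by rewrite left// lexx ler01.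
rewrite -hc mono//=; have [xc|/ltW xc] := leP x (c + ep); first by rewrite -hce mono.
by rewrite right.
Qed.

(** The cutoff differs from 1 on an interval of length [ep] only. *)
Lemma cutoff_defect (l r p c ep : R) (w F xi : R -> R) : l <= r -> 0 <= p -> 0 <= ep ->
  l <= c -> c + ep <= r -> bm w -> (forall x, l < x < r -> w x = p) ->
  bm F -> (forall x, 0 <= F x <= 1) -> bm xi -> (forall x, 0 <= xi x <= 1) ->
  (forall x, l < x < r -> ~~ (c <= x <= c + ep) -> xi x = 1) ->
  `|\int[leb]_(x in `]l, r[) (w x * F x) - \int[leb]_(x in `]l, r[) (p * F x * xi x)| <= p * ep.
Proof.
move=> lr p0 ep0 lc cr bw wp bF F01 bxi xi01 xi1.
have b1 : bm (fun x => w x * F x) by exact: bmM.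
have b2 : bm (fun x => p * F x * xi x).
  by apply: bmM => //; apply: bmM => //; exact: bm_cst.
have b3 : bm (fun x => p * \1_(`[c, c + ep]%classic) x).
  by apply: bmM; [exact: bm_cst|exact: bm_indic].
rewrite -itvB//; apply: (le_trans (itv_norm _ _ _ _ (bmB b1 b2))).
apply: (@le_trans _ _ (\int[leb]_(x in `]l, r[) (p * \1_(`[c, c + ep]%classic) x))); last first.
  rewrite (Rintegral_itv_closed false true _ _ b3) Rintegral_indic//.
  by rewrite Rintegral_cst// fine_leb_itv ?lerDl// addrC addKr.
apply: itv_le => //; first by apply: bm_norm; exact: bmB.
move=> x /=; rewrite in_itv/= => lxr; rewrite wp//.
have /andP[? ?] := F01 x; have /andP[? ?] := xi01 x.
have [xc|xc] := boolP (c <= x <= c + ep); last first.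
  by rewrite (xi1 _ lxr xc) mulr1 subrr normr0 mulr_ge0.
rewrite indicE mem_set ?in_itv//= mulr1.
rewrite -[X in `|X - _|]mulr1 -mulrBr -mulrA normrM (ger0_norm p0) ler_piMr//.
rewrite normrM ger0_norm// mulr_ile1//.
by rewrite ger0_norm ?subr_ge0// lerBlDr lerDl.
Qed.

End cutoff.

Section kato_global.
Context (R : realType).
Local Notation leb := (@lebesgue_measure R).
Variables (T p0 p1 : R) (w : R -> R).
Hypotheses (T0 : 0 < T) (p00 : 0 <= p0) (p10 : 0 <= p1).
Hypotheses (bw : bm w) (wp0 : forall x, -1 < x < 0 -> w x = p0)
  (wp1 : forall x, 0 < x < 1 -> w x = p1).
Variables (ph0 ph1 : R -> R) (a f z0 z1 D b g zb0 zb1 Db : R * R -> R) (gu gv : R -> Prop).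
Hypotheses (cph0 : continuous ph0) (iph0 : {in `[0, 1] &, {homo ph0 : x y / x < y}}).
Hypotheses (cph1 : continuous ph1) (iph1 : {in `[0, 1] &, {homo ph1 : x y / x < y}}).
Hypotheses (su0 : side_sol T (-1) 0 w ph0 a f z0 D gu) (sv0 : side_sol T (-1) 0 w ph0 b g zb0 Db gv).
Hypotheses (su1 : side_sol T 0 1 w ph1 a f z1 D gu) (sv1 : side_sol T 0 1 w ph1 b g zb1 Db gv).
Hypothesis compat : forall t s, gu t -> gv s ->
  (0 < z0 (0, t) - zb0 (0, s) -> 0 <= z1 (0, t) - zb1 (0, s)) /\
  (0 < z1 (0, t) - zb1 (0, s) -> 0 <= z0 (0, t) - zb0 (0, s)).
Variables (th th1 th2 : R * R -> R).
Hypothesis tw : test_weight T th th1 th2.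

Definition excess (q : R * R) : R :=
  \int[leb]_(x in `]-1, 1[) (w x * Order.max (a (x, q.1) - b (x, q.2)) 0).

Let bmax t s : bm (fun x => Order.max (a (x, t) - b (x, s)) 0).
Proof.
by apply: bm_max0; apply: bmB; [exact: bm_section2 (ss_bm su0)|exact: bm_section2 (ss_bm sv0)].
Qed.

Lemma excess_bm : bm excess.
Proof.
apply: (@bm_param R _ _ (fun q : (R * R) * R =>
   w q.2 * Order.max (a (q.2, q.1.1) - b (q.2, q.1.2)) 0)) => //.
  exact: leb_itv_lty.
apply: bmM; first exact: bm_x.
by apply: bm_max0; apply: bmB; [exact: bm_xt (ss_bm su0)|exact: bm_xs (ss_bm sv0)].
Qed.

Lemma excess_split (c ep : R) (xi0 xi1 : R -> R) t s : 0 <= ep -> ep <= 1 ->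
  bm xi0 -> bm xi1 -> (forall x, 0 <= xi0 x <= 1) -> (forall x, 0 <= xi1 x <= 1) ->
  (forall x, x <= - ep -> xi0 x = 1) -> (forall x, ep <= x -> xi1 x = 1) ->
  `|excess (t, s) - (kato_limit (-1) 0 p0 xi0 a b (t, s) + kato_limit 0 1 p1 xi1 a b (t, s))|
    <= (p0 + p1) * ep.
Proof.
move=> ep0 ep1 bxi0 bxi1 xi001 xi101 xi0E xi1E.
have bF : bm (fun x => w x * Order.max (a (x, t) - b (x, s)) 0) by exact: bmM.
have h0 : (-1 : R) <= 0 by lra.
have max01 x : 0 <= Order.max (a (x, t) - b (x, s)) 0 <= 1.
  have /andP[? ?] := ss_itv su0 (x, t); have /andP[? ?] := ss_itv sv0 (x, s).
  by rewrite le_max lexx orbT ge_max ler01 andbT/=; lra.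
rewrite /excess /= (Rintegral_itv_closed false true _ _ bF).
rewrite (Rintegral_itv_cat bF h0 ler01).
rewrite -(Rintegral_itv_closed false true (-1) 0 bF) -(Rintegral_itv_closed false true 0 1 bF).
rewrite opprD addrACA (le_trans (ler_normD _ _))// mulrDl lerD//.
  apply: (@cutoff_defect _ (-1) 0 p0 (- ep) ep) => //; try lra.
  by move=> x /andP[? ?]; rewrite negb_and -!ltNge => /orP[?|?]; apply: xi0E; lra.
apply: (@cutoff_defect _ 0 1 p1 0 ep) => //; try lra.
by move=> x /andP[? ?]; rewrite negb_and -!ltNge => /orP[?|?]; apply: xi1E; lra.
Qed.

Let z_increment (l r : R) (ph : R -> R) (al fl z Dl : R * R -> R) (good : R -> Prop) (c d t : R) :
  side_sol T l r w ph al fl z Dl good -> l <= c -> c <= d -> d <= r ->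
  z (d, t) - z (c, t) = \int[leb]_(x in `[c, d]) fl (x, t).
Proof.
move=> ss lc cd dr; have [_ bW ->//] := ss_z ss t.
have bf : bm (fun x => fl (x, t)) by exact: bm_section2 (ss_fbm ss).
rewrite -(Rintegral_itv_closed false true _ _ bW) -(Rintegral_itv_closed false true _ _ bf).
apply: eq_Rintegral => x; rewrite inE/= in_itv/= => /andP[? ?].
by rewrite indicE mem_set/= ?in_itv/= ?mulr1//; apply/andP; split; lra.
Qed.

Let scaled_combine (x k0 k1 a0 a1 u d : R) : `|x - (k0 + k1)| <= d -> - k0 <= - a0 -> - k1 <= - a1 ->
  u <= a0 + a1 -> - x <= - u + d.
Proof. by rewrite ler_norml => /andP[? ?] ? ? ?; lra. Qed.

Let global_combine (x u v d e : R) : `|u| <= e / 3 -> `|v| <= e / 3 -> d <= e / 3 ->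
  - x <= - (u - v) + d -> 0 <= x + e.
Proof. by rewrite !ler_norml => /andP[? ?] /andP[? ?] ? ?; lra. Qed.

(** [w0] and [w1] are the values of [z - zb] on the two sides of the
    interface, [wm] and [wp] its values at the outer ends of the two layers.
    The Boolean [s] says whether one of the first two is positive; then both
    are nonnegative and equal to their positive parts. *)
Let interface_sign (s : bool) (wm w0 w1 wp : R) :
  (0 < w0 -> 0 <= w1) -> (0 < w1 -> 0 <= w0) -> s = (0 < w0) || (0 < w1) ->
  s%:R * ((wp - w1) - (w0 - wm)) <=
  - (Order.max w0 0 - Order.max wm 0) + (Order.max wp 0 - Order.max w1 0).
Proof.
move=> h01 h10 ->.
have hm : Order.max wm 0 >= wm by rewrite le_max lexx.
have hm' : Order.max wm 0 >= 0 by rewrite le_max lexx orbT.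
have hp : Order.max wp 0 >= wp by rewrite le_max lexx.
have hp' : Order.max wp 0 >= 0 by rewrite le_max lexx orbT.
have [pos|neg] := boolP ((0 < w0) || (0 < w1)); rewrite ?mul1r ?mul0r.
  have w0p : 0 <= w0 by case/orP : pos => [/ltW//|/h10].
  have w1p : 0 <= w1 by case/orP : pos => [/h01//|/ltW].
  by rewrite (max_l w0p) (max_l w1p); lra.
by move: neg; rewrite negb_or -!leNgt => /andP[n0 n1]; rewrite (max_r n0) (max_r n1); lra.
Qed.

Definition interface_open (q : R * R) : bool :=
  (0 < z0 (0, q.1) - zb0 (0, q.2)) || (0 < z1 (0, q.1) - zb1 (0, q.2)).

Let bsec (z zb : R * R -> R) (y : R) : bm z -> bm zb -> bm (fun q : R * R => z (y, q.1) - zb (y, q.2)).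
Proof.
move=> bz bzb; apply: bmB.
  apply: (bm_comp (h := fun q : R * R => (y, q.1)) _ bz).
  by apply: measurable_fun_pair => //; exact: measurable_cst.
apply: (bm_comp (h := fun q : R * R => (y, q.2)) _ bzb).
by apply: measurable_fun_pair => //; exact: measurable_cst.
Qed.

Let bopen : bm (fun q => (interface_open q)%:R : R).
Proof.
split; last by exists 1 => q; case: interface_open; rewrite ?normr1 ?normr0.
have mpos (F : R * R -> R) : bm F -> measurable_fun setT (fun q => 0 < F q).
  by move=> [mF _]; apply: measurable_fun_ltr => //; exact: measurable_cst.
apply: (measurableT_comp (f := fun c : bool => c%:R : R)) => //.
apply: measurable_or; apply: mpos; apply: bsec.
- exact: ss_zbm su0.
- exact: ss_zbm sv0.
- exact: ss_zbm su1.
- exact: ss_zbm sv1.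
Qed.

(** [interface_sign], with the differences of [z - zb] across the layers
    rewritten as mean fluxes. *)
Lemma interface_flux_le (ep t s : R) : 0 < ep -> ep <= 1 -> gu t -> gv s ->
  th (t, s) * (interface_open (t, s))%:R * flux_jump f ep t -
  th (t, s) * (interface_open (t, s))%:R * flux_jump g ep s <=
  th (t, s) * (-1 * ep^-1 * (Order.max (z0 (0, t) - zb0 (0, s)) 0 -
     Order.max (z0 (- ep, t) - zb0 (- ep, s)) 0)) +
  th (t, s) * (1 * ep^-1 * (Order.max (z1 (ep, t) - zb1 (ep, s)) 0 -
     Order.max (z1 (0, t) - zb1 (0, s)) 0)).
Proof.
move=> ep0 ep1 gt gs; have [c01 c10] := compat gt gs.
have epi : 0 <= ep^-1 by rewrite invr_ge0 ltW.
have i1 : ep <= 1 by []. have i2 : (0 : R) <= ep by exact: ltW.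
have i3 : -1 <= - ep by lra. have i4 : - ep <= 0 by lra.
rewrite /flux_jump -(z_increment t su1 (lexx 0) i2 i1) -(z_increment s sv1 (lexx 0) i2 i1).
rewrite -(z_increment t su0 i3 i4 (lexx 0)) -(z_increment s sv0 i3 i4 (lexx 0)).
have := @interface_sign (interface_open (t, s)) (z0 (- ep, t) - zb0 (- ep, s)) _ _
  (z1 (ep, t) - zb1 (ep, s)) c01 c10 erefl.
have tho := tw_ge0 tw (t, s).
set k := _%:R; set m1 := Order.max _ _; set m2 := Order.max _ _; set m3 := Order.max _ _.
set m4 := Order.max _ _ => H.
rewrite -subr_ge0 (_ : _ - _ = th (t, s) * (ep^-1 * (- (m1 - m2) + (m3 - m4) -
  k * (z1 (ep, t) - zb1 (ep, s) - (z1 (0, t) - zb1 (0, s)) -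
     (z0 (0, t) - zb0 (0, s) - (z0 (- ep, t) - zb0 (- ep, s)))))));
  last by ring.
by rewrite mulr_ge0// mulr_ge0// subr_ge0.
Qed.

(** The two subdomains are added for a fixed width [ep] of the layers. *)
Lemma kato_scaled (ep M1 M2 : R) : 0 < ep -> ep <= 1 ->
  (forall q, `|th1 q| <= M1) -> (forall q, `|th2 q| <= M2) ->
  - I2 T (fun q => excess q * (th1 q + th2 q)) <=
  - (I2 T (fun q => th q * (interface_open q)%:R * flux_jump f ep q.1) -
     I2 T (fun q => th (q.2, q.1) * (interface_open (q.2, q.1))%:R * flux_jump g ep q.1)) +
  (p0 + p1) * ep * (M1 + M2) * T * T.
Proof.
move=> ep0 ep1 hM1 hM2.
have bth := tw_bm tw; have bth1 := tw_bm1 tw; have bth2 := tw_bm2 tw.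
have bth12 : bm (fun q => th1 q + th2 q) by exact: bmD.
have epm1 : -1 <= - ep by rewrite lerN2.
have [h0 [ph0' h001 h0l h0r]] := cutoff_exists (- ep) ep0.
have [h1 [ph1' h101 h1l h1r]] := cutoff_exists 0 ep0.
rewrite addNr in h0r; rewrite add0r in h1r.
have px0 : bprim (fun x => 1 - h0 x) (fun x => -1 * ep^-1 * \1_(`[- ep, - ep + ep]%classic) x).
  by apply: eq_bprim (bprimB (bprim_cst 1) ph0') => // x; ring.
have px1 : bprim h1 (fun x => 1 * ep^-1 * \1_(`[0, 0 + ep]%classic) x).
  by apply: eq_bprim ph1' => // x; ring.
have x001 x : 0 <= 1 - h0 x <= 1.
  by have /andP[u1 u2] := h001 x; rewrite subr_ge0 u2 gerBl u1.
have m10 : (-1 : R) <= 0 by rewrite lerN10.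
have x0out x : -1 < x < 1 -> ~~ (-1 < x < 0) -> 1 - h0 x = 0.
  by move=> /andP[x1 _]; rewrite x1/= -leNgt => /h0r ->; rewrite subrr.
have x1out x : -1 < x < 1 -> ~~ (0 < x < 1) -> h1 x = 0.
  by move=> /andP[_ x1]; rewrite x1 andbT -leNgt => /h1l.
have n1 : `|(-1 : R)| <= 1 by rewrite normrN1.
have n1' : `|(1 : R)| <= 1 by rewrite normr1.
have ce0 : - ep + ep <= 0 by rewrite addNr.
have ce1 : 0 + ep <= 1 by rewrite add0r.
have H0 := kato_side T0 (lexx (-1)) m10 ler01 p00 bw wp0 px0 x001 x0out cph0 iph0 su0 sv0 tw
  ep0 epm1 ce0 n1 erefl.
have H1 := kato_side T0 m10 ler01 (lexx 1) p10 bw wp1 px1 h101 x1out cph1 iph1 su1 sv1 tw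
  ep0 (lexx 0) ce1 n1' erefl.
rewrite addNr in H0; rewrite add0r in H1.
have bK0 := kato_limit_bm p0 px0 su0 sv0; have bK1 := kato_limit_bm p1 px1 su1 sv1.
have bA (z zb : R * R -> R) (k x y : R) : bm z -> bm zb -> bm (fun q : R * R => th q * (k * ep^-1 *
   (Order.max (z (x, q.1) - zb (x, q.2)) 0 - Order.max (z (y, q.1) - zb (y, q.2)) 0))).
  move=> bz bzb; apply: bmM => //; apply: bmM; first exact: bm_cst.
  by apply: bmB; apply: bm_max0; exact: bsec.
have bA0 := bA _ _ (-1) 0 (- ep) (ss_zbm su0) (ss_zbm sv0).
have bA1 := bA _ _ 1 ep 0 (ss_zbm su1) (ss_zbm sv1).
have bchi : bm (fun q => th q * (interface_open q)%:R) by exact: bmM.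
have [_ bju _] := flux_jump_bprim su0 ep; have [_ bjv _] := flux_jump_bprim sv0 ep.
have bju1 : bm (fun q : R * R => th q * (interface_open q)%:R * flux_jump f ep q.1).
  by apply: bmM => //; apply: (bm_comp (h := fst) _ bju); exact: measurable_fst.
have bjv2 : bm (fun q : R * R => th q * (interface_open q)%:R * flux_jump g ep q.2).
  by apply: bmM => //; apply: (bm_comp (h := snd) _ bjv); exact: measurable_snd.
have Z : `|I2 T (fun q => excess q * (th1 q + th2 q)) -
    I2 T (fun q => (kato_limit (-1) 0 p0 (fun x => 1 - h0 x) a b q + kato_limit 0 1 p1 h1 a b q) *
       (th1 q + th2 q))| <= (p0 + p1) * ep * (M1 + M2) * T * T.
  apply: I2_near => //; [by apply: bmM => //; exact: excess_bm|by apply: bmM => //; exact: bmD|].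
  move=> t s; rewrite -mulrBl normrM; apply: ler_pM; [exact: normr_ge0|exact: normr_ge0| |].
    have [bx0 _ _] := px0; have [bx1 _ _] := px1.
    apply: excess_split => //; first exact: ltW.
    by move=> x /h0l ->; rewrite subr0.
  by rewrite (le_trans (ler_normD _ _))// lerD.
have E : I2 T (fun q => (kato_limit (-1) 0 p0 (fun x => 1 - h0 x) a b q + kato_limit 0 1 p1 h1 a b q) *
       (th1 q + th2 q)) =
   I2 T (fun q => kato_limit (-1) 0 p0 (fun x => 1 - h0 x) a b q * (th1 q + th2 q)) +
   I2 T (fun q => kato_limit 0 1 p1 h1 a b q * (th1 q + th2 q)).
  rewrite -I2D; [|exact: bmM|exact: bmM].
  by apply: I2_ext => t s _ _; rewrite mulrDl.
have F : I2 T (fun q => th q * (interface_open q)%:R * flux_jump f ep q.1) -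
     I2 T (fun q => th (q.2, q.1) * (interface_open (q.2, q.1))%:R * flux_jump g ep q.1) <=
   I2 T (fun q => th q * (-1 * ep^-1 * (Order.max (z0 (0, q.1) - zb0 (0, q.2)) 0 -
     Order.max (z0 (- ep, q.1) - zb0 (- ep, q.2)) 0))) +
   I2 T (fun q => th q * (1 * ep^-1 * (Order.max (z1 (ep, q.1) - zb1 (ep, q.2)) 0 -
     Order.max (z1 (0, q.1) - zb1 (0, q.2)) 0))).
  rewrite -(I2_swap T bjv2) -I2B// -I2D//.
  apply: (I2_ae_le (bmB bju1 bjv2) (bmD bA0 bA1) (ss_good su0) (ss_good sv0)).
  by move=> t s _ _ gt gs; exact: interface_flux_le.
rewrite E in Z.
exact: scaled_combine Z H0 H1 F.
Qed.

(** The flux jumps disappear when the layers shrink, because they are tested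
    against weights independent of [ep]. *)
Lemma kato_global : 0 <= I2 T (fun q => excess q * (th1 q + th2 q)).
Proof.
apply/ler_addgt0Pr => e e0.
have bth := tw_bm tw; have bth1 := tw_bm1 tw; have bth2 := tw_bm2 tw.
have [d d0 supp] := tw_supp tw.
have [_ [M1 hM1]] := bth1; have [_ [M2 hM2]] := bth2.
have M10 : 0 <= M1 by exact: le_trans (hM1 (0, 0)).
have M20 : 0 <= M2 by exact: le_trans (hM2 (0, 0)).
pose chi q := th q * (interface_open q)%:R.
have bchi : bm chi by exact: bmM.
have suppu t s : chi (t, s) != 0 -> d <= t <= T - d.
  by move=> h; have [] := supp t s (contra_neq _ h) => //; rewrite /chi => ->; rewrite mul0r.
have suppv t s : chi (s, t) != 0 -> d <= t <= T - d.
  by move=> h; have [] := supp s t (contra_neq _ h) => //; rewrite /chi => ->; rewrite mul0r.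
have e3 : 0 < e / 3 by rewrite divr_gt0.
have [eu eu0 Hu] := flux_jump_null T0 bw su0 d0 bchi suppu e3.
have [ev ev0 Hv] := flux_jump_null T0 bw sv0 d0 (bm_swap_args bchi) suppv e3.
pose Q := (p0 + p1) * (M1 + M2) * T * T + 1.
have T1 := ltW T0.
have Q0 : 0 < Q by rewrite /Q ltr_pwDr// !mulr_ge0// addr_ge0.
(* half of the smallest threshold, as the thresholds must be strictly exceeded *)
pose ep := Order.min 1 (Order.min (e / 3 / Q) (Order.min eu ev)) / 2.
have m0 : 0 < Order.min 1 (Order.min (e / 3 / Q) (Order.min eu ev)).
  by rewrite !lt_min ltr01 eu0 ev0 !andbT/= divr_gt0.
have ep0 : 0 < ep by rewrite divr_gt0.
have : ep < Order.min 1 (Order.min (e / 3 / Q) (Order.min eu ev)).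
  by rewrite /ep ltr_pdivrMr// ltr_pMr// ltr1n.
rewrite !lt_min => /andP[ep1 /andP[epQ /andP[epu epv]]].
have {}Hu := Hu _ ep0 epu; have {}Hv := Hv _ ep0 epv.
have := kato_scaled ep0 (ltW ep1) hM1 hM2.
apply: global_combine Hu Hv _.
rewrite (_ : _ * T * T = ep * (Q - 1)); last by rewrite /Q; ring.
move: epQ; rewrite ltr_pdivlMr// => /ltW; apply: le_trans.
by rewrite ler_wpM2l ?gerBl// ltW.
Qed.

End kato_global.

(** * Strong continuity at the initial time *)

Section initial_side.
Context (R : realType).
Local Notation leb := (@lebesgue_measure R).
Variables (T l r p : R) (w ph : R -> R) (a f z D : R * R -> R) (good : R -> Prop) (a0 : R -> R).
Hypotheses (T0 : 0 < T) (l1 : -1 <= l) (lr : l <= r) (r1 : r <= 1) (p0 : 0 <= p).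
Hypotheses (bw : bm w) (wp : forall x, l < x < r -> w x = p).
Hypotheses (cph : continuous ph) (iph : {in `[0, 1] &, {homo ph : x y / x < y}}).
Hypotheses (su : side_sol T l r w ph a f z D good).
Hypotheses (ba0 : bm a0) (a001 : forall x, 0 <= a0 x <= 1)
  (pD : forall t, bprim (fun x => D (x, t)) (fun x => w x * (a (x, t) - a0 x))).

Lemma cumul_small : exists2 K : R, 0 <= K & forall x t, 0 <= t -> `|cumul f (x, t)| <= K * t.
Proof.
have [_ [K fK]] := ss_fbm su; exists K; first exact: le_trans (fK (0, 0)).
move=> x t t0; rewrite /cumul /= -[X in _ * X]subr0.
by apply: Rintegral_itv_bound => //; exact: bm_section1 (ss_fbm su).
Qed.

(** The variation of the stored mass is the accumulated flux, which is at most
    a constant times the time. *)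
Lemma increment_small : exists2 K : R, 0 <= K & forall (X X' : R -> R) (C t : R),
  bprim X X' -> (forall x, `|X' x| <= C) -> good t -> 0 <= t ->
  `|\int[leb]_(x in `[-1, 1]) (w x * (a (x, t) - a0 x) * X x)| <= C * K * t.
Proof.
have [K K0 cK] := cumul_small; exists (2 * K); first exact: mulr_ge0.
move=> X X' C t pX XC gt t0; have [bD bd _] := pD t; have [bX bX' _] := pX.
have m11 : (-1 : R) <= 1 by lra.
rewrite (bprim_parts m11 (pD t) pX (ss_Dl su t) (ss_Dr su gt)) normrN.
have bcu := bm_section2 t (cumul_bm (ss_fbm su) (ss_fout su)).
rewrite (itv_ae_eq (g := fun x => cumul f (x, t) * X' x)); [|exact: bmM|exact: bmM|]; last first.
  by apply: ae1 (ss_DF su gt) _ => x h /=; rewrite in_itv/= => /h ->.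
rewrite (_ : C * (2 * K) * t = K * t * C * (1 - -1)); last by ring.
apply: Rintegral_itv_bound => //; first exact: bmM.
by move=> x _; rewrite normrM ler_pM// cK.
Qed.

(** The saturation [q] at a later time is compared with the initial one [k],
    whose transform is known only through an approximation [y]. *)
Let entropy_pairing (dl eta L : R) (Sg S S1 : R -> R) (q k y : R) : ramp dl Sg S S1 ->
  (forall u v, `|S v - S u| <= L * `|v - u|) -> 0 <= eta -> 0 <= L ->
  (forall r k, 0 <= r <= 1 -> 0 <= k <= 1 -> ph r - ph k <= dl -> r - k <= eta) ->
  0 <= q <= 1 -> 0 <= k <= 1 ->
  Order.max (q - k) 0 <= (q - k) * S (ph q - y) + eta + L * `|ph k - y|.
Proof.
move=> rmp lipS eta0 L0 mo q01 k01.
have /andP[q0 q1] := q01; have /andP[k0 k1] := k01.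
have lipS' := lipS (ph q - ph k) (ph q - y).
rewrite (_ : ph q - y - (ph q - ph k) = ph k - y) in lipS'; last by ring.
have Ly : 0 <= L * `|ph k - y| by rewrite mulr_ge0.
have S01 := ramp_itv rmp (ph q - ph k).
have [qk|kq] := leP q k.
  rewrite max_r ?subr_le0//.
  have S0 : S (ph q - ph k) = 0.
    apply: (ramp_left rmp); rewrite subr_le0.
    by move: qk; rewrite le_eqVlt => /predU1P[->//|qk]; apply/ltW/iph; rewrite ?in_itv.
  rewrite S0 subr0 in lipS'.
  have : `|(q - k) * S (ph q - y)| <= L * `|ph k - y|.
    rewrite normrM -[leRHS]mul1r ler_pM// ler_norml; apply/andP; split; lra.
  by rewrite ler_norml => /andP[+ _]; move: (_ * S _) (L * _) => ? ? ?; lra.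
have qk0 : 0 <= q - k by rewrite subr_ge0 ltW.
rewrite max_l//.
have h1 : (q - k) * S (ph q - ph k) <= (q - k) * S (ph q - y) + L * `|ph k - y|.
  rewrite -lerBlDl -mulrBr.
  have h : `|(q - k) * (S (ph q - ph k) - S (ph q - y))| <= L * `|ph k - y|.
    rewrite normrM -[leRHS]mul1r ler_pM//; last by rewrite distrC.
    by rewrite ler_norml; apply/andP; split; lra.
  exact: le_trans (ler_norm _) h.
have h2 : q - k <= (q - k) * S (ph q - ph k) + eta.
  have [big|small] := leP dl (ph q - ph k).
    by rewrite (ramp_right rmp big) mulr1 lerDl.
  by rewrite (le_trans (mo _ _ q01 k01 (ltW small)))// lerDr mulr_ge0//; case/andP: S01.
by move: h1 h2; move: (_ * S _) (_ * S _) (L * _) => ? ? ? ? ?; lra.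
Qed.

Variables (xi xi1 : R -> R).
Hypotheses (pxi : bprim xi xi1) (xi01 : forall x, 0 <= xi x <= 1)
  (xiout : forall x, -1 < x < 1 -> ~~ (l < x < r) -> xi x = 0).

(** The initial datum is merely bounded, so [S (z - ph a0)] is not an
    admissible test function. The transform of the initial datum is replaced
    by an average in space, close to it in L^1; the resulting test function is
    Lipschitz, with a constant independent of time. *)
Lemma initial_side_cut (e : R) : 0 < e -> exists2 dl : R, 0 < dl & forall t, good t -> 0 <= t < dl ->
  \int[leb]_(x in `]l, r[) (p * Order.max (a (x, t) - a0 x) 0 * xi x) <= e.
Proof.
move=> e0.
pose eta := e / (3 * (p * (r - l) + 1)).
have Q0 : 0 < p * (r - l) + 1 by rewrite ltr_wpDl// mulr_ge0// subr_ge0.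
have eta0 : 0 < eta by rewrite divr_gt0// mulr_gt0.
have [dl dl0 mo] := increasing_modulus cph iph eta0.
have [Sg [S [S1 rmp]]] := ramp_exists dl0.
have [L0' _ lipS] := ramp_prim rmp.
have [L L0 {}lipS] : exists2 L : R, 0 <= L & forall u v, `|S v - S u| <= L * `|v - u|.
  exists L0' => //; have := lipS 0 1; rewrite subr0 normr1 mulr1; exact: le_trans.
have bpa0 : bm (fun x => ph (a0 x)) by exact: bm_continuous_comp.
pose B := (fun x => ph (a0 x)) \_ `[-1, 1].
have bB : bm B by apply: bm_restrict => //; exact: measurable_itv.
have Bout x : x < -1 \/ 1 < x -> B x = 0.
  move=> h; rewrite /B patchE memNset//= in_itv/= => /andP[? ?]; case: h => ?; lra.
have [n nB] : exists n, p * L * \int[leb]_(x in `]-1, 1[) `|backward_average B n x - B x| <= e / 3.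
  have : p * L * \int[leb]_(x in `]-1, 1[) `|backward_average B n x - B x| @[n --> \oo] -->
      p * L * (0 : R) by apply: cvgMr; exact: backward_average_L1 Bout.
  rewrite mulr0 => /cvgrPdist_le/(_ (e / 3)); rewrite divr_gt0// => /(_ isT) [N _ /(_ N (leqnn N))].
  by rewrite sub0r normrN => h; exists N; exact: le_trans (ler_norm _) h.
have pzk := backward_average_bprim n bB Bout.
set zk := backward_average B n in nB pzk; set zk' := (fun t : R => _) in pzk.
have [bzk bzk' _] := pzk; have [bxi bxi1 _] := pxi.
have cS : continuous S := C11_continuous (ramp_C11 rmp).
have cS1 : continuous S1 := C11_continuous' (ramp_C11 rmp).
have b1 (h : R -> R) : bm h -> bm (fun q : R * R => h q.1).
  by move=> bh; apply: (bm_comp (h := fst) _ bh); exact: measurable_fst.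
have [_ [C XC]] : bm (fun q : R * R => S1 (z q - zk q.1) *
    (f q * \1_(`]l, r[%classic) q.1 - zk' q.1) * xi q.1 + S (z q - zk q.1) * xi1 q.1).
  have bd : bm (fun q : R * R => z q - zk q.1) by apply: bmB; [exact: ss_zbm su|exact: b1].
  have bi : bm (fun q : R * R => \1_(`]l, r[%classic) q.1 : R).
    by apply: b1; exact: bm_indic.
  apply: bmD; apply: bmM; [|exact: b1|exact: bm_continuous_comp|exact: b1].
  apply: bmM; first exact: bm_continuous_comp.
  by apply: bmB; [apply: bmM => //; exact: ss_fbm su|exact: b1].
have [K K0 HK] := increment_small.
have C0 : 0 <= C by exact: le_trans (XC (0, 0)).
have CK1 : 0 < C * K + 1 by rewrite ltr_wpDl// mulr_ge0.
exists (e / 3 / (C * K + 1)); first by rewrite !divr_gt0.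
move=> t gt /andP[t0 tdl].
have bat := bm_section2 t (ss_bm su).
have bzt := bm_section2 t (ss_zbm su).
have pX := bprimM (bprim_comp (ramp_C11 rmp) (bprimB (ss_z su t) pzk)) pxi.
have {HK} := HK _ _ C t pX (fun x => XC (x, t)) gt t0.
have [bX _ _] := pX.
have bda : bm (fun x => a (x, t) - a0 x) by exact: bmB.
have bpa : bm (fun x => ph (a (x, t))) by exact: bm_continuous_comp.
have bS : bm (fun x => S (ph (a (x, t)) - zk x)) by apply: bm_continuous_comp => //; exact: bmB.
have bPS : bm (fun x => p * ((a (x, t) - a0 x) * S (ph (a (x, t)) - zk x)) * xi x).
  by apply: bmM => //; apply: bmM; [exact: bm_cst|exact: bmM].
have bwX : bm (fun x => w x * (a (x, t) - a0 x) * (S (z (x, t) - zk x) * xi x)).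
  by apply: bmM => //; exact: bmM.
have -> : \int[leb]_(x in `[-1, 1]) (w x * (a (x, t) - a0 x) * (S (z (x, t) - zk x) * xi x)) =
    \int[leb]_(x in `]l, r[) (p * ((a (x, t) - a0 x) * S (ph (a (x, t)) - zk x)) * xi x).
  rewrite -(Rintegral_itv_closed false true _ _ bwX).
  rewrite -(@Rintegral_subset _ `]l, r[%classic `]-1, 1[%classic).
  - apply: itv_ae_eq => //; apply: ae1 (ss_phz su gt) _ => x h /=; rewrite in_itv/= => lxr.
    by rewrite wp// h//; ring.
  - by move=> x /=; rewrite !in_itv/= => /andP[u1 u2]; rewrite (le_lt_trans l1 u1) (lt_le_trans u2 r1).
  - move=> x /=; rewrite !in_itv/= => x11 /negP xlr.
    by rewrite (xiout x11 xlr) !mulr0.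
move=> H.
have bdz : bm (fun x => `|ph (a0 x) - zk x|) by apply: bm_norm; exact: bmB.
have bdz' : bm (fun x => p * eta + p * L * `|ph (a0 x) - zk x|).
  by apply: bmD; [exact: bm_cst|apply: bmM => //; exact: bm_cst].
have bmx : bm (fun x => p * Order.max (a (x, t) - a0 x) 0 * xi x).
  by apply: bmM => //; apply: bmM; [exact: bm_cst|exact: bm_max0].
have step : \int[leb]_(x in `]l, r[) (p * Order.max (a (x, t) - a0 x) 0 * xi x) <=
    \int[leb]_(x in `]l, r[) (p * ((a (x, t) - a0 x) * S (ph (a (x, t)) - zk x)) * xi x) +
    \int[leb]_(x in `]l, r[) (p * eta + p * L * `|ph (a0 x) - zk x|).
  rewrite -itvD//; apply: itv_le => //; first exact: bmD.
  move=> x _; have := entropy_pairing (zk x) rmp lipS (ltW eta0) L0 mo (ss_itv su (x, t)) (a001 x).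
  have /andP[x0 x1] := xi01 x.
  have e1 : 0 <= eta + L * `|ph (a0 x) - zk x| by exact: (addr_ge0 (ltW eta0) (mulr_ge0 L0 (normr_ge0 _))).
  move: e1; rewrite -addrA; set y := eta + _ => e1 h.
  rewrite (_ : p * eta + _ = p * y); last by rewrite /y; ring.
  rewrite -!mulrA -mulrDr ler_wpM2l// (le_trans (ler_wpM2r x0 h))// mulrDl -mulrA lerD2l.
  by rewrite ler_piMr.
have lz : \int[leb]_(x in `]l, r[) `|ph (a0 x) - zk x| <= \int[leb]_(x in `]-1, 1[) `|zk x - B x|.
  have bzB : bm (fun x => `|zk x - B x|) by apply: bm_norm; exact: bmB.
  have bzi : bm (fun x => `|zk x - B x| * \1_(`]l, r[%classic) x).
    by apply: bmM => //; exact: bm_indic.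
  rewrite (_ : \int[leb]_(x in `]l, r[) _ = \int[leb]_(x in `]l, r[) (`|zk x - B x| * \1_(`]l, r[%classic) x)).
    rewrite (@Rintegral_subset _ `]l, r[%classic `]-1, 1[%classic).
    - apply: itv_le => // x _; rewrite ler_piMr// indicE lern1 leq_b1//.
    - by move=> x /=; rewrite !in_itv/= => /andP[u1 u2]; rewrite (le_lt_trans l1 u1) (lt_le_trans u2 r1).
    - by move=> x _ nx; rewrite indicE memNset// mulr0.
  apply: eq_Rintegral => x xlr; rewrite indicE xlr mulr1 distrC /B patchE mem_set//.
  move: xlr; rewrite inE/= !in_itv/= => /andP[u1 u2].
  by rewrite (le_trans l1 (ltW u1)) (le_trans (ltW u2) r1).
apply: (le_trans step).
rewrite itvD; [|exact: bm_cst|apply: bmM => //; exact: bm_cst].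
rewrite Rintegral_cst// fine_leb_itv// itvZl//.
have h1 : p * eta * (r - l) <= e / 3.
  rewrite /eta invfM mulrA (_ : _ * _ * _ = (e / 3) * ((p * (r - l)) / (p * (r - l) + 1))); last by ring.
  rewrite ger_pMr ?divr_gt0// ler_pdivrMr// mul1r lerDl//.
have h2 := le_trans (ler_wpM2l (mulr_ge0 p0 L0) lz) nB.
have h3 : C * K * t <= e / 3.
  move: tdl; rewrite ltr_pdivlMr// => /ltW; apply: le_trans.
  by rewrite mulrC ler_wpM2l// lerDl.
have h4 := le_trans (ler_norm _) (le_trans H h3).
rewrite (_ : e = e / 3 + (e / 3 + e / 3)); last by field.
by rewrite lerD// lerD.
Qed.

End initial_side.

Section initial_continuity.
Context (R : realType).
Local Notation leb := (@lebesgue_measure R).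
Variables (T p0 p1 : R) (w : R -> R).
Hypotheses (T0 : 0 < T) (p00 : 0 <= p0) (p10 : 0 <= p1).
Hypotheses (bw : bm w) (wp0 : forall x, -1 < x < 0 -> w x = p0)
  (wp1 : forall x, 0 < x < 1 -> w x = p1).
Variables (ph0 ph1 : R -> R) (a f z0 z1 D : R * R -> R) (good : R -> Prop) (a0 : R -> R).
Hypotheses (cph0 : continuous ph0) (iph0 : {in `[0, 1] &, {homo ph0 : x y / x < y}}).
Hypotheses (cph1 : continuous ph1) (iph1 : {in `[0, 1] &, {homo ph1 : x y / x < y}}).
Hypotheses (su0 : side_sol T (-1) 0 w ph0 a f z0 D good) (su1 : side_sol T 0 1 w ph1 a f z1 D good).
Hypotheses (ba0 : bm a0) (a001 : forall x, 0 <= a0 x <= 1)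
  (pD : forall t, bprim (fun x => D (x, t)) (fun x => w x * (a (x, t) - a0 x))).

Let initial_combine (u v x y c0 c1 e : R) : 0 < e -> u <= e / 8 -> v <= e / 8 ->
  `|x - u| <= c0 -> `|y - v| <= c1 -> c0 + c1 <= e / 8 -> 2 * (x + y) <= e.
Proof. by rewrite !ler_norml => ? ? ? /andP[? ?] /andP[? ?] ?; lra. Qed.

(** The total mass is conserved, so the integral of the absolute value is
    twice the integral of the positive part. *)
Lemma initial_continuity (e : R) : 0 < e -> exists2 dl : R, 0 < dl &
  forall t, good t -> 0 <= t < dl ->
  \int[leb]_(x in `]-1, 1[) (w x * `|a (x, t) - a0 x|) <= e.
Proof.
move=> e0.
pose ep := Order.min 1 (e / 8 / (p0 + p1 + 1)).
have P1 : 0 < p0 + p1 + 1 by rewrite ltr_wpDl// addr_ge0.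
have ep0 : 0 < ep by rewrite lt_min ltr01 !divr_gt0.
have ep1 : ep <= 1 by rewrite ge_min lexx.
have epe : (p0 + p1) * ep <= e / 8.
  have : ep <= e / 8 / (p0 + p1 + 1) by rewrite ge_min lexx orbT.
  rewrite ler_pdivlMr//; apply: le_trans; rewrite mulrC ler_wpM2l ?lerDl//; exact: ltW.
have [h0 [ph0' h001 h0l h0r]] := cutoff_exists (- ep) ep0.
have [h1 [ph1' h101 h1l h1r]] := cutoff_exists 0 ep0.
rewrite addNr in h0r; rewrite add0r in h1r.
have px0 := bprimB (bprim_cst 1) ph0'.
have x001 x : 0 <= 1 - h0 x <= 1.
  by have /andP[u1 u2] := h001 x; rewrite subr_ge0 u2 gerBl u1.
have m10 : (-1 : R) <= 0 by rewrite lerN10.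
have x0out x : -1 < x < 1 -> ~~ (-1 < x < 0) -> 1 - h0 x = 0.
  by move=> /andP[x1 _]; rewrite x1/= -leNgt => /h0r ->; rewrite subrr.
have x1out x : -1 < x < 1 -> ~~ (0 < x < 1) -> h1 x = 0.
  by move=> /andP[_ x1]; rewrite x1 andbT -leNgt => /h1l.
have e8 : 0 < e / 8 by rewrite divr_gt0.
have [d0 d00 H0] := initial_side_cut (lexx (-1)) m10 ler01 p00 bw wp0 cph0 iph0 su0 ba0 a001 pD
  px0 x001 x0out e8.
have [d1 d10 H1] := initial_side_cut m10 ler01 (lexx 1) p10 bw wp1 cph1 iph1 su1 ba0 a001 pD
  ph1' h101 x1out e8.
exists (Order.min d0 d1); first by rewrite lt_min d00.
move=> t gt /andP[t0]; rewrite lt_min => /andP[td0 td1].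
have {}H0 : _ <= _ := H0 t gt _; rewrite t0 td0 in H0; have {}H0 := H0 isT.
have {}H1 : _ <= _ := H1 t gt _; rewrite t0 td1 in H1; have {}H1 := H1 isT.
have bat := bm_section2 t (ss_bm su0).
have bd : bm (fun x => a (x, t) - a0 x) by exact: bmB.
have bF : bm (fun x => Order.max (a (x, t) - a0 x) 0) by exact: bm_max0.
have F01 x : 0 <= Order.max (a (x, t) - a0 x) 0 <= 1.
  have /andP[? ?] := ss_itv su0 (x, t); have /andP[? ?] := a001 x.
  by rewrite le_max lexx orbT ge_max ler01 andbT/=; lra.
have bwF : bm (fun x => w x * Order.max (a (x, t) - a0 x) 0) by exact: bmM.
have [bx0 _ _] := px0; have [bx1 _ _] := ph1'.
have G0 : `|\int[leb]_(x in `]-1, 0[) (w x * Order.max (a (x, t) - a0 x) 0) -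
    \int[leb]_(x in `]-1, 0[) (p0 * Order.max (a (x, t) - a0 x) 0 * (1 - h0 x))| <= p0 * ep.
  have epm1 : -1 <= - ep by rewrite lerN2.
  have ce0 : - ep + ep <= 0 by rewrite addNr.
  apply: (cutoff_defect m10 p00 (ltW ep0) epm1 ce0 bw wp0 bF F01 bx0 x001).
  move=> x /andP[_ x0]; rewrite addNr negb_and -!ltNge => /orP[xe|].
    by rewrite h0l ?subr0// ltW.
  by move=> /(lt_trans x0); rewrite ltxx.
have G1 : `|\int[leb]_(x in `]0, 1[) (w x * Order.max (a (x, t) - a0 x) 0) -
    \int[leb]_(x in `]0, 1[) (p1 * Order.max (a (x, t) - a0 x) 0 * h1 x)| <= p1 * ep.
  have ce1 : 0 + ep <= 1 by rewrite add0r.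
  apply: (cutoff_defect ler01 p10 (ltW ep0) (lexx 0) ce1 bw wp1 bF F01 bx1 h101).
  move=> x /andP[x0 _]; rewrite add0r negb_and -!ltNge => /orP[|xe].
    by move=> /(lt_trans x0); rewrite ltxx.
  by rewrite h1r// ltW.
have mass : \int[leb]_(x in `]-1, 1[) (w x * (a (x, t) - a0 x)) = 0.
  have [_ bwd E] := pD t.
  rewrite (Rintegral_itv_closed false true _ _ bwd) -E; last by lra.
  by rewrite (ss_Dl su0) (ss_Dr su0)// subrr.
have -> : \int[leb]_(x in `]-1, 1[) (w x * `|a (x, t) - a0 x|) =
    2 * \int[leb]_(x in `]-1, 1[) (w x * Order.max (a (x, t) - a0 x) 0).
  transitivity (\int[leb]_(x in `]-1, 1[)
      (2 * (w x * Order.max (a (x, t) - a0 x) 0) - w x * (a (x, t) - a0 x))).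
    apply: eq_Rintegral => x _; have [d0'|/ltW d0'] := leP (a (x, t) - a0 x) 0.
      by rewrite ler0_norm//; ring.
    by rewrite ger0_norm//; ring.
  rewrite itvB; [|by apply: bmM => //; exact: bm_cst|exact: bmM].
  by rewrite mass subr0 itvZl.
rewrite (Rintegral_itv_closed false true _ _ bwF) (Rintegral_itv_cat bwF m10 ler01).
rewrite -(Rintegral_itv_closed false true (-1) 0 bwF) -(Rintegral_itv_closed false true 0 1 bwF).
by rewrite mulrDl in epe; exact: initial_combine e0 H0 H1 G0 G1 epe.
Qed.

End initial_continuity.

(** * Contraction *)

Section doubling_weight.
Context (R : realType).
Local Notation leb := (@lebesgue_measure R).
Variables (sg ka : R -> R) (sk : smooth_step sg ka).

Lemma C11_mul_expansion (A A0 A1 B B0 B1 h C C' L M M' M1 : R) :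
  `|A - A0 - h * A1| <= C * h ^+ 2 -> `|B - B0 - h * B1| <= C' * h ^+ 2 ->
  `|B - B0| <= L * `|h| -> `|B| <= M' -> `|A0| <= M -> `|A1| <= M1 ->
  `|A * B - A0 * B0 - h * (A1 * B0 + A0 * B1)| <= (C * M' + M * C' + M1 * L) * h ^+ 2.
Proof.
move=> hA hB hL hM' hM hM1.
rewrite (_ : _ - _ = (A - A0 - h * A1) * B + A0 * (B - B0 - h * B1) + A1 * (B - B0) * h); last by ring.
apply: (le_trans (ler_normD _ _)); rewrite [leRHS]mulrDl lerD//.
  apply: (le_trans (ler_normD _ _)); rewrite [leRHS]mulrDl lerD// normrM.
    by rewrite mulrAC ler_pM.
  by rewrite -mulrA ler_pM.
by rewrite !normrM -real_normK ?num_real// expr2 mulrA ler_wpM2r// -mulrA ler_pM.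
Qed.

Let support_bounds (h tau T t s d : R) : 0 < h -> h <= t -> t <= tau + h -> t <= s -> s <= t + h ->
  d <= h -> d <= T - tau - 2 * h -> d <= t <= T - d /\ d <= s <= T - d.
Proof. by move=> ? ? ? ? ? ? ?; split; apply/andP; split; lra. Qed.

(** The kernel [kernn n t] is concentrated just after [t], so it forces the
    second time to be close to the first; the difference of steps is a window
    in the first time, from [1/(n+1)] to [tau]. *)
Definition doubling (n : nat) (tau : R) (q : R * R) : R :=
  kernn ka n q.1 q.2 * (stepn sg n n.+1%:R^-1 q.1 - stepn sg n tau q.1).

(** The kernel depends on the difference of times, so the sum of the two
    partial derivatives only sees the window. *)
Lemma doubling_weight (T : R) (n : nat) (tau : R) :
  n.+1%:R^-1 <= tau -> tau + 2 * n.+1%:R^-1 < T -> exists th1 th2,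
  test_weight T (doubling n tau) th1 th2 /\
  forall q, th1 q + th2 q = kernn ka n q.1 q.2 * kernn ka n n.+1%:R^-1 q.1 -
                            kernn ka n q.1 q.2 * kernn ka n tau q.1.
Proof.
set h : R := n.+1%:R^-1 => htau tauT; have h0 : 0 < h by rewrite invr_gt0.
have [ka1 bka1 [C0 kaC _]] := kern_C11 sk.
pose P1 y := n.+1%:R * (n.+1%:R * ka1 (n.+1%:R * y)) : R.
pose P y := n.+1%:R * ka (n.+1%:R * y) : R.
pose Q t := stepn sg n h t - stepn sg n tau t.
pose Q1 t := kernn ka n h t - kernn ka n tau t.
have mlin (F : R * R -> R) : measurable_fun setT F -> measurable_fun setT (fun q => n.+1%:R * F q).
  by move=> mF; apply: measurable_funM => //; exact: measurable_cst.
have mst : measurable_fun setT (fun q : R * R => q.2 - q.1).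
  by apply: measurable_funB; [exact: measurable_snd|exact: measurable_fst].
have bP : bm (fun q : R * R => P (q.2 - q.1)).
  apply: bmM; first exact: bm_cst.
  by apply: (bm_comp (h := fun q : R * R => n.+1%:R * (q.2 - q.1)) _ (kern_bm sk)); exact: mlin.
have bP1 : bm (fun q : R * R => P1 (q.2 - q.1)).
  do 2 (apply: bmM; first exact: bm_cst).
  by apply: (bm_comp (h := fun q : R * R => n.+1%:R * (q.2 - q.1)) _ bka1); exact: mlin.
have b1 (k : R -> R) : bm k -> bm (fun q : R * R => k q.1).
  by move=> bk; apply: (bm_comp (h := fst) _ bk); exact: measurable_fst.
have pQ : bprim Q Q1 by apply: bprimB; exact: stepn_bprim.
have [bQ bQ1 _] := pQ.
have [L L0 QL] := bprim_lip pQ.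
have [CQ QC _] : C11 Q Q1.
  have [c1 h1 h1'] := stepn_C11 sk n h; have [c2 h2 h2'] := stepn_C11 sk n tau.
  exists (c1 + c2) => u v.
    rewrite (_ : _ - _ = (stepn sg n h v - stepn sg n h u - kernn ka n h u * (v - u)) -
      (stepn sg n tau v - stepn sg n tau u - kernn ka n tau u * (v - u))); last by rewrite /Q /Q1; ring.
    by rewrite mulrDl (le_trans (ler_normB _ _))// lerD.
  rewrite (_ : _ - _ = (kernn ka n h v - kernn ka n h u) - (kernn ka n tau v - kernn ka n tau u));
    last by rewrite /Q1; ring.
  by rewrite mulrDl (le_trans (ler_normB _ _))// lerD.
pose CP := n.+1%:R * C0 * n.+1%:R ^+ 2 : R.
have PC y k : `|P (y + k) - P y - k * P1 y| <= CP * k ^+ 2.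
  rewrite (_ : _ - _ = n.+1%:R * (ka (n.+1%:R * (y + k)) - ka (n.+1%:R * y) -
     ka1 (n.+1%:R * y) * (n.+1%:R * (y + k) - n.+1%:R * y))); last by rewrite /P /P1; ring.
  rewrite normrM ger0_norm// /CP -2!mulrA ler_wpM2l// (le_trans (kaC _ _))//.
  by rewrite -mulrBr addrAC subrr add0r exprMn.
have [_ [MP hMP]] := bP; have [_ [MP1 hMP1]] := bP1; have [_ [MQ hMQ]] := bQ.
have [_ [MQ1 hMQ1]] := bQ1.
have CP0 : 0 <= CP * 1 by have := PC 0 1; rewrite expr1n; exact: le_trans.
rewrite mulr1 in CP0.
exists (fun q => - P1 (q.2 - q.1) * Q q.1 + P (q.2 - q.1) * Q1 q.1).
exists (fun q => P1 (q.2 - q.1) * Q q.1).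
split; last by move=> q; rewrite /P /Q1 /kernn; ring.
split.
- exact: (bmM bP (b1 _ bQ)).
- by apply: bmD; apply: bmM => //; [exact: bmN|exact: b1|exact: b1].
- by apply: bmM => //; exact: b1.
- move=> [t s]; rewrite mulr_ge0 ?(kernn_ge0 sk)// subr_ge0 (step_mono sk)//.
  by rewrite ler_wpM2l// lerD2l lerN2.
- exists (Order.min h (T - tau - 2 * h)); first by rewrite lt_min h0/= subr_gt0; lra.
  move=> t s; rewrite /doubling /= => nz.
  have ht : h <= t.
    rewrite leNgt; apply/negP => th; move/eqP : nz; apply.
    rewrite !(stepn_left sk) ?subrr ?mulr0//; last exact: ltW.
    exact: le_trans (ltW th) htau.
  have tt : t <= tau + h.
    rewrite leNgt; apply/negP => th; move/eqP : nz; apply.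
    rewrite !(stepn_right sk) ?subrr ?mulr0//; first exact: ltW.
    by apply: le_trans (ltW th); rewrite lerD2r.
  have ts : t <= s.
    rewrite leNgt; apply/negP => th; move/eqP : nz; apply.
    by rewrite (kernn_out sk) ?mul0r//; left; exact: ltW.
  have st : s <= t + h.
    rewrite leNgt; apply/negP => th; move/eqP : nz; apply.
    by rewrite (kernn_out sk) ?mul0r//; right; exact: ltW.
  have m1 : Order.min h (T - tau - 2 * h) <= h by rewrite ge_min lexx.
  have m2 : Order.min h (T - tau - 2 * h) <= T - tau - 2 * h by rewrite ge_min lexx orbT.
  exact: support_bounds h0 ht tt ts st m1 m2.
- pose K1 := CP * MQ + MP * CQ + MP1 * L; pose K2 := CP * MQ.
  have hP y : `|P y| <= MP by have := hMP (0, y); rewrite /= subr0.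
  have hP1 y : `|P1 y| <= MP1 by have := hMP1 (0, y); rewrite /= subr0.
  exists (Order.max K1 K2) => t s k; rewrite /doubling /=; split.
    apply: (@le_trans _ _ (K1 * k ^+ 2)); last by rewrite ler_wpM2r ?sqr_ge0// le_max lexx.
    rewrite (_ : _ * _ - _ - _ = P (s - (t + k)) * Q (t + k) - P (s - t) * Q t -
      k * (- P1 (s - t) * Q t + P (s - t) * Q1 t)); last by rewrite /P /Q /kernn; ring.
    apply: C11_mul_expansion.
    - have := PC (s - t) (- k); rewrite sqrrN => H; apply: le_trans H.
      rewrite le_eqVlt; apply/orP; left; apply/eqP; congr (`|_|).
      by rewrite (_ : s - (t + k) = s - t - k); ring.
    - by have := QC t (t + k); rewrite (_ : t + k - t = k) 1?[Q1 t * _]mulrC//; ring.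
    - by have := QL t (t + k); rewrite (_ : t + k - t = k)//; ring.
    - exact: hMQ.
    - exact: hP.
    - by rewrite normrN; exact: hP1.
  apply: (@le_trans _ _ (K2 * k ^+ 2)); last by rewrite ler_wpM2r ?sqr_ge0// le_max lexx orbT.
  rewrite (_ : _ * _ - _ - _ = (P (s - t + k) - P (s - t) - k * P1 (s - t)) * Q t); last first.
    by rewrite (_ : s - t + k = s + k - t); [rewrite /P /Q /kernn; ring|ring].
  by rewrite /K2 normrM mulrAC ler_pM.
Qed.

End doubling_weight.

Section kernel_mass.
Context (R : realType).
Local Notation leb := (@lebesgue_measure R).
Variables (sg ka : R -> R) (sk : smooth_step sg ka).

Lemma kernn_int_itv (T : R) (n : nat) (y : R) : 0 <= y -> y + n.+1%:R^-1 <= T ->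
  \int[leb]_(x in `]0, T[) kernn ka n y x = 1.
Proof.
move=> y0 yT; rewrite -(kernn_int1 sk n y).
have h0 : 0 < n.+1%:R^-1 :> R by rewrite invr_gt0.
move: (n.+1%:R^-1 : R) h0 yT (@kernn_out R sg ka sk n y) => h h0 yT out.
transitivity (\int[leb]_(x in `]y, y + h[) kernn ka n y x).
  apply/esym/Rintegral_subset => x /=; rewrite !in_itv/=.
    by move=> /andP[yx xy]; rewrite (le_lt_trans y0 yx) (lt_le_trans xy yT).
  by move=> _ /negP; rewrite negb_and -!leNgt => /orP[?|?]; apply: out; [left|right].
apply: Rintegral_subset => x /=; rewrite !in_itv/=.
  by move=> /andP[yx xy]; rewrite (ltW xy) andbT lerBlDr (le_trans (ltW yx))// lerDl ltW.
by move=> _ /negP; rewrite negb_and -!leNgt => /orP[?|?]; apply: out; [left|right].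
Qed.

Definition kernn2 (n : nat) (y : R) (q : R * R) : R := kernn ka n q.1 q.2 * kernn ka n y q.1.

Lemma kernn2_bm n y : bm (kernn2 n y).
Proof.
apply: bmM.
  have mst : measurable_fun setT (fun q : R * R => n.+1%:R * (q.2 - q.1)).
    apply: measurable_funM; first exact: measurable_cst.
    by apply: measurable_funB; [exact: measurable_snd|exact: measurable_fst].
  by apply: bmM; [exact: bm_cst|exact: bm_comp mst (kern_bm sk)].
by apply: (bm_comp (h := fst) _ (kernn_bm sk n y)); exact: measurable_fst.
Qed.

Lemma kernn2_supp n y t s : kernn2 n y (t, s) != 0 ->
  (y < t < y + n.+1%:R^-1) /\ (t < s < t + n.+1%:R^-1).
Proof.
move=> nz.
have [yt|ty] := leP t y; first by move: nz; rewrite /kernn2/= (kernn_out sk (or_introl yt)) mulr0 eqxx.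
have [yt|ty'] := leP (y + n.+1%:R^-1) t.
  by move: nz; rewrite /kernn2/= [X in _ * X](kernn_out sk (or_intror yt)) mulr0 eqxx.
have [yt|ts] := leP s t; first by move: nz; rewrite /kernn2/= (kernn_out sk (or_introl yt)) mul0r eqxx.
have [yt|//] := leP (t + n.+1%:R^-1) s.
by move: nz; rewrite /kernn2/= [X in X * _](kernn_out sk (or_intror yt)) mul0r eqxx.
Qed.

Lemma kernn2_mass (T : R) (n : nat) (y : R) : 0 <= y -> y + 2 * n.+1%:R^-1 <= T ->
  I2 T (kernn2 n y) = 1.
Proof.
move=> y0 yT; have h0 : 0 < n.+1%:R^-1 :> R by rewrite invr_gt0.
have yT' : y + n.+1%:R^-1 <= T.
  by apply: le_trans yT; rewrite lerD2l mulr2n mulrDl mul1r lerDl ltW.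
rewrite -(kernn_int_itv y0 yT'); apply: eq_Rintegral => t _.
rewrite (_ : (fun s => _) = fun s => kernn ka n t s * kernn ka n y t)//.
rewrite (itvZr _ _ _ _ _ (kernn_bm sk n t)).
have [h1|h1] := leP t y; first by rewrite [X in _ * X](kernn_out sk (or_introl h1)) mulr0 (kernn_out sk (or_introl h1)).
have [h2|h2] := leP (y + n.+1%:R^-1) t.
  by rewrite [X in _ * X](kernn_out sk (or_intror h2)) mulr0 (kernn_out sk (or_intror h2)).
rewrite kernn_int_itv ?mul1r//; first by rewrite (le_trans y0)// ltW.
apply: le_trans yT; rewrite mulr2n mulrDl mul1r addrA lerD2r; exact: ltW.
Qed.

(** The weight is nonnegative and has total mass 1. *)
Lemma kernn2_le (T : R) (n : nat) (y c : R) (F : R * R -> R) (A B : R -> Prop) :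
  0 <= y -> y + 2 * n.+1%:R^-1 <= T -> bm F ->
  {ae leb, forall t, t \in `]0, T[ -> A t} -> {ae leb, forall s, s \in `]0, T[ -> B s} ->
  (forall t s, A t -> B s -> 0 < t < T -> 0 < s < T ->
     y < t < y + n.+1%:R^-1 -> t < s < t + n.+1%:R^-1 -> F (t, s) <= c) ->
  I2 T (fun q => F q * kernn2 n y q) <= c.
Proof.
move=> y0 yT bF aA aB H; have bk := kernn2_bm n y.
apply: (@le_trans _ _ (I2 T (fun q => c * kernn2 n y q))).
  apply: (I2_ae_le _ _ aA aB); [exact: bmM|by apply: bmM => //; exact: bm_cst|].
  move=> t s; rewrite !in_itv/= => tJ sJ At Bs.
  have [->|nz] := eqVneq (kernn2 n y (t, s)) 0; first by rewrite !mulr0.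
  have [h1 h2] := kernn2_supp nz.
  apply: ler_wpM2r; [|exact: H].
  by rewrite /kernn2 mulr_ge0// (kernn_ge0 sk).
rewrite le_eqVlt; apply/orP; left; apply/eqP.
transitivity (c * I2 T (kernn2 n y)); last by rewrite kernn2_mass// mulr1.
rewrite /I2 -itvZl; last by apply: (bm_param _ _ bk) => //; exact: leb_itv_lty.
by apply: eq_Rintegral => t _; rewrite -itvZl//; exact: bm_section1 bk.
Qed.

End kernel_mass.

Section contraction.
Context (R : realType).
Local Notation leb := (@lebesgue_measure R).
Variables (T p0 p1 : R) (w : R -> R).
Hypotheses (T0 : 0 < T) (p00 : 0 <= p0) (p10 : 0 <= p1).
Hypotheses (bw : bm w) (w0 : forall x, 0 <= w x) (wp0 : forall x, -1 < x < 0 -> w x = p0)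
  (wp1 : forall x, 0 < x < 1 -> w x = p1).
Variables (ph0 ph1 : R -> R) (a f z0 z1 D b g zb0 zb1 Db : R * R -> R) (gu gv : R -> Prop).
Hypotheses (cph0 : continuous ph0) (iph0 : {in `[0, 1] &, {homo ph0 : x y / x < y}}).
Hypotheses (cph1 : continuous ph1) (iph1 : {in `[0, 1] &, {homo ph1 : x y / x < y}}).
Hypotheses (su0 : side_sol T (-1) 0 w ph0 a f z0 D gu) (sv0 : side_sol T (-1) 0 w ph0 b g zb0 Db gv).
Hypotheses (su1 : side_sol T 0 1 w ph1 a f z1 D gu) (sv1 : side_sol T 0 1 w ph1 b g zb1 Db gv).
Hypothesis compat : forall t s, gu t -> gv s ->
  (0 < z0 (0, t) - zb0 (0, s) -> 0 <= z1 (0, t) - zb1 (0, s)) /\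
  (0 < z1 (0, t) - zb1 (0, s) -> 0 <= z0 (0, t) - zb0 (0, s)).
Variables (a0 b0 : R -> R).
Hypotheses (ba0 : bm a0) (a001 : forall x, 0 <= a0 x <= 1)
  (pD : forall t, bprim (fun x => D (x, t)) (fun x => w x * (a (x, t) - a0 x))).
Hypotheses (bb0 : bm b0) (b001 : forall x, 0 <= b0 x <= 1)
  (pDb : forall t, bprim (fun x => Db (x, t)) (fun x => w x * (b (x, t) - b0 x))).
Variables (A B : R -> R -> R).
Hypotheses (bA : forall t, 0 <= t <= T -> bm (A t)) (bB : forall t, 0 <= t <= T -> bm (B t)).
Hypotheses (cA : forall k : R -> R, bm k ->
    {within `[0, T], continuous (fun t => \int[leb]_(x in `]-1, 1[) (A t x * k x))})
  (cB : forall k : R -> R, bm k ->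
    {within `[0, T], continuous (fun t => \int[leb]_(x in `]-1, 1[) (B t x * k x))}).
Hypotheses (aA : forall t, gu t -> 0 < t < T -> {ae leb, forall x, -1 < x < 1 -> a (x, t) = A t x})
  (bB' : forall t, gv t -> 0 < t < T -> {ae leb, forall x, -1 < x < 1 -> b (x, t) = B t x}).

Lemma within_near (U : R -> R) (tau e : R) : {within `[0, T], continuous U} -> 0 <= tau <= T -> 0 < e ->
  exists2 dl : R, 0 < dl & forall t, 0 <= t <= T -> `|t - tau| < dl -> `|U t - U tau| <= e.
Proof.
move=> /subspace_continuousP cU tJ e0.
have : U @ within `[0, T] (nbhs tau) --> U tau by apply: cU; rewrite /= in_itv.
move/cvgrPdist_le => /(_ e e0); rewrite /within /= => -[dl /= dl0 H].
exists dl => // t tI tt; rewrite distrC; apply: H; last by rewrite /= in_itv.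
by rewrite /ball_/= distrC.
Qed.

(** Indicator of the set where the difference is positive at the fixed time
    [tau]. Integrating over this set is weakly continuous in time, and bounds
    the integral of the positive part from below at other times. *)
Definition active (tau x : R) : R := if B tau x < A tau x then 1 else 0.

Let active_bm tau : 0 <= tau <= T -> bm (fun x => w x * active tau x).
Proof.
move=> tJ; apply: bmM => //; split; last by exists 1 => x; rewrite /active; case: ifP; rewrite ?normr1 ?normr0.
apply: measurable_fun_ifT; [|exact: measurable_cst|exact: measurable_cst].
by apply: measurable_fun_ltr; [exact: (bB tJ).1|exact: (bA tJ).1].
Qed.

Let late_combine (u u' v v' e x : R) : `|u - u'| <= e / 2 -> `|v - v'| <= e / 2 -> u - v <= x ->
  u' - v' - e <= x.
Proof. by rewrite !ler_norml => /andP[? ?] /andP[? ?] ?; lra. Qed.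

Let step_size (h tau d1 d2 : R) : 0 < h -> 0 < tau -> h < Order.min d1 d2 / 3 -> h < tau ->
  h < (T - tau) / 2 ->
  h <= tau /\ (tau + 2 * h < T /\ (0 < 3 * h /\ (2 * h < d1 /\ h + 2 * h < d2))).
Proof.
move=> h0 tau0 hd htau hT.
have m1 : Order.min d1 d2 <= d1 by rewrite ge_min lexx.
have m2 : Order.min d1 d2 <= d2 by rewrite ge_min lexx orbT.
by move: (Order.min d1 d2) hd m1 m2 => u ? ? ?; do 4 (split; first lra); lra.
Qed.

Let final_combine (x y e q q0 : R) : 0 <= x - y -> x <= q0 + e / 2 -> - y <= - (q - e / 2) ->
  q <= q0 + e.
Proof. by move=> *; lra. Qed.

Let max_triangle (q k q0 k0 : R) :
  Order.max (q - k) 0 <= Order.max (q0 - k0) 0 + (`|q - q0| + `|k - k0|).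
Proof.
have h1 := ler_norm (q - q0); have h2 := ler_norm (- (k - k0)); rewrite normrN in h2.
have h3 : q0 - k0 <= Order.max (q0 - k0) 0 by rewrite le_max lexx.
have h4 : 0 <= Order.max (q0 - k0) 0 by rewrite le_max lexx orbT.
have h5 := normr_ge0 (q - q0); have h6 := normr_ge0 (k - k0).
by rewrite ge_max; apply/andP; split; lra.
Qed.

Let active_max (tau x : R) : w x * Order.max (A tau x - B tau x) 0 =
  A tau x * (w x * active tau x) - B tau x * (w x * active tau x).
Proof.
rewrite /active; case: ltP => h.
  by rewrite max_l ?subr_ge0 1?ltW//; ring.
by rewrite max_r ?subr_le0//; ring.
Qed.

Definition gap (tau : R) : R := \int[leb]_(x in `]-1, 1[) (w x * Order.max (A tau x - B tau x) 0).

Let gapE tau : 0 <= tau <= T -> gap tau =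
  \int[leb]_(x in `]-1, 1[) (A tau x * (w x * active tau x)) -
  \int[leb]_(x in `]-1, 1[) (B tau x * (w x * active tau x)).
Proof.
move=> tJ; have bk := active_bm tJ.
rewrite -itvB; [|by apply: bmM => //; exact: bA|by apply: bmM => //; exact: bB].
by apply: eq_Rintegral => x _; exact: active_max.
Qed.

Let active_le (tau x q k : R) : q * (w x * active tau x) - k * (w x * active tau x) <=
  w x * Order.max (q - k) 0.
Proof.
rewrite /active; case: ifP => _.
  by rewrite mulr1 -mulrBl mulrC ler_wpM2l// le_max lexx.
by rewrite mulr0 !mulr0 subrr mulr_ge0// le_max lexx orbT.
Qed.

Let bmaxab (q k : R -> R) : bm q -> bm k -> bm (fun x => w x * Order.max (q x - k x) 0).
Proof. by move=> bq bk; apply: bmM => //; apply: bm_max0; exact: bmB. Qed.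

Let initial_gap := \int[leb]_(x in `]-1, 1[) (w x * Order.max (a0 x - b0 x) 0).

(** Weak lower semicontinuity. *)
Let excess_late tau e : 0 <= tau <= T -> 0 < e -> exists2 dl : R, 0 < dl & forall t s,
  gu t -> gv s -> 0 < t < T -> 0 < s < T -> `|t - tau| < dl -> `|s - tau| < dl ->
  gap tau - e <= excess w a b (t, s).
Proof.
move=> tJ e0; have bk := active_bm tJ.
have e2 : 0 < e / 2 by rewrite divr_gt0.
have [d1 d10 H1] := within_near (cA bk) tJ e2.
have [d2 d20 H2] := within_near (cB bk) tJ e2.
exists (Order.min d1 d2); first by rewrite lt_min d10.
move=> t s gt gs tI sI; rewrite !lt_min => /andP[td _] /andP[_ sd].
have tI' : 0 <= t <= T by case/andP: tI => h1 h2; rewrite !ltW.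
have sI' : 0 <= s <= T by case/andP: sI => h1 h2; rewrite !ltW.
have bat := bm_section2 t (ss_bm su0); have bbs := bm_section2 s (ss_bm sv0).
have h1 := H1 _ tI' td; have h2 := H2 _ sI' sd.
have h3 : \int[leb]_(x in `]-1, 1[) (A t x * (w x * active tau x)) -
    \int[leb]_(x in `]-1, 1[) (B s x * (w x * active tau x)) <= excess w a b (t, s).
  have bAk : bm (fun x => A t x * (w x * active tau x)) by apply: bmM => //; exact: bA.
  have bBk : bm (fun x => B s x * (w x * active tau x)) by apply: bmM => //; exact: bB.
  rewrite -itvB//; apply: itv_ae_le; [exact: bmB|exact: bmaxab|].
  apply: ae2 (aA gt tI) (bB' gs sI) _ => x h4 h5 /=; rewrite in_itv/= => x1.
  by rewrite h4// h5//; exact: active_le.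
rewrite gapE//; exact: late_combine h1 h2 h3.
Qed.

(** Strong continuity at the initial time, for both solutions. *)
Let excess_early e : 0 < e -> exists2 dl : R, 0 < dl & forall t s,
  gu t -> gv s -> 0 < t < dl -> 0 < s < dl -> excess w a b (t, s) <= initial_gap + e.
Proof.
move=> e0; have e2 : 0 < e / 2 by rewrite divr_gt0.
have [d1 d10 H1] := initial_continuity p00 p10 bw wp0 wp1 cph0 iph0 cph1 iph1 su0 su1 ba0 a001 pD e2.
have [d2 d20 H2] := initial_continuity p00 p10 bw wp0 wp1 cph0 iph0 cph1 iph1 sv0 sv1 bb0 b001 pDb e2.
exists (Order.min d1 d2); first by rewrite lt_min d10.
move=> t s gt gs /andP[t0]; rewrite lt_min => /andP[td _] /andP[s0]; rewrite lt_min => /andP[_ sd].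
have {}H1 := H1 t gt; rewrite (ltW t0) td in H1; have {}H1 := H1 isT.
have {}H2 := H2 s gs; rewrite (ltW s0) sd in H2; have {}H2 := H2 isT.
have bat := bm_section2 t (ss_bm su0); have bbs := bm_section2 s (ss_bm sv0).
have b1 : bm (fun x => w x * `|a (x, t) - a0 x|) by apply: bmM => //; apply: bm_norm; exact: bmB.
have b2 : bm (fun x => w x * `|b (x, s) - b0 x|) by apply: bmM => //; apply: bm_norm; exact: bmB.
have b3 := bmaxab ba0 bb0.
apply: (@le_trans _ _ (initial_gap + (\int[leb]_(x in `]-1, 1[) (w x * `|a (x, t) - a0 x|) +
    \int[leb]_(x in `]-1, 1[) (w x * `|b (x, s) - b0 x|)))); last first.
  by rewrite lerD2l [leRHS]splitr lerD.
rewrite /initial_gap -itvD// -itvD//; last exact: bmD.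
apply: itv_le; [exact: bmaxab|by apply: bmD => //; exact: bmD|].
move=> x _ /=; rewrite -!mulrDr ler_wpM2l//; exact: max_triangle.
Qed.

(** The two averages given by the weight [doubling] are compared. *)
Lemma contraction_interior tau : 0 < tau < T -> gap tau <= initial_gap.
Proof.
move=> /andP[tau0 tauT]; apply/ler_addgt0Pr => e e0; have e2 : 0 < e / 2 by rewrite divr_gt0.
have tJ : 0 <= tau <= T by rewrite !ltW.
have [d1 d10 late] := excess_late tJ e2.
have [d2 d20 early] := excess_early e2.
have [sg [ka sk]] := smooth_step_exists R.
(* the supports reach times 3/(n+1) near 0 and tau + 2/(n+1) near tau *)
pose m := Order.min (Order.min d1 d2 / 3) (Order.min tau ((T - tau) / 2)).
have m0 : 0 < m by rewrite !lt_min !divr_gt0 ?lt_min ?d10 ?d20 ?tau0 ?subr_gt0.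
have [n nm] : exists n : nat, n.+1%:R^-1 < m.
  have : n.+1%:R^-1 @[n --> \oo] --> (0 : R) by exact: cvg_harmonic.
  move=> /cvgrPdist_lt /(_ m m0) [N _ /(_ N (leqnn N))].
  by rewrite /= sub0r normrN ger0_norm//; exists N.
have h0 : 0 < n.+1%:R^-1 :> R by rewrite invr_gt0.
move: nm; rewrite /m !lt_min => /andP[nd /andP[ntau nT]].
have [htau [hT [h3 [hd1 hd2]]]] := step_size h0 tau0 nd ntau nT.
have hy : n.+1%:R^-1 + 2 * n.+1%:R^-1 <= T :> R by apply: le_trans (ltW hT); rewrite lerD2r.
have [th1 [th2 [tw thE]]] := doubling_weight sk htau hT.
have K := kato_global T0 p00 p10 bw wp0 wp1 cph0 iph0 cph1 iph1 su0 sv0 su1 sv1 compat tw.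
have bE : bm (excess w a b) := excess_bm bw su0 sv0.
have bk y := kernn2_bm sk n y.
have E : I2 T (fun q => excess w a b q * (th1 q + th2 q)) =
    I2 T (fun q => excess w a b q * kernn2 ka n n.+1%:R^-1 q) -
    I2 T (fun q => excess w a b q * kernn2 ka n tau q).
  rewrite -I2B; [|exact: bmM|exact: bmM].
  by apply: I2_ext => t s _ _; rewrite thE mulrBr.
have U1 : I2 T (fun q => excess w a b q * kernn2 ka n n.+1%:R^-1 q) <= initial_gap + e / 2.
  apply: (kernn2_le sk _ hy bE (ss_good su0) (ss_good sv0)); first exact: ltW.
  move=> t s gt gs _ _ /andP[t1 t2] /andP[s1 s2]; apply: early => //; apply/andP; split.
  - exact: lt_trans h0 t1.
  - by apply: lt_trans t2 (le_lt_trans _ hd2); rewrite lerD2l ler_peMl ?ler1n// ltW.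
  - exact: lt_trans h0 (lt_trans t1 s1).
  - by apply: lt_le_trans s2 (le_trans _ (ltW hd2)); rewrite mulr2n mulrDl mul1r addrA lerD2r ltW.
have U2 : I2 T (fun q => (- excess w a b q) * kernn2 ka n tau q) <= - (gap tau - e / 2).
  apply: (kernn2_le sk (ltW tau0) (ltW hT) (bmN bE) (ss_good su0) (ss_good sv0)).
  move=> t s gt gs tI sI /andP[t1 t2] /andP[s1 s2]; rewrite lerN2; apply: late => //.
    by rewrite gtr0_norm ?subr_gt0// ltrBlDl (lt_trans t2)// ltrD2l (le_lt_trans _ hd1)// ler_peMl ?ler1n// ltW.
  rewrite gtr0_norm ?subr_gt0 ?(lt_trans t1)// ltrBlDl (lt_trans s2)//.
  rewrite (lt_le_trans (y := tau + n.+1%:R^-1 + n.+1%:R^-1)) ?ltrD2r//.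
  by rewrite -addrA lerD2l (le_trans _ (ltW hd1))// mulr2n mulrDl mul1r.
have N : I2 T (fun q => (- excess w a b q) * kernn2 ka n tau q) =
    - I2 T (fun q => excess w a b q * kernn2 ka n tau q).
  by rewrite -I2N; [apply: I2_ext => t s _ _; rewrite mulNr|exact: bmM].
rewrite N in U2; rewrite E in K; exact: final_combine K U1 U2.
Qed.

(** At the extreme times the inequality is inherited from nearby interior
    times, by integrating over the set [active tau]. *)
Theorem contraction tau : 0 <= tau <= T -> gap tau <= initial_gap.
Proof.
move=> tJ; apply/ler_addgt0Pr => e e0; have e2 : 0 < e / 2 by rewrite divr_gt0.
have bk := active_bm tJ.
have [d1 d10 H1] := within_near (cA bk) tJ e2.
have [d2 d20 H2] := within_near (cB bk) tJ e2.
have [s sJ sd] : exists2 s, 0 < s < T & `|s - tau| < Order.min d1 d2.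
  have d0 : 0 < Order.min d1 d2 by rewrite lt_min d10.
  case/andP: tJ => t0 tT; have [tau1|tau1] := leP tau (T / 2).
    exists (tau + Order.min (Order.min d1 d2) T / 4).
      have : Order.min (Order.min d1 d2) T <= T by rewrite ge_min lexx orbT.
      have : 0 < Order.min (Order.min d1 d2) T by rewrite lt_min d0.
      by move: (Order.min _ T) => u ? ?; apply/andP; split; lra.
    rewrite addrAC subrr add0r.
    have : Order.min (Order.min d1 d2) T <= Order.min d1 d2 by rewrite ge_min lexx.
    have u0 : 0 < Order.min (Order.min d1 d2) T by rewrite lt_min d0.
    rewrite gtr0_norm ?divr_gt0//.
    by move: (Order.min _ T) u0 => u ? ?; lra.
  exists (tau - Order.min (Order.min d1 d2) T / 4).
    have : Order.min (Order.min d1 d2) T <= T by rewrite ge_min lexx orbT.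
    have : 0 < Order.min (Order.min d1 d2) T by rewrite lt_min d0.
    by move: (Order.min _ T) => u ? ?; apply/andP; split; lra.
  rewrite addrAC subrr add0r normrN.
  have : Order.min (Order.min d1 d2) T <= Order.min d1 d2 by rewrite ge_min lexx.
  have u0 : 0 < Order.min (Order.min d1 d2) T by rewrite lt_min d0.
  rewrite gtr0_norm ?divr_gt0//.
  by move: (Order.min _ T) u0 => u ? ?; lra.
move: sd; rewrite lt_min => /andP[sd1 sd2].
have sJ' : 0 <= s <= T by case/andP: sJ => h1 h2; rewrite !ltW.
have h1 := H1 _ sJ' sd1; have h2 := H2 _ sJ' sd2.
apply: le_trans (_ : gap s + e <= _); last by rewrite lerD2r contraction_interior.
rewrite -lerBlDr gapE//; apply: late_combine h1 h2 _.
rewrite -itvB; [|by apply: bmM => //; exact: bA|by apply: bmM => //; exact: bB].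
apply: itv_le; [|by apply: bmaxab; [exact: bA|exact: bB]|by move=> x _; exact: active_le].
by apply: bmB; apply: bmM => //; [exact: bA|exact: bB].
Qed.

End contraction.

(** * Weak derivatives and storage balance *)

Section representatives.
Context (R : realType).
Local Notation leb := (@lebesgue_measure R).

Lemma Lp_on_measurable d (X : measurableType d) (mu : {measure set X -> \bar R})
  (p : \bar R) (D : set X) (f : X -> R) : Lp_on mu p D f -> measurable_fun setT (f \_ D).
Proof. by rewrite /Lp_on inE/= => /andP[]; rewrite inE. Qed.

Lemma Lp_on_measurable_on d (X : measurableType d) (mu : {measure set X -> \bar R})
  (p : \bar R) (D : set X) (f : X -> R) : measurable D -> Lp_on mu p D f -> measurable_fun D f.
Proof. by move=> mD /Lp_on_measurable; rewrite (measurable_restrictT _ mD). Qed.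

(** Truncation at the essential supremum; on a null space every function is 0
    almost everywhere. *)
Lemma Lp_on_bounded d (X : measurableType d) (mu : {measure set X -> \bar R})
  (D : set X) (f : X -> R) : Lp_on mu +oo%E D f ->
  exists k : X -> R, [/\ bm k, forall x, ~ D x -> k x = 0 & {ae mu, forall x, D x -> f x = k x}].
Proof.
move=> fL; have mf := Lp_on_measurable fL.
have [pos|] := boolP ((0 < mu setT)%E); last first.
  rewrite -leNgt measure_le0 => /eqP mu0.
  exists (fun=> 0); split => //; first exact: bm_cst.
  by apply: (@negligibleS _ _ _ mu setT) => //; exists setT; split.
have [M HM] : exists M, {ae mu, forall x, `|(f \_ D) x| <= M}.
  apply: (@ess_supr_bounded _ _ _ mu (fun x => `|(f \_ D) x|)).
  move: fL; rewrite /Lp_on inE/= => /andP[_]; rewrite inE/= /finite_norm unlock /= pos.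
  by congr (ess_sup _ _ < _)%E; apply/funext.
pose k x := Order.max (Order.min ((f \_ D) x) `|M|) (- `|M|).
exists k; split.
- split.
    by apply: measurable_maxr; [apply: measurable_minr|]; do ?exact: measurable_cst.
  exists `|M| => x; rewrite ler_norml /k le_max lexx orbT/= ge_max ge_min lexx orbT/=.
  by rewrite (@le_trans _ _ 0)// oppr_le0.
- move=> x nx; rewrite /k patchE memNset// (min_l (normr_ge0 M)).
  by rewrite max_l// oppr_le0.
- apply: filterS HM => x /= + Dx; rewrite /k patchE mem_set// => fM.
  have : `|f x| <= `|M| by rewrite (le_trans fM)// ler_norm.
  by rewrite ler_norml => /andP[f1 f2]; rewrite min_l// max_l.
Qed.

Lemma bm_Lp_on1 (k : R -> R) : bm k -> Lp_on leb 1%:E `]-1, 1[ k.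
Proof.
move=> bk; rewrite /Lp_on; apply/Lfun1_integrable.
rewrite (_ : EFin \o k \_ _ = (EFin \o k) \_ `]-1, 1[); last first.
  by apply/funext => x /=; rewrite !patchE; case: ifP.
apply/(integrable_restrict leb (measurable_itv _) measurableT).
by rewrite setTI; apply: bm_integrable => //; exact: leb_itv_lty.
Qed.

End representatives.

Section fundamental_lemma.
Context (R : realType).
Local Notation leb := (@lebesgue_measure R).
Variables (sg ka : R -> R) (sk : smooth_step sg ka).

Lemma window_test (l r y1 y2 : R) (n : nat) : l < y1 -> y1 < y2 -> y2 + n.+1%:R^-1 < r ->
  test_function `]l, r[ (fun x => stepn sg n y1 x - stepn sg n y2 x).
Proof.
move=> ly1 y12 y2r; split.
  move=> k; rewrite (_ : (fun x => _) = (fun x => stepn sg n y1 x + (-1) * stepn sg n y2 x)).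
    apply: class_C_add; first exact: (stepn_class_C sk).
    by apply: class_C_mul; [exact: class_C_cst|exact: (stepn_class_C sk)].
  by apply/funext => x; rewrite mulN1r.
exists `[y1, y2 + n.+1%:R^-1]%classic; split; first exact: segment_compact.
  by move=> x /=; rewrite !in_itv/= => /andP[x1 x2]; rewrite (lt_le_trans ly1 x1) (le_lt_trans x2 y2r).
move=> x _ nz; rewrite /= in_itv/= leNgt; apply/andP; split.
  apply/negP => xy; move/eqP: nz; apply.
  by rewrite !(stepn_left sk) ?subrr// ltW// (lt_trans xy).
rewrite leNgt; apply/negP => xy; move/eqP: nz; apply.
rewrite !(stepn_right sk) ?subrr//; first exact: ltW.
by apply: le_trans (ltW xy); rewrite lerD2r ltW.
Qed.

Lemma kernel_test (l r y : R) (n : nat) : l < y -> y + n.+1%:R^-1 < r ->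
  test_function `]l, r[ (kernn ka n y).
Proof.
move=> ly yr; split; first by move=> k; exact: (kernn_class_C sk).
exists `[y, y + n.+1%:R^-1]%classic; split; first exact: segment_compact.
  by move=> x /=; rewrite !in_itv/= => /andP[x1 x2]; rewrite (lt_le_trans ly x1) (le_lt_trans x2 yr).
move=> x _ nz; rewrite /= in_itv/= !leNgt; apply/andP; split; apply/negP => xy; move/eqP: nz; apply.
  by rewrite (kernn_out sk)//; left; exact: ltW.
by rewrite (kernn_out sk)//; right; exact: ltW.
Qed.

(** The differences of two steps are test functions whose derivatives are
    averaging kernels at two points. In the limit the difference [H - W] takes
    the same value at any two of its Lebesgue points, and this value is its
    mean. *)
Lemma weak_derivative_primitive (l r : R) (H fl W : R -> R) : l < r -> bm H -> bprim W fl ->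
  (forall psi : R -> R, test_function `]l, r[ psi ->
     \int[leb]_(x in `]l, r[) (H x * derive1 psi x) = - \int[leb]_(x in `]l, r[) (fl x * psi x)) ->
  {ae leb, forall x, l < x < r ->
     H x = W x + (\int[leb]_(y in `]l, r[) (H y - W y)) / (r - l)}.
Proof.
move=> lr bH pW weak; have [bW bfl _] := pW.
have bK : bm (fun x => H x - W x) by exact: bmB.
have har0 : n.+1%:R^-1 @[n --> \oo] --> (0 : R) by exact: cvg_harmonic.
have bker n y : bm (fun x => kernn ka n y x * (H x - W x)).
  by apply: bmM => //; exact: (kernn_bm sk).
(* the defining identity, tested with the window from [y1] to [y2] *)
have windows y1 y2 n : l < y1 -> y1 < y2 -> y2 + n.+1%:R^-1 < r ->
    \int[leb]_(x in `[l, r]) (kernn ka n y1 x * (H x - W x)) =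
    \int[leb]_(x in `[l, r]) (kernn ka n y2 x * (H x - W x)).
  move=> ly1 y12 y2r; have := weak _ (window_test ly1 y12 y2r).
  set psi := (fun x => _ - _).
  have ppsi : bprim psi (fun x => kernn ka n y1 x - kernn ka n y2 x).
    by apply: bprimB; exact: (stepn_bprim sk).
  have [bpsi bpsi' _] := ppsi.
  have dpsi x : derive1 psi x = kernn ka n y1 x - kernn ka n y2 x.
    rewrite derive1E; apply: derive_val.
    have d1 := stepn_derive sk n y1 x; have d2 := stepn_derive sk n y2 x.
    exact: is_deriveB.
  under eq_Rintegral do rewrite dpsi.
  have h0 : 0 < n.+1%:R^-1 :> R by rewrite invr_gt0.
  have psil : psi l = 0.
    by rewrite /psi !(stepn_left sk) ?subrr//; [exact/ltW/(lt_trans ly1)|exact: ltW].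
  have psir : psi r = 0.
    rewrite /psi !(stepn_right sk) ?subrr//; first exact: ltW.
    by apply: le_trans (ltW y2r); rewrite lerD2r ltW.
  have := bprim_parts (ltW lr) ppsi pW psil psir.
  have bHp : bm (fun x => H x * (kernn ka n y1 x - kernn ka n y2 x)) by exact: bmM.
  have bfp : bm (fun x => fl x * psi x) by exact: bmM.
  rewrite (Rintegral_itv_closed false true _ _ bHp) (Rintegral_itv_closed false true _ _ bfp).
  rewrite [X in - X](_ : _ = \int[leb]_(x in `[l, r]) (fl x * psi x)); last first.
    by apply: eq_Rintegral => x _; rewrite mulrC.
  move=> <- /eqP; rewrite -subr_eq0 -itvB//; last exact: bmM.
  move=> /eqP E; apply/eqP; rewrite -subr_eq0 -itvB//; apply/eqP; rewrite -E.
  by apply: eq_Rintegral => x _; ring.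
have lebeq y1 y2 : lebesgue_pt (fun x => H x - W x) y1 -> lebesgue_pt (fun x => H x - W x) y2 ->
    l < y1 -> y1 < y2 -> y2 < r -> H y1 - W y1 = H y2 - W y2.
  move=> L1 L2 ly1 y12 y2r.
  have c1 := cvg_kernn sk bK L1 ly1 (lt_trans y12 y2r).
  have c2 := cvg_kernn sk bK L2 (lt_trans ly1 y12) y2r.
  have c1' : \int[leb]_(x in `[l, r]) (kernn ka n y1 x * (H x - W x)) @[n --> \oo] -->
      H y2 - W y2.
    apply: cvg_trans c2; apply: near_eq_cvg.
    near=> n; apply/esym/windows => //.
    rewrite -ltrBrDl; near: n.
    move/cvgrPdist_lt : har0 => /(_ (r - y2)); rewrite subr_gt0 => /(_ y2r).
    by apply: filterS => n; rewrite sub0r normrN ger0_norm.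
  by rewrite -(cvg_lim (@norm_hausdorff _ _) c1) (cvg_lim (@norm_hausdorff _ _) c1').
apply: (ae1 (bm_lebesgue_pt bK)) => y Ly /andP[ly yr].
have -> : \int[leb]_(x in `]l, r[) (H x - W x) = \int[leb]_(x in `]l, r[) (H y - W y).
  apply: itv_ae_eq => //; first exact: bm_cst.
  apply: (ae1 (bm_lebesgue_pt bK)) => x Lx /=; rewrite in_itv/= => /andP[lx xr].
  have [xy|yx|->//] := ltgtP x y; first exact: lebeq.
  by apply/esym; exact: lebeq.
rewrite Rintegral_cst// fine_leb_itv ?ltW// mulfK ?gt_eqF ?subr_gt0//; ring.
Unshelve. all: end_near. Qed.

End fundamental_lemma.

Section weak_derivatives.
Context (R : realType).
Local Notation leb := (@lebesgue_measure R).

Lemma test_function_continuous (D : set R) (psi : R -> R) : test_function D psi ->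
  continuous psi /\ continuous (derive1 psi).
Proof.
move=> [sm _]; have [cpsi /(_ 1)[_ [cd _]]] := sm 1%N; split=> //.
by rewrite (_ : derive1 psi = (fun x => 'D_1 psi x))//; apply/funext => x; rewrite derive1E.
Qed.

Lemma H1_deriv_bounded (l r : R) (F g H fl : R -> R) : H1_deriv l r F g -> bm H -> bm fl ->
  {ae leb, forall x, l < x < r -> F x = H x} -> {ae leb, forall x, l < x < r -> g x = fl x} ->
  forall psi : R -> R, test_function `]l, r[ psi ->
     \int[leb]_(x in `]l, r[) (H x * derive1 psi x) = - \int[leb]_(x in `]l, r[) (fl x * psi x).
Proof.
move=> [FL gL weak] bH bfl FH gf psi tpsi; have [cpsi cdpsi] := test_function_continuous tpsi.
have mD : measurable (`]l, r[%classic : set (measurableTypeR R)) by exact: measurable_itv.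
have mpsi : measurable_fun (`]l, r[%classic : set (measurableTypeR R)) psi.
  by apply: (measurable_funS measurableT) => //; exact: continuous_measurable_fun.
have mdpsi : measurable_fun (`]l, r[%classic : set (measurableTypeR R)) (derive1 psi).
  by apply: (measurable_funS measurableT) => //; exact: continuous_measurable_fun.
have mF := Lp_on_measurable_on mD FL; have mg := Lp_on_measurable_on mD gL.
have mH : measurable_fun (`]l, r[%classic : set (measurableTypeR R)) H.
  by apply: (measurable_funS measurableT) => //; exact: bH.1.
have mfl : measurable_fun (`]l, r[%classic : set (measurableTypeR R)) fl.
  by apply: (measurable_funS measurableT) => //; exact: bfl.1.
rewrite -(@ae_eq_Rintegral _ _ _ leb _ mD (fun x => F x * derive1 psi x)).
- rewrite weak//; congr (- _); apply: ae_eq_Rintegral => //; [exact: measurable_funM|exact: measurable_funM|].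
  by apply: ae1 gf _ => x h /=; rewrite in_itv/= => /h ->.
- exact: measurable_funM.
- exact: measurable_funM.
- by apply: ae1 FH _ => x h /=; rewrite in_itv/= => /h ->.
Qed.

(** The integral of a weak derivative against a test function only depends on
    the function differentiated. *)
Lemma H1_deriv_same (l r : R) (F g g' psi : R -> R) : H1_deriv l r F g -> H1_deriv l r F g' ->
  test_function `]l, r[ psi ->
  \int[leb]_(x in `]l, r[) (g x * psi x) = \int[leb]_(x in `]l, r[) (g' x * psi x).
Proof.
by move=> [_ _ h] [_ _ h'] tpsi; apply: oppr_inj; rewrite -h// -h'.
Qed.

(** Distinct values at a point would remain distinct on an interval, of
    positive measure. *)
Lemma trace_unique (l r x0 : R) (F G : R -> R) : l < r -> l <= x0 <= r ->
  {within `[l, r], continuous F} -> {within `[l, r], continuous G} ->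
  {ae leb, forall x, l < x < r -> F x = G x} -> F x0 = G x0.
Proof.
move=> lr x0lr cF cG FG; apply/eqP/negPn/negP => ne.
have lim (K : R -> R) : {within `[l, r], continuous K} -> K @ within `[l, r] (nbhs x0) --> K x0.
  by move=> /subspace_continuousP cK; apply: cK; rewrite /= in_itv.
have d0 : 0 < `|F x0 - G x0| / 2 by rewrite divr_gt0// normr_gt0 subr_eq0.
have [dF /= dF0 HF] : \forall x \near x0, x \in `[l, r] -> `|F x0 - F x| < `|F x0 - G x0| / 2.
  by move/cvgrPdist_lt : (lim _ cF) => /(_ _ d0).
have [dG /= dG0 HG] : \forall x \near x0, x \in `[l, r] -> `|G x0 - G x| < `|F x0 - G x0| / 2.
  by move/cvgrPdist_lt : (lim _ cG) => /(_ _ d0).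
have [a [b [ab laF sub]]] : exists a b, [/\ a < b, l <= a & b <= r /\
    forall x, a < x < b -> `|x0 - x| < dF /\ `|x0 - x| < dG].
  have := x0lr => /andP[lx xr].
  exists (Order.max l (x0 - Order.min dF dG)), (Order.min r (x0 + Order.min dF dG)).
  have m0 : 0 < Order.min dF dG by rewrite lt_min dF0.
  have mF : Order.min dF dG <= dF by rewrite ge_min lexx.
  have mG : Order.min dF dG <= dG by rewrite ge_min lexx orbT.
  move: (Order.min dF dG) m0 mF mG => d d1 d2 d3.
  split; [|by rewrite le_max lexx|split; first by rewrite ge_min lexx].
    by rewrite gt_max !lt_min lr/=; apply/andP; split; [lra|apply/andP; split; lra].
  move=> x; rewrite gt_max lt_min => /andP[/andP[x1 x2] /andP[x3 x4]].
  by split; rewrite ltr_norml; apply/andP; split; lra.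
have [brr near] := sub.
have : \int[leb]_(x in `]a, b[) (1 : R) = \int[leb]_(x in `]a, b[) 0.
  apply: itv_ae_eq; [exact: bm_cst|exact: bm_cst|].
  apply: ae1 FG _ => x FGx /=; rewrite in_itv/= => xab.
  have /andP[x1 x2] := xab; have [h1 h2] := near _ xab.
  have xlr : x \in `[l, r] by rewrite in_itv/= (le_trans laF (ltW x1)) (le_trans (ltW x2) brr).
  have := HF x h1 xlr; have := HG x h2 xlr.
  rewrite FGx ?(le_lt_trans laF x1) ?(lt_le_trans x2 brr)// => h3 h4.
  have : `|F x0 - G x0| < `|F x0 - G x0|.
    rewrite [ltRHS]splitr (le_lt_trans _ (ltrD h4 h3))// -{1}(subrK (G x) (F x0)) -addrA.
    by rewrite (le_trans (ler_normD _ _))// lerD2l distrC.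
  by rewrite ltxx.
rewrite !Rintegral_cst// mul0r mul1r fine_leb_itv ?ltW// => /eqP.
by rewrite subr_eq0 gt_eqF.
Qed.

End weak_derivatives.

Section two_subdomains.
Context (R : realType).
Local Notation leb := (@lebesgue_measure R).

Lemma ord2P (P : 'I_2 -> Prop) : P ord0 -> P ord_max -> forall i, P i.
Proof.
move=> h0 h1 [[|[|//]] p]; first by rewrite (_ : Ordinal p = ord0)//; exact: val_inj.
by rewrite (_ : Ordinal p = ord_max)//; exact: val_inj.
Qed.

Lemma sum_ord2 (F : 'I_2 -> R) : \sum_(i < 2) F i = F ord0 + F ord_max.
Proof.
by rewrite big_ord_recl big_ord1; congr (_ + F _); exact: val_inj.
Qed.

Lemma left_end0 : left_end R ord0 = -1. Proof. by rewrite /left_end sub0r. Qed.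
Lemma right_end0 : right_end R ord0 = 0. Proof. by []. Qed.
Lemma left_end1 : left_end R ord_max = 0. Proof. by rewrite /left_end subrr. Qed.
Lemma right_end1 : right_end R ord_max = 1. Proof. by []. Qed.
Lemma end_lt i : left_end R i < right_end R i.
Proof. by rewrite /left_end /right_end gtrBl. Qed.
Lemma left_end_ge i : -1 <= left_end R i.
Proof. by rewrite /left_end lerBrDl addrN. Qed.
Lemma right_end_le i : right_end R i <= 1.
Proof. by rewrite /right_end lern1 -ltnS. Qed.

Lemma sum_Omega (k : R -> R) : bm k ->
  \sum_(i < 2) \int[leb]_(x in Omega R i) k x = \int[leb]_(x in `]-1, 1[) k x.
Proof.
move=> bk; rewrite sum_ord2 /Omega left_end0 right_end0 left_end1 right_end1.
have h : (-1 : R) <= 0 by rewrite lerN10.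
by rewrite !(Rintegral_itv_closed false true _ _ bk) (Rintegral_itv_cat bk h ler01).
Qed.

Definition weight (m : 'I_2 -> medium R) (x : R) : R :=
  porosity (m (if x < 0 then ord0 else ord_max)).

Lemma weight_bm m : bm (weight m).
Proof.
split.
  rewrite (_ : weight m = fun x => if x < 0 then porosity (m ord0) else porosity (m ord_max)).
    apply: measurable_fun_ifT; [|exact: measurable_cst|exact: measurable_cst].
    by apply: measurable_fun_ltr => //; exact: measurable_cst.
  by apply/funext => x; rewrite /weight; case: ifP.
exists 1 => x; rewrite /weight.
have /andP[p0 p1] := porosity_itv (m (if x < 0 then ord0 else ord_max)).
by rewrite ger0_norm ltW.
Qed.

Lemma weight_ge0 m x : 0 <= weight m x.
Proof. by have /andP[/ltW] := porosity_itv (m (if x < 0 then ord0 else ord_max)). Qed.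

Lemma weightE m i x : left_end R i < x < right_end R i -> weight m x = porosity (m i).
Proof.
move: i; apply: ord2P; rewrite ?left_end0 ?right_end0 ?left_end1 ?right_end1 /weight => /andP[h1 h2].
  by rewrite h2.
by rewrite ltNge (ltW h1).
Qed.

Lemma Omega_sub i x : Omega R i x -> -1 < x < 1.
Proof.
rewrite /Omega /= in_itv/= => /andP[h1 h2].
by rewrite (le_lt_trans (left_end_ge i) h1) (lt_le_trans h2 (right_end_le i)).
Qed.

Lemma sum_Omega_weight m (k : R -> R) : bm k ->
  \sum_(i < 2) \int[leb]_(x in Omega R i) (porosity (m i) * k x) =
  \int[leb]_(x in `]-1, 1[) (weight m x * k x).
Proof.
move=> bk; rewrite -sum_Omega; last by apply: bmM => //; exact: weight_bm.
apply: eq_bigr => i _; apply: eq_Rintegral => x; rewrite inE /Omega /= in_itv/= => xi.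
by rewrite (weightE m xi).
Qed.

End two_subdomains.

Section balance.
Context (R : realType).
Local Notation leb := (@lebesgue_measure R).
Variables (sg ka : R -> R) (sk : smooth_step sg ka).
Variables (m : 'I_2 -> medium R) (T : R) (u0 : R -> R) (u : R * R -> R) (g : 'I_2 -> R * R -> R).
Hypothesis T0 : 0 < T.
Hypothesis u0L : Lp_on leb +oo%E `]-1, 1[ u0.
Hypothesis uL : Lp_on (@lebesgue2 R) +oo%E (`]-1, 1[ `*` `]0, T[) u.
Hypothesis gL : forall i, Lp_on (@lebesgue2 R) 2%:E (Omega R i `*` `]0, T[) (g i).
Hypothesis weak : forall psi : R * R -> R,
  @test_function R (R * R)%type (`[-1, 1] `*` `[0, T[) psi -> weak_formulation m T u0 u g psi.
Variables (a f : R * R -> R) (a0 : R -> R) (A : R -> R -> R).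
Hypotheses (ba : bm a) (bf : bm f) (ba0 : bm a0).
Hypothesis fout : forall x t, t < 0 \/ T < t -> f (x, t) = 0.
Hypothesis u0E : {ae leb, forall x, -1 < x < 1 -> u0 x = a0 x}.
Hypothesis uE : {ae leb, forall t, t \in `]0, T[ -> {ae leb, forall x, -1 < x < 1 -> u (x, t) = a (x, t)}}.
Hypothesis aA : {ae leb, forall t, t \in `]0, T[ -> {ae leb, forall x, -1 < x < 1 -> a (x, t) = A t x}}.
Hypothesis gE : forall i, {ae leb, forall t, t \in `]0, T[ -> forall psi : R -> R,
  test_function (Omega R i) psi ->
  \int[leb]_(x in Omega R i) (g i (x, t) * psi x) = \int[leb]_(x in Omega R i) (f (x, t) * psi x)}.
Hypothesis bA : forall t, 0 <= t <= T -> bm (A t).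
Hypothesis cA : forall k : R -> R, bm k ->
    {within `[0, T], continuous (fun t => \int[leb]_(x in `]-1, 1[) (A t x * k x))}.

(** No support condition in space is imposed by the domain of test functions,
    which contains the ends of the space interval. *)
Lemma time_step_test (n k : nat) (y t0 : R) : 0 < t0 -> t0 + k.+1%:R^-1 < T ->
  @test_function R (R * R)%type (`[-1, 1] `*` `[0, T[)
    (fun p => stepn sg n y p.1 * (1 - stepn sg k t0 p.2)).
Proof.
move=> t00 tT; split.
  move=> c; apply: (class_C_tensor (X := stepn sg n y) (Z := fun t => 1 - stepn sg k t0 t)).
    exact: (stepn_class_C sk).
  rewrite (_ : (fun t => _) = (fun t => 1 + (-1) * stepn sg k t0 t)).
    apply: class_C_add; first exact: class_C_cst.
    by apply: class_C_mul; [exact: class_C_cst|exact: (stepn_class_C sk)].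
  by apply/funext => t; rewrite mulN1r.
exists (`[-1, 1]%classic `*` `[0, t0 + k.+1%:R^-1]%classic); split.
- by apply: compact_setX; exact: segment_compact.
- move=> [x t] /= [xi]; rewrite !in_itv/= => /andP[h1 h2]; split => //.
  by rewrite h1 (le_lt_trans h2 tT).
- move=> [x t] /= [xi]; rewrite !in_itv/= => /andP[h1 h2] nz; split => //.
  rewrite h1/= leNgt; apply/negP => h3; move/eqP: nz; apply.
  by rewrite (stepn_right sk (ltW h3)) subrr mulr0.
Qed.

Lemma test_functionZ (D : set R) (psi : R -> R) (c : R) : test_function D psi ->
  test_function D (fun x => psi x * c).
Proof.
move=> [sm [K [cK KD nz]]]; split; first by move=> k; apply: class_C_mul => //; exact: class_C_cst.
by exists K; split => // x Dx h; apply: nz => //; apply: contra_neq h => ->; rewrite mul0r.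
Qed.

Lemma measurable_section_sum (G : 'I_2 -> R * R -> R) : (forall i, measurable_fun setT (G i)) ->
  measurable_fun setT (fun t => \sum_(i < 2) \int[leb]_(x in Omega R i) G i (x, t)).
Proof.
move=> mG; apply: measurable_sum => i.
apply: (measurable_Rintegral_param (F := fun q => G i (q.2, q.1))); first exact: measurable_itv.
apply: (measurableT_comp (mG i)); exact: measurable_fun_pair.
Qed.

Lemma measurable_section (G : R * R -> R) t : measurable_fun setT G ->
  measurable_fun setT (fun x => G (x, t)).
Proof. by move=> mG; apply: (measurableT_comp mG); exact: measurable_pair2. Qed.

Let ae_Omega (i : 'I_2) (F G : R -> R) : measurable_fun setT F -> measurable_fun setT G ->
  {ae leb, forall x, -1 < x < 1 -> F x = G x} ->
  \int[leb]_(x in Omega R i) F x = \int[leb]_(x in Omega R i) G x.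
Proof.
move=> mF mG FG; have mO : measurable (Omega R i : set (measurableTypeR R)) by exact: measurable_itv.
apply: ae_eq_Rintegral => //; [exact: (measurable_funS measurableT)|exact: (measurable_funS measurableT)|].
by apply: ae1 FG _ => x h /Omega_sub /h.
Qed.

Section step_in_time.
Variables (n k : nat) (y t0 : R).
Hypotheses (t00 : 0 < t0) (t0T : t0 + k.+1%:R^-1 < T).
Hypothesis adm : forall i, (forall x, Omega R i x -> kernn ka n y x = 0) \/
  test_function (Omega R i) (kernn ka n y).

Let X := stepn sg n y.
Let X' := kernn ka n y.
Let Z t := 1 - stepn sg k t0 t.
Let psi (p : R * R) := X p.1 * Z p.2.

Let bX : bm X. Proof. exact: (stepn_bm sk). Qed.
Let bX' : bm X'. Proof. exact: (kernn_bm sk). Qed.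
Let bZ : bm Z. Proof. by apply: bmB; [exact: bm_cst|exact: (stepn_bm sk)]. Qed.
Let bw : bm (weight m). Proof. exact: weight_bm. Qed.

Let psi_t x t : 'D_(0, 1) psi (x, t) = X x * - kernn ka k t0 t.
Proof.
apply: derive_tensor2; rewrite -[- _]sub0r; have h := stepn_derive sk k t0 t.
exact: is_deriveB.
Qed.

Let psi_x x t : 'D_(1, 0) psi (x, t) = X' x * Z t.
Proof. by apply: derive_tensor1; exact: stepn_derive sk n y x. Qed.

Let storage : \int[leb]_(t in `]0, T[) (\sum_(i < 2) \int[leb]_(x in Omega R i)
        (porosity (m i) * u (x, t) * 'D_(0, 1) psi (x, t))) =
  - \int[leb]_(t in `]0, T[) (kernn ka k t0 t * \int[leb]_(x in `]-1, 1[) (weight m x * (a (x, t) * X x))).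
Proof.
pose ud := u \_ (`]-1, 1[ `*` `]0, T[).
have mud : measurable_fun setT ud := Lp_on_measurable uL.
have bk : bm (kernn ka k t0) by exact: (kernn_bm sk).
have mfst : measurable_fun setT (fun p : R * R => X p.1).
  by apply: (measurableT_comp bX.1); exact: measurable_fst.
have msnd : measurable_fun setT (fun p : R * R => - kernn ka k t0 p.2).
  by apply: (measurableT_comp (bmN bk).1); exact: measurable_snd.
have bU : bm (fun t => \int[leb]_(x in `]-1, 1[) (weight m x * (a (x, t) * X x))).
  apply: (bm_param (F := fun q => weight m q.2 * (a (q.2, q.1) * X q.2))) => //.
    exact: leb_itv_lty.
  have b2 (h : R -> R) : bm h -> bm (fun q : R * R => h q.2).
    by move=> bh; apply: (bm_comp (h := snd) _ bh); exact: measurable_snd.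
  by apply: bmM; [exact: b2|apply: bmM; [exact: bm_swap_args|exact: b2]].
have bkU : bm (fun t => kernn ka k t0 t * \int[leb]_(x in `]-1, 1[) (weight m x * (a (x, t) * X x))).
  exact: bmM.
transitivity (\int[leb]_(t in `]0, T[) (\sum_(i < 2) \int[leb]_(x in Omega R i)
        (porosity (m i) * (ud (x, t) * (X x * - kernn ka k t0 t))))).
  apply: eq_Rintegral => t; rewrite inE/= => tJ; apply: eq_bigr => i _.
  apply: eq_Rintegral => x; rewrite inE => /Omega_sub xi.
  by rewrite psi_t /ud patchE mem_set ?mulrA//; split => //=; rewrite in_itv.
rewrite -itvN//; apply: ae_eq_Rintegral.
- exact: measurable_itv.
- apply: (measurable_funS measurableT) => //.
  apply: (measurable_section_sum (G := fun i p => porosity (m i) * (ud p * (X p.1 * - kernn ka k t0 p.2)))) => i.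
  apply: measurable_funM; first exact: measurable_cst.
  by apply: measurable_funM => //; exact: measurable_funM.
- by apply: (measurable_funS measurableT) => //; exact: (bmN bkU).1.
apply: ae1 uE _ => t h tJ; have {}h := h tJ.
have bat := bm_section2 t ba.
have baX : bm (fun x => a (x, t) * X x) by exact: bmM.
transitivity (\sum_(i < 2) \int[leb]_(x in Omega R i)
    (porosity (m i) * (a (x, t) * X x * - kernn ka k t0 t))).
  apply: eq_bigr => i _; apply: ae_Omega.
  - apply: measurable_funM; first exact: measurable_cst.
    apply: measurable_funM; first exact: measurable_section.
    by apply: measurable_funM; [exact: bX.1|exact: measurable_cst].
  - by apply: (bmM (bm_cst _ _) _).1; apply: bmM => //; exact: bm_cst.
  - apply: ae1 h _ => x hx x1.
    have dom : (`]-1, 1[ `*` `]0, T[)%classic (x, t) by split => //=; rewrite in_itv.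
    by rewrite -[a (x, t) * X x * _]mulrA /ud patchE (mem_set dom) hx.
rewrite sum_Omega_weight; last by apply: bmM => //; exact: bm_cst.
transitivity ((\int[leb]_(x in `]-1, 1[) (weight m x * (a (x, t) * X x))) * - kernn ka k t0 t);
  last by rewrite mulrN mulrC.
rewrite -itvZr; last exact: bmM.
by apply: eq_Rintegral => x _; ring.
Qed.

Let initial : \sum_(i < 2) \int[leb]_(x in Omega R i) (porosity (m i) * u0 x * psi (x, 0)) =
  \int[leb]_(x in `]-1, 1[) (weight m x * (a0 x * X x)).
Proof.
rewrite -sum_Omega_weight; last exact: bmM.
apply: eq_bigr => i _.
pose ud := u0 \_ `]-1, 1[.
transitivity (\int[leb]_(x in Omega R i) (porosity (m i) * (ud x * X x))).
  apply: eq_Rintegral => x; rewrite inE => /Omega_sub xi.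
  rewrite /psi /Z /= (stepn_left sk _ (ltW t00)) subr0 mulr1 -mulrA /ud patchE mem_set//=.
apply: ae_Omega.
- apply: measurable_funM; first exact: measurable_cst.
  by apply: measurable_funM; [exact: Lp_on_measurable u0L|exact: bX.1].
- by apply: (bmM (bm_cst _ _) _).1; exact: bmM.
- by apply: ae1 u0E _ => x h x1; rewrite /ud patchE mem_set ?h//= in_itv.
Qed.

Let transport : \int[leb]_(t in `]0, T[) (\sum_(i < 2) \int[leb]_(x in Omega R i)
        (g i (x, t) * 'D_(1, 0) psi (x, t))) =
  \int[leb]_(t in `]0, T[) (Z t * \int[leb]_(x in `]-1, 1[) (f (x, t) * X' x)).
Proof.
pose gd i := g i \_ (Omega R i `*` `]0, T[).
have mgd i : measurable_fun setT (gd i) := Lp_on_measurable (gL i).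
have mfst : measurable_fun setT (fun p : R * R => X' p.1).
  by apply: (measurableT_comp bX'.1); exact: measurable_fst.
have msnd : measurable_fun setT (fun p : R * R => Z p.2).
  by apply: (measurableT_comp bZ.1); exact: measurable_snd.
have bV : bm (fun t => \int[leb]_(x in `]-1, 1[) (f (x, t) * X' x)).
  apply: (bm_param (F := fun q => f (q.2, q.1) * X' q.2)) => //; first exact: leb_itv_lty.
  apply: bmM; first exact: bm_swap_args.
  by apply: (bm_comp (h := snd) _ bX'); exact: measurable_snd.
transitivity (\int[leb]_(t in `]0, T[) (\sum_(i < 2) \int[leb]_(x in Omega R i)
        (gd i (x, t) * (X' x * Z t)))).
  apply: eq_Rintegral => t; rewrite inE/= => tJ; apply: eq_bigr => i _.
  apply: eq_Rintegral => x; rewrite inE => xi.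
  by rewrite psi_x /gd patchE mem_set.
apply: ae_eq_Rintegral.
- exact: measurable_itv.
- apply: (measurable_funS measurableT) => //.
  apply: (measurable_section_sum (G := fun i p => gd i p * (X' p.1 * Z p.2))) => i.
  by apply: measurable_funM => //; exact: measurable_funM.
- by apply: (measurable_funS measurableT) => //; exact: (bmM bZ bV).1.
apply: ae2 (gE ord0) (gE ord_max) _ => t h0 h1 tJ.
have {h0 h1} h : forall i, forall psi : R -> R, test_function (Omega R i) psi ->
  \int[leb]_(x in Omega R i) (g i (x, t) * psi x) = \int[leb]_(x in Omega R i) (f (x, t) * psi x).
  by apply: ord2P; [exact: h0|exact: h1].
have bft := bm_section2 t bf.
transitivity ((\int[leb]_(x in `]-1, 1[) (f (x, t) * X' x)) * Z t); last by rewrite mulrC.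
rewrite -itvZr; last exact: bmM.
rewrite -sum_Omega; last by apply: bmM; [exact: bmM|exact: bm_cst].
apply: eq_bigr => i _.
transitivity (\int[leb]_(x in Omega R i) (g i (x, t) * (X' x * Z t))).
  by apply: eq_Rintegral => x; rewrite inE => xi; rewrite /gd patchE mem_set.
have [zero|test] := adm i.
  rewrite (eq_Rintegral _ _ (g := fun=> 0)); last first.
    by move=> x; rewrite inE => xi; rewrite /X' zero// mul0r mulr0.
  by apply: eq_Rintegral => x; rewrite inE => xi; rewrite /X' zero// mulr0 mul0r.
rewrite (h i _ (test_functionZ (Z t) test)).
by apply: eq_Rintegral => x _; rewrite mulrA.
Qed.

Let combine (s i tr s' i' tr' : R) : s = - s' -> i = i' -> tr = tr' -> s + i - tr = 0 ->
  s' = i' - tr'.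
Proof. by move=> -> -> ->; lra. Qed.

(** The three terms of the weak formulation, with the saturation, the initial
    datum and the flux replaced by their bounded representatives. *)
Lemma weak_expanded :
  \int[leb]_(t in `]0, T[) (kernn ka k t0 t * \int[leb]_(x in `]-1, 1[) (weight m x * (a (x, t) * stepn sg n y x))) =
  \int[leb]_(x in `]-1, 1[) (weight m x * (a0 x * stepn sg n y x)) -
  \int[leb]_(t in `]0, T[) ((1 - stepn sg k t0 t) * \int[leb]_(x in `]-1, 1[) (f (x, t) * kernn ka n y x)).
Proof.
exact: (combine storage initial transport (weak (time_step_test n y t00 t0T))).
Qed.

End step_in_time.

Let balance_combine (s i z q : R) : s = i - z -> z = q -> s + q = i.
Proof. by move=> -> ->; lra. Qed.

Lemma parts_from_start (Z Z' Q V : R -> R) : bprim Z Z' -> bprim Q V -> Z T = 0 -> Q 0 = 0 ->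
  \int[leb]_(t in `]0, T[) (Z t * V t) = - \int[leb]_(t in `]0, T[) (Z' t * Q t).
Proof.
move=> pZ pQ ZT Q0; have [bZ bZ' _] := pZ; have [bQ bV _] := pQ.
have [bZQ bd E] := bprimM pZ pQ; have := E 0 T (ltW T0).
rewrite ZT Q0 mul0r mulr0 subrr -(Rintegral_itv_closed false true _ _ bd) itvD; [|exact: bmM|exact: bmM].
by move=> /esym/eqP; rewrite addrC addr_eq0 => /eqP.
Qed.

(** The kernels concentrate on the right of [t0], where [Psi] is continuous;
    this reaches every time, not only almost every time. *)
Lemma kernel_limit (Phi Psi : R -> R) (t0 I0 : R) : 0 < t0 < T -> bm Phi ->
  {within `[0, T], continuous Psi} ->
  {ae leb, forall t, t \in `]0, T[ -> Phi t = Psi t} ->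
  (forall k : nat, t0 + k.+1%:R^-1 < T -> \int[leb]_(t in `]0, T[) (kernn ka k t0 t * Phi t) = I0) ->
  Psi t0 = I0.
Proof.
move=> /andP[t00 t0T] bPhi cPsi PP lim; apply/eqP; rewrite -subr_eq0 -normr_le0.
apply/ler_addgt0Pr => e e0; rewrite add0r.
have t0J : 0 <= t0 <= T by rewrite !ltW.
have [dl dl0 near] := within_near cPsi t0J e0.
have [k kd] : exists k : nat, k.+1%:R^-1 < Order.min dl (T - t0).
  have m0 : 0 < Order.min dl (T - t0) by rewrite lt_min dl0 subr_gt0.
  have : n.+1%:R^-1 @[n --> \oo] --> (0 : R) by exact: cvg_harmonic.
  move=> /cvgrPdist_lt /(_ _ m0) [N _ /(_ N (leqnn N))].
  by rewrite /= sub0r normrN ger0_norm//; exists N.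
move: kd; rewrite lt_min => /andP[kdl kT].
have kT' : t0 + k.+1%:R^-1 < T by rewrite -ltrBrDl.
have bk : bm (kernn ka k t0) by exact: (kernn_bm sk).
have mass := kernn_int_itv sk (ltW t00) (ltW kT').
rewrite -(lim k kT') -[Psi t0]mulr1 -mass -itvZl// -itvB; [|by apply: bmM => //; exact: bm_cst|exact: bmM].
have bd : bm (fun t => Psi t0 * kernn ka k t0 t - kernn ka k t0 t * Phi t).
  by apply: bmB; [apply: bmM => //; exact: bm_cst|exact: bmM].
apply: (le_trans (itv_norm _ _ _ _ bd)).
rewrite -[leRHS]mulr1 -mass -itvZl//.
apply: itv_ae_le; [exact: bm_norm|by apply: bmM => //; exact: bm_cst|].
apply: ae1 PP _ => t h /= tJ; rewrite h//.
rewrite [Psi t0 * _]mulrC -mulrBr normrM (ger0_norm (kernn_ge0 sk k t0 t)) mulrC.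
have [tl|tl] := leP t t0; first by rewrite (kernn_out sk (or_introl tl)) !mulr0.
have [tr|tr] := leP (t0 + k.+1%:R^-1) t; first by rewrite (kernn_out sk (or_intror tr)) !mulr0.
rewrite ler_wpM2r ?(kernn_ge0 sk)// distrC near//.
  by move: tJ; rewrite in_itv/= => /andP[? ?]; rewrite !ltW.
by rewrite gtr0_norm ?subr_gt0// ltrBlDl (lt_trans tr)// ltrD2l.
Qed.

(** The weak formulation is tested with a step in space times [1 - stepn k
    t0]. Integrating by parts in time, the accumulated flux joins the stored
    mass under the same averaging kernel, and [k] tends to infinity. The
    hypothesis on the kernel in space says that it is an admissible test
    function in the only subdomain that it meets; then the flux of the weak
    formulation can be replaced by the bounded one. *)
Lemma balance (n : nat) (y t0 : R) : 0 < t0 < T ->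
  (forall i, (forall x, Omega R i x -> kernn ka n y x = 0) \/
     test_function (Omega R i) (kernn ka n y)) ->
  \int[leb]_(x in `]-1, 1[) (A t0 x * (weight m x * stepn sg n y x)) +
    \int[leb]_(x in `[-1, 1]) (cumul f (x, t0) * kernn ka n y x) =
  \int[leb]_(x in `]-1, 1[) (weight m x * (a0 x * stepn sg n y x)).
Proof.
move=> t0T adm; have bw := weight_bm m.
have bX : bm (stepn sg n y) by exact: (stepn_bm sk).
have bX' : bm (kernn ka n y) by exact: (kernn_bm sk).
have b2 (h : R -> R) : bm h -> bm (fun q : R * R => h q.2).
  by move=> bh; apply: (bm_comp (h := snd) _ bh); exact: measurable_snd.
have bU : bm (fun t => \int[leb]_(x in `]-1, 1[) (weight m x * (a (x, t) * stepn sg n y x))).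
  apply: (bm_param (F := fun q => weight m q.2 * (a (q.2, q.1) * stepn sg n y q.2))) => //.
    exact: leb_itv_lty.
  by apply: bmM; [exact: b2|apply: bmM; [exact: bm_swap_args|exact: b2]].
pose fX (p : R * R) := f p * kernn ka n y p.1.
have bfX : bm fX.
  by apply: bmM => //; apply: (bm_comp (h := fst) _ bX'); exact: measurable_fst.
have fXout x t : t < 0 \/ T < t -> fX (x, t) = 0 by move=> /fout h; rewrite /fX h mul0r.
have cumulX x t : cumul fX (x, t) = cumul f (x, t) * kernn ka n y x.
  by rewrite /cumul /= -itvZr//; exact: bm_section1.
pose Q t := \int[leb]_(x in `[-1, 1]) (cumul f (x, t) * kernn ka n y x).
pose V t := \int[leb]_(x in `[-1, 1]) (f (x, t) * kernn ka n y x).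
have pQ : bprim Q V.
  have := bprim_param (-1) 1 bfX fXout; apply: eq_bprim => // t.
  by apply: eq_Rintegral => x _; exact: cumulX.
have [bQ bV _] := pQ.
have Q0 : Q 0 = 0.
  rewrite /Q (eq_Rintegral _ _ (g := fun=> 0)) ?Rintegral_cst ?mul0r// => x _.
  by rewrite /cumul /= set_itv1 Rintegral_set1 mul0r.
pose U' t := \int[leb]_(x in `]-1, 1[) (A t x * (weight m x * stepn sg n y x)).
have cU' : {within `[0, T], continuous U'} by apply: cA; exact: bmM.
apply: (@kernel_limit (fun t => \int[leb]_(x in `]-1, 1[) (weight m x * (a (x, t) * stepn sg n y x)) + Q t)
   (fun t => U' t + Q t) t0) => //.
- exact: bmD.
- apply/subspace_continuousP => x xJ; apply: cvgD.
    by move/subspace_continuousP : cU'; exact.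
  by move/continuous_subspaceT : (bprim_continuous pQ) => /(_ `[0, T]%classic)/subspace_continuousP; exact.
- apply: ae1 aA _ => t h tJ; congr (_ + _).
  have tJ' : 0 <= t <= T by move: tJ; rewrite in_itv/= => /andP[? ?]; rewrite !ltW.
  have bat := bm_section2 t ba; have bAt := bA tJ'.
  apply: itv_ae_eq; [by apply: bmM => //; exact: bmM|by apply: bmM => //; exact: bmM|].
  apply: ae1 (h tJ) _ => x hx /=; rewrite in_itv/= => x1.
  by rewrite hx//; ring.
move=> k kT; have /andP[t00 _] := t0T.
have bk : bm (kernn ka k t0) by exact: (kernn_bm sk).
have W := weak_expanded t00 kT adm.
have pZ : bprim (fun t => 1 - stepn sg k t0 t) (fun t => 0 - kernn ka k t0 t).
  by apply: bprimB; [exact: bprim_cst|exact: (stepn_bprim sk)].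
have [bZ bZ' _] := pZ.
have parts : \int[leb]_(t in `]0, T[) ((1 - stepn sg k t0 t) * \int[leb]_(x in `]-1, 1[) (f (x, t) * kernn ka n y x)) =
    \int[leb]_(t in `]0, T[) (kernn ka k t0 t * Q t).
  transitivity (\int[leb]_(t in `]0, T[) ((1 - stepn sg k t0 t) * V t)).
    apply: eq_Rintegral => t _; congr (_ * _); rewrite /V (Rintegral_itv_closed false true)//.
    by apply: bmM => //; exact: bm_section2.
  transitivity (- \int[leb]_(t in `]0, T[) ((0 - kernn ka k t0 t) * Q t)).
    apply: (parts_from_start pZ pQ _ Q0).
    by rewrite (stepn_right sk (ltW kT)) subrr.
  rewrite -itvN; last exact: bmM.
  by apply: eq_Rintegral => t _; rewrite sub0r mulNr opprK.
transitivity (\int[leb]_(t in `]0, T[) (kernn ka k t0 t *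
     \int[leb]_(x in `]-1, 1[) (weight m x * (a (x, t) * stepn sg n y x))) +
   \int[leb]_(t in `]0, T[) (kernn ka k t0 t * Q t)).
  rewrite -itvD; [|exact: bmM|exact: bmM].
  by apply: eq_Rintegral => t _; rewrite mulrDr.
exact: balance_combine W parts.
Qed.

End balance.

(** * Reduction of weak solutions *)

Section pieces.
Context (R : realType).
Local Notation leb := (@lebesgue_measure R).

Lemma saturation_bounded d (X : measurableType d) (mu : {measure set X -> \bar R})
  (D : set X) (f : X -> R) : saturation mu D f ->
  exists k : X -> R, [/\ bm k, forall x, 0 <= k x <= 1, forall x, ~ D x -> k x = 0 &
    {ae mu, forall x, D x -> f x = k x}].
Proof.
move=> [fL f01]; have [k [bk k0 fk]] := Lp_on_bounded fL.
exists (fun x => Order.min (Order.max (k x) 0) 1); split.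
- split; last first.
    exists 1 => x; rewrite ger0_norm ?ge_min ?lexx ?orbT//.
    by rewrite le_min ler01 andbT le_max lexx orbT.
  apply: measurable_minr; last exact: measurable_cst.
  by apply: measurable_maxr; [exact: bk.1|exact: measurable_cst].
- by move=> x; rewrite le_min ler01 andbT le_max lexx orbT ge_min lexx orbT.
- by move=> x /k0 ->; rewrite maxxx min_l.
- apply: filterS2 fk f01 => x h h01 Dx; rewrite -h//.
  by have /andP[f0 f1] := h01 Dx; rewrite max_l// min_l.
Qed.

Lemma ae_neq (c : R) : {ae leb, forall x, x != c}.
Proof.
exists [set c]; split; [exact: measurable_set1|exact: lebesgue_measure_set1|].
by move=> x /= /negP; rewrite negbK => /eqP.
Qed.

Lemma ae_section_itv (l r T : R) (P : R * R -> Prop) :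
  {ae @lebesgue2 R, forall p, (`]l, r[ `*` `]0, T[)%classic p -> P p} ->
  {ae leb, forall t, t \in `]0, T[ -> {ae leb, forall x, l < x < r -> P (x, t)}}.
Proof.
move=> /ae_section h; apply: ae1 h _ => t h tJ; apply: ae1 h _ => x h lxr.
by apply: h; split => //=; rewrite in_itv.
Qed.

Variables (sg ka : R -> R) (sk : smooth_step sg ka).

(** The constant of integration is fixed by the mean value over the subdomain,
    which depends measurably on time. *)
Lemma potential_exists (l r : R) (ph : R -> R) (a f : R * R -> R) :
  -1 <= l -> l < r -> r <= 1 -> continuous ph -> bm a -> bm f ->
  exists z : R * R -> R, [/\ bm z,
    forall t, bprim (fun x => z (x, t)) (fun x => f (x, t) * \1_(`]l, r[%classic) x) &
    forall t, (forall psi : R -> R, test_function `]l, r[ psi ->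
        \int[leb]_(x in `]l, r[) (ph (a (x, t)) * derive1 psi x) =
        - \int[leb]_(x in `]l, r[) (f (x, t) * psi x)) ->
      {ae leb, forall x, l < x < r -> ph (a (x, t)) = z (x, t)}].
Proof.
move=> l1 lr r1 cph ba bf.
pose F (q : R * R) := f (q.2, q.1) * \1_(`]l, r[%classic) q.2.
have bF : bm F.
  apply: bmM; first exact: bm_swap_args.
  by apply: (bm_comp (h := snd)); [exact: measurable_snd|exact: bm_indic].
have Fout q : q.2 < -1 \/ 1 < q.2 -> F q = 0.
  move=> h; rewrite /F indicE memNset ?mulr0//= in_itv/= => /andP[h1 h2].
  by case: h => h3; lra.
pose W (p : R * R) := \int[leb]_(y in `[-1, p.1]) F (p.2, y).
have bW : bm W := bm_swap_args (bm_indefinite bF Fout).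
have pW t : bprim (fun x => W (x, t)) (fun x => f (x, t) * \1_(`]l, r[%classic) x).
  apply: (@bprim_indefinite R (-1) 1 (fun y => F (t, y))); first exact: bm_section1 bF.
  by move=> y; exact: (Fout (t, y)).
pose K (p : R * R) := ph (a p) - W p.
have bK : bm K by apply: bmB => //; exact: bm_continuous_comp.
pose c t := (\int[leb]_(y in `]l, r[) K (y, t)) / (r - l).
have bc : bm c.
  apply: bmM; last exact: bm_cst.
  apply: (bm_param (F := fun q => K (q.2, q.1))) => //; first exact: leb_itv_lty.
  exact: bm_swap_args.
exists (fun p => W p + c p.2); split.
- by apply: bmD => //; apply: (bm_comp (h := snd) _ bc); exact: measurable_snd.
- by move=> t; apply: eq_bprim (bprimD (pW t) (bprim_cst (c t))) => // x; rewrite addr0.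
move=> t weak; have bpa : bm (fun x => ph (a (x, t))).
  by apply: bm_continuous_comp => //; exact: bm_section2.
apply: (weak_derivative_primitive sk lr bpa (pW t)) => psi tpsi.
rewrite weak//; congr (- _); apply: eq_Rintegral => x xlr.
by rewrite indicE xlr mulr1.
Qed.

(** The transformed saturation agrees almost everywhere with [z], and also
    with [z] truncated to the range of [ph]; by uniqueness of traces the value
    of [z] lies in this range. *)
Lemma trace_value (mi : medium R) (l r x0 : R) (ph F al z fz : R -> R) (c : R) : l < r -> l <= x0 <= r ->
  continuous ph -> {homo ph : x y / x <= y} -> {in `[0, 1] &, {homo ph : x y / x < y}} ->
  {in `[0, 1], varphi mi =1 ph} -> (forall x, 0 <= al x <= 1) ->
  {ae leb, forall x, l < x < r -> F x = ph (al x)} ->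
  {ae leb, forall x, l < x < r -> ph (al x) = z x} -> bprim z fz ->
  is_trace l r x0 F c ->
  [/\ 0 <= varphi_inv mi c <= 1 & ph (varphi_inv mi c) = z x0].
Proof.
move=> lr x0lr cph hph iph vph al01 Fal alz pz [fc [cfc fcF fcx0]].
have cz : {within `[l, r], continuous z} by apply: continuous_subspaceT; exact: bprim_continuous pz.
have cz0 : c = z x0.
  rewrite -fcx0; apply: (trace_unique lr x0lr cfc cz).
  have fcF' : {ae leb, forall x, l < x < r -> fc x = F x}.
    by apply: ae1 fcF _ => x h lxr; apply: h; rewrite in_itv.
  apply: ae2 fcF' (ae2 Fal alz (fun x h1 h2 => conj h1 h2)) _ => x h1 [h2 h3] lxr.
  by rewrite h1// h2// h3.
have zimg : ph 0 <= z x0 <= ph 1.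
  pose G x := Order.min (Order.max (z x) (ph 0)) (ph 1).
  have cG : {within `[l, r], continuous G}.
    apply: continuous_subspaceT => x; have cz' := bprim_continuous pz.
    apply: (@continuous_min _ _ (fun x => Order.max (z x) (ph 0)) (fun=> ph 1)); last exact: cvg_cst.
    apply: (@continuous_max _ _ z (fun=> ph 0)); [exact: cz'|exact: cvg_cst].
  have ph01 : ph 0 <= ph 1 by exact: hph.
  have -> : z x0 = G x0.
    apply: (trace_unique lr x0lr cz cG); apply: ae1 alz _ => x h lxr.
    have /andP[a0 a1] := al01 x.
    by rewrite /G -(h lxr) max_l ?hph// min_l ?hph.
  by rewrite le_min ph01 andbT le_max lexx orbT ge_min lexx orbT.
have [s s01 sE] : exists2 s, s \in `[0, 1] & ph s = c.
  apply: IVT => //; first by apply: continuous_subspaceT.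
  by rewrite cz0 min_l ?max_r ?hph.
have inj : {in `[0, 1]%classic &, injective (varphi mi)}.
  move=> x y; rewrite !inE /= => x01 y01; rewrite !vph// => e.
  have [xy|yx|//] := ltgtP x y.
    by have := iph _ _ x01 y01 xy; rewrite e ltxx.
  by have := iph _ _ y01 x01 yx; rewrite e ltxx.
have invE : varphi_inv mi c = s.
  by rewrite -sE -(vph _ s01) /varphi_inv pinvKV// inE.
by rewrite invE sE cz0; split => //; move: s01; rewrite in_itv.
Qed.

Lemma H1_flux_bounded (l r : R) (F g fl : R -> R) : H1_deriv l r F g -> bm fl ->
  {ae leb, forall x, l < x < r -> g x = fl x} -> forall psi : R -> R, test_function `]l, r[ psi ->
  \int[leb]_(x in `]l, r[) (g x * psi x) = \int[leb]_(x in `]l, r[) (fl x * psi x).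
Proof.
move=> [_ gL _] bfl gf psi tpsi; have [cpsi _] := test_function_continuous tpsi.
have mD : measurable (`]l, r[%classic : set (measurableTypeR R)) by exact: measurable_itv.
have mpsi : measurable_fun (`]l, r[%classic : set (measurableTypeR R)) psi.
  by apply: (measurable_funS measurableT) => //; exact: continuous_measurable_fun.
have mg := Lp_on_measurable_on mD gL.
have mfl : measurable_fun (`]l, r[%classic : set (measurableTypeR R)) fl.
  by apply: (measurable_funS measurableT) => //; exact: bfl.1.
apply: ae_eq_Rintegral => //; [exact: measurable_funM|exact: measurable_funM|].
by apply: ae1 gf _ => x h /=; rewrite in_itv/= => /h ->.
Qed.

(** A step starting far on the left is 1 on the whole domain, and gives the
    conservation of mass. Steps starting at [y] have averaging kernels at [y]
    as derivatives, so an integration by parts gives the identity at Lebesgue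
    points. *)
Lemma stored_mass (D d cu : R -> R) : bprim D d -> D (-1) = 0 -> bm cu ->
  (forall n y, (forall i, (forall x, Omega R i x -> kernn ka n y x = 0) \/
       test_function (Omega R i) (kernn ka n y)) ->
     \int[leb]_(x in `[-1, 1]) (d x * stepn sg n y x) =
     - \int[leb]_(x in `[-1, 1]) (cu x * kernn ka n y x)) ->
  D 1 = 0 /\ {ae leb, forall x, -1 <= x <= 1 -> D x = cu x}.
Proof.
move=> pD Dl bcu bal; have [bD bd ED] := pD.
have m11 : (-1 : R) <= 1 by lra.
have D1 : D 1 = 0.
  (* the step of width 1 starting at -3 ends at -2, outside the domain *)
  have far x : -1 <= x -> -3 + 1%:R^-1 <= x :> R by move=> h; rewrite invr1; lra.
  have k0 x : -1 <= x -> kernn ka 0 (-3) x = 0.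
    by move=> /far h; apply: (kernn_out sk); right.
  have I0 : \int[leb]_(x in `[-1, 1]) (cu x * kernn ka 0 (-3) x) = 0.
    rewrite (eq_Rintegral _ _ (g := fun=> 0)) ?Rintegral_cst ?mul0r//.
    by move=> x; rewrite inE/= in_itv/= => /andP[x1 _]; rewrite k0 ?mulr0.
  have I1 : \int[leb]_(x in `[-1, 1]) (d x * stepn sg 0 (-3) x) = \int[leb]_(x in `[-1, 1]) d x.
    apply: eq_Rintegral => x; rewrite inE/= in_itv/= => /andP[x1 _].
    by rewrite (stepn_right sk) ?mulr1//; exact: far.
  have := bal 0%N (-3); rewrite I0 I1 oppr0 -ED// Dl subr0; apply => i; left => x /Omega_sub/andP[x1 _].
  by rewrite k0// ltW.
split => //.
have bK : bm (fun x => D x - cu x) by exact: bmB.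
have har0 : n.+1%:R^-1 @[n --> \oo] --> (0 : R) by exact: cvg_harmonic.
apply: ae2 (bm_lebesgue_pt bK) (ae2 (ae_neq 0) (ae2 (ae_neq (-1)) (ae_neq 1)
  (fun x h1 h2 => conj h1 h2)) (fun x h1 h2 => conj h1 h2)) _ => y Ly [y0 [ym1 y1]] /andP[ly yr].
have {}ly : -1 < y by rewrite lt_neqAle eq_sym ym1.
have {}yr : y < 1 by rewrite lt_neqAle y1.
apply/eqP; rewrite -subr_eq0; apply/eqP.
have c1 := cvg_kernn sk bK Ly ly yr.
have c0 : \int[leb]_(x in `[-1, 1]) (kernn ka n y x * (D x - cu x)) @[n --> \oo] --> (0 : R).
  apply: (@cvg_trans _ ((fun=> 0) @ \oo)); last exact: cvg_cst.
  (* right end of the subdomain that contains [y] *)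
  pose re : R := if y < 0 then 0 else 1.
  have yre : y < re by rewrite /re; case: ifP.
  apply: near_eq_cvg; near=> n.
  have hn : y + n.+1%:R^-1 < re.
    rewrite -ltrBrDl; near: n; move/cvgrPdist_lt : har0 => /(_ (re - y)).
    rewrite subr_gt0 => /(_ yre); apply: filterS => n.
    by rewrite sub0r normrN ger0_norm.
  have adm : forall i, (forall x, Omega R i x -> kernn ka n y x = 0) \/
       test_function (Omega R i) (kernn ka n y).
    apply: ord2P; rewrite /Omega ?left_end0 ?right_end0 ?left_end1 ?right_end1.
      have [yn|yp] := ltP y 0; first by right; apply: (kernel_test sk) => //; rewrite /re yn in hn.
      left => x /=; rewrite in_itv/= => /andP[_ x0]; apply: (kernn_out sk); left.
      by rewrite (le_trans (ltW x0)).
    have [yn|yp] := ltP y 0.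
      left => x /=; rewrite in_itv/= => /andP[x0 _]; apply: (kernn_out sk); right.
      by rewrite /re yn in hn; rewrite (le_trans (ltW hn))// ltW.
    right; apply: (kernel_test sk); first by rewrite lt_neqAle eq_sym y0.
    by move: hn; rewrite /re (le_gtF yp).
  have bk : bm (kernn ka n y) by exact: (kernn_bm sk).
  have [bst _ _] := stepn_bprim sk n y.
  have := bal n y adm; rewrite (bprim_parts m11 pD (stepn_bprim sk n y) Dl D1).
  move=> /oppr_inj/eqP; rewrite -subr_eq0 -itvB; [|exact: bmM|exact: bmM].
  by move=> /eqP <-; apply: eq_Rintegral => x _; ring.
by rewrite -(cvg_lim (@norm_hausdorff _ _) c1) (cvg_lim (@norm_hausdorff _ _) c0).
Unshelve. all: end_near. Qed.

End pieces.

(** Data extracted from a weak solution, in both subdomains: [A t] is a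
    bounded representative of the saturation at each time, and [a] a jointly
    measurable representative for almost every time. *)
Record reduced (R : realType) (m : 'I_2 -> medium R) (ph : 'I_2 -> R -> R) (T : R) (u0 : R -> R)
    (uc : R -> R -> R) (a f : R * R -> R) (z : 'I_2 -> R * R -> R) (D : R * R -> R)
    (good : R -> Prop) (a0 : R -> R) (A : R -> R -> R) : Prop := Reduced {
  rd_side : forall i, side_sol T (left_end R i) (right_end R i) (weight m) (ph i) a f (z i) D good;
  rd_bm0 : bm a0;
  rd_itv0 : forall x, 0 <= a0 x <= 1;
  rd_D : forall t, bprim (fun x => D (x, t)) (fun x => weight m x * (a (x, t) - a0 x));
  rd_u0 : {ae @lebesgue_measure R, forall x, -1 < x < 1 -> u0 x = a0 x};
  rd_bmA : forall t, 0 <= t <= T -> bm (A t);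
  rd_cA : forall k : R -> R, bm k -> {within `[0, T], continuous
    (fun t => \int[@lebesgue_measure R]_(x in `]-1, 1[) (A t x * k x))};
  rd_aA : forall t, good t -> 0 < t < T ->
    {ae @lebesgue_measure R, forall x, -1 < x < 1 -> a (x, t) = A t x};
  rd_uc : forall t, 0 <= t <= T ->
    {ae @lebesgue_measure R, forall x, -1 < x < 1 -> uc t x = A t x};
  rd_graph : forall t, good t -> exists rho : 'I_2 -> R,
    (forall i, 0 <= rho i <= 1 /\ ph i (rho i) = z i (0, t)) /\
    (\bigcap_i capillary_graph (m i) (rho i)) !=set0 }.

Section extraction.
Context (R : realType).
Local Notation leb := (@lebesgue_measure R).
Variables (m : 'I_2 -> medium R) (T : R) (u0 : R -> R) (u : R * R -> R) (uc : R -> R -> R).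
Hypotheses (T0 : 0 < T) (u0_sat : saturation leb `]-1, 1[ u0) (u_sol : weak_solution m T u0 u)
  (u_flux : bounded_flux m T u) (uc_rep : weak_star_representative T u uc).
Variable ph : 'I_2 -> R -> R.
Hypothesis phP : forall i, [/\ continuous (ph i), {homo ph i : x y / x <= y},
  {in `[0, 1] &, {homo ph i : x y / x < y}}, ph i 0 = 0 & {in `[0, 1], varphi (m i) =1 ph i}].

(** Chosen independently at each time: no joint measurability is asserted. *)
Lemma representative_bounded : exists A : R -> R -> R,
  [/\ forall t, 0 <= t <= T -> bm (A t),
    forall t, 0 <= t <= T -> {ae leb, forall x, -1 < x < 1 -> uc t x = A t x} &
    forall k : R -> R, bm k -> {within `[0, T], continuous
      (fun t => \int[leb]_(x in `]-1, 1[) (A t x * k x))}].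
Proof.
have [ucL ucc _] := uc_rep.
have ex t : exists k : R -> R, 0 <= t <= T -> bm k /\ {ae leb, forall x, -1 < x < 1 -> uc t x = k x}.
  have [tJ|tJ] := boolP (0 <= t <= T); last by exists (fun=> 0).
  have tJ' : t \in `[0, T] by rewrite in_itv.
  have [k [bk _ kE]] := Lp_on_bounded (ucL t tJ'); by exists k => _; split.
have [A HA] := choice ex; exists A; split; [by move=> t /HA[]|by move=> t /HA[]|].
move=> k bk; have cU := ucc k (bm_Lp_on1 bk).
have E t : `[0, T]%classic t -> \int[leb]_(x in `]-1, 1[) (uc t x * k x) =
    \int[leb]_(x in `]-1, 1[) (A t x * k x).
  rewrite /= in_itv/= => tJ; have [bAt ucA] := HA t tJ.
  have mD : measurable (`]-1, 1[%classic : set (measurableTypeR R)) by exact: measurable_itv.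
  have mk : measurable_fun (`]-1, 1[%classic : set (measurableTypeR R)) k.
    by apply: (measurable_funS measurableT) => //; exact: bk.1.
  have tJ' : t \in `[0, T] by rewrite in_itv.
  apply: ae_eq_Rintegral => //.
  - by apply: measurable_funM => //; exact: Lp_on_measurable_on (ucL t tJ').
  - apply: measurable_funM => //.
    by apply: (measurable_funS measurableT) => //; exact: bAt.1.
  - by apply: ae1 ucA _ => x h /=; rewrite in_itv/= => /h ->.
by apply: subspace_eq_continuous cU => t; rewrite inE; exact: E.
Qed.

(** The flux functions are extended by 0, so that their sum over the two
    subdomains represents the flux in the whole domain. *)
Lemma flux_bounded : exists gb : 'I_2 -> R * R -> R, exists fi : 'I_2 -> R * R -> R,
  forall i, [/\ flux_deriv m T u i (gb i), bm (fi i),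
    forall p, ~ (Omega R i `*` `]0, T[)%classic p -> fi i p = 0 &
    {ae @lebesgue2 R, forall p, (Omega R i `*` `]0, T[)%classic p -> gb i p = fi i p}].
Proof.
have ex i : exists q : (R * R -> R) * (R * R -> R), [/\ flux_deriv m T u i q.1, bm q.2,
    forall p, ~ (Omega R i `*` `]0, T[)%classic p -> q.2 p = 0 &
    {ae @lebesgue2 R, forall p, (Omega R i `*` `]0, T[)%classic p -> q.1 p = q.2 p}].
  have [gb gbd gbL] := u_flux i; have [k [bk k0 kE]] := Lp_on_bounded gbL.
  by exists (gb, k).
have [q Hq] := choice ex.
by exists (fun i => (q i).1), (fun i => (q i).2).
Qed.

Let mass_combine (x y q : R) : x + q = y -> x - y = - q.
Proof. by move=> <-; rewrite opprD addrA subrr sub0r. Qed.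

(** The time [t] is good when the weak derivative, the trace condition and the
    identification of representatives all hold at [t]. *)
Lemma extraction : exists a f z D good a0 A, reduced m ph T u0 uc a f z D good a0 A.
Proof.
have [usat utrace [gw gwd gweak]] := u_sol.
have [sg [ka sk]] := smooth_step_exists R.
have [a [ba a01 aout aE]] := saturation_bounded usat.
have [a0 [ba0 a001 a0out a0E]] := saturation_bounded u0_sat.
have [A [bA ucA cA]] := representative_bounded.
have [gb [fi fiP]] := flux_bounded.
pose f p := fi ord0 p + fi ord_max p.
have bf : bm f by apply: bmD; [have [] := fiP ord0|have [] := fiP ord_max].
have fout x t : t < 0 \/ T < t -> f (x, t) = 0.
  move=> h; have out i : fi i (x, t) = 0.
    have [_ _ -> //] := fiP i; rewrite /= in_itv/= => -[_ /andP[h1 h2]].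
    by case: h => h3; [have := lt_trans h1 h3|have := lt_trans h2 h3]; rewrite ltxx.
  by rewrite /f !out addr0.
have fE i x t : Omega R i x -> f (x, t) = fi i (x, t).
  move: i; apply: ord2P; rewrite /Omega ?left_end0 ?right_end0 ?left_end1 ?right_end1 /= in_itv/= => /andP[h1 h2].
    rewrite /f [fi ord_max _](_ : _ = 0) ?addr0//; have [_ _ -> //] := fiP ord_max.
    rewrite /Omega left_end1 right_end1 /= !in_itv/= => -[/andP[h3 _] _].
    by have := lt_trans h2 h3; rewrite ltxx.
  rewrite /f [fi ord0 _](_ : _ = 0) ?add0r//; have [_ _ -> //] := fiP ord0.
  rewrite /Omega left_end0 right_end0 /= !in_itv/= => -[/andP[_ h3] _].
  by have := lt_trans h1 h3; rewrite ltxx.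
have cph i : continuous (ph i) by have [] := phP i.
have uT : {ae leb, forall t, t \in `]0, T[ -> {ae leb, forall x, -1 < x < 1 -> u (x, t) = a (x, t)}}.
  exact: (@ae_section_itv R (-1) 1 T (fun p => u p = a p) aE).
have aA : {ae leb, forall t, t \in `]0, T[ -> {ae leb, forall x, -1 < x < 1 -> a (x, t) = A t x}}.
  have [_ _ ucu] := uc_rep; apply: ae2 uT ucu _ => t h1 h2 tJ.
  have tJ' : 0 <= t <= T by move: tJ; rewrite in_itv/= => /andP[? ?]; rewrite !ltW.
  apply: ae2 (h1 tJ) (ae2 (h2 tJ) (ucA t tJ') (fun x h3 h4 => conj h3 h4)) _ => x h3 [h4 h5] x1.
  by rewrite -h3// -h5// h4// in_itv.
have varE i t : {ae leb, forall x, -1 < x < 1 -> u (x, t) = a (x, t)} ->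
    {ae leb, forall x, left_end R i < x < right_end R i -> varphi (m i) (u (x, t)) = ph i (a (x, t))}.
  have [_ _ _ _ vph] := phP i.
  move=> h; apply: ae1 h _ => x h lxr.
  by rewrite h ?vph ?in_itv//=; apply: (@Omega_sub R i); rewrite /Omega /= in_itv.
have fxE i t : {ae leb, forall x, left_end R i < x < right_end R i -> gb i (x, t) = fi i (x, t)} ->
    {ae leb, forall x, left_end R i < x < right_end R i -> gb i (x, t) = f (x, t)}.
  by move=> h; apply: ae1 h _ => x h lxr; rewrite (fE i) ?h// /Omega /= in_itv.
have gT i : {ae leb, forall t, t \in `]0, T[ ->
    {ae leb, forall x, left_end R i < x < right_end R i -> gb i (x, t) = fi i (x, t)}}.
  have [_ _ _ gfi] := fiP i.
  exact: (@ae_section_itv R _ _ T (fun p => gb i p = fi i p) gfi).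
have weakT i : {ae leb, forall t, t \in `]0, T[ -> forall psi : R -> R, test_function (Omega R i) psi ->
    \int[leb]_(x in Omega R i) (ph i (a (x, t)) * derive1 psi x) =
    - \int[leb]_(x in Omega R i) (f (x, t) * psi x)}.
  have [[_ _ gbH] _ _ _] := fiP i.
  apply: ae2 uT (ae2 (gT i) gbH (fun x h1 h2 => conj h1 h2)) _ => t h1 [h2 h3] tJ.
  apply: (H1_deriv_bounded (h3 tJ) _ _ (varE i t (h1 tJ)) (fxE i t (h2 tJ))).
    by apply: bm_continuous_comp => //; exact: bm_section2.
  exact: bm_section2.
have gE i : {ae leb, forall t, t \in `]0, T[ -> forall psi : R -> R, test_function (Omega R i) psi ->
    \int[leb]_(x in Omega R i) (gw i (x, t) * psi x) = \int[leb]_(x in Omega R i) (f (x, t) * psi x)}.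
  have [[_ _ gbH] _ _ _] := fiP i; have [_ _ gwH] := gwd i.
  apply: ae2 gwH (ae2 (gT i) gbH (fun x h1 h2 => conj h1 h2)) _ => t h1 [h2 h3] tJ psi tpsi.
  rewrite (H1_deriv_same (h1 tJ) (h3 tJ) tpsi).
  by apply: (H1_flux_bounded (h3 tJ) _ (fxE i t (h2 tJ)) tpsi); exact: bm_section2.
have [z zP] := choice (fun i => potential_exists sk (left_end_ge R i) (end_lt R i)
  (right_end_le R i) (cph i) ba bf).
have bw := weight_bm m.
have pD t := @bprim_indefinite R (-1) 1 (fun x => weight m x * (a (x, t) - a0 x))
  (bmM bw (bmB (bm_section2 t ba) ba0)).
pose D (p : R * R) := \int[leb]_(x in `[-1, p.1]) (weight m x * (a (x, p.2) - a0 x)).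
have {}pD t : bprim (fun x => D (x, t)) (fun x => weight m x * (a (x, t) - a0 x)).
  apply: pD => x h; rewrite (aout (x, t)) ?a0out ?subrr ?mulr0//=.
    by rewrite in_itv/= => /andP[h1 h2]; case: h => h3; [have := lt_trans h1 h3|have := lt_trans h2 h3]; rewrite ltxx.
  by rewrite !in_itv/= => -[/andP[h1 h2] _]; case: h => h3; [have := lt_trans h1 h3|have := lt_trans h2 h3]; rewrite ltxx.
have Dl t : D (-1, t) = 0 by rewrite /D /= set_itv1 Rintegral_set1.
pose good t := [/\ 0 < t < T, {ae leb, forall x, -1 < x < 1 -> a (x, t) = A t x},
  forall i psi, test_function (Omega R i) psi ->
    \int[leb]_(x in Omega R i) (ph i (a (x, t)) * derive1 psi x) =
    - \int[leb]_(x in Omega R i) (f (x, t) * psi x),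
  {ae leb, forall x, -1 < x < 1 -> u (x, t) = a (x, t)} &
  exists c : 'I_2 -> R,
        (forall i, is_trace (left_end R i) (right_end R i) 0
                     (fun x => varphi (m i) (u (x, t))) (c i)) /\
        (\bigcap_i capillary_graph (m i) (varphi_inv (m i) (c i))) !=set0].
have good_ae : {ae leb, forall t, t \in `]0, T[ -> good t}.
  apply: ae2 (ae2 aA uT (fun x h1 h2 => conj h1 h2)) (ae2 utrace (ae2 (weakT ord0) (weakT ord_max)
    (fun x h1 h2 => conj h1 h2)) (fun x h1 h2 => conj h1 h2)) _ => t [h1 h2] [h3 [h4 h5]] tJ.
  split; [by move: tJ; rewrite in_itv|exact: h1| |exact: h2|exact: h3].
  by apply: ord2P; [exact: h4|exact: h5].
have zE i t : good t -> {ae leb, forall x, left_end R i < x < right_end R i -> ph i (a (x, t)) = z i (x, t)}.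
  by move=> [_ _ h _ _]; have [_ _] := zP i; apply; exact: h.
have mass t : good t -> D (1, t) = 0 /\ {ae leb, forall x, -1 <= x <= 1 -> D (x, t) = cumul f (x, t)}.
  move=> [tJ aAt _ _ _].
  have tJ' : 0 <= t <= T by move: tJ => /andP[? ?]; rewrite !ltW.
  have bat := bm_section2 t ba; have bAt := bA t tJ'.
  apply: (stored_mass sk (pD t) (Dl t)) => [|n y adm].
    exact: bm_section2 (cumul_bm bf fout).
  have bX : bm (stepn sg n y) by exact: (stepn_bm sk).
  have gwL i : Lp_on (@lebesgue2 R) 2%:E (Omega R i `*` `]0, T[) (gw i) by have [] := gwd i.
  have E := balance sk T0 u0_sat.1 usat.1 gwL gweak ba bf ba0 fout a0E uT aA gE bA cA tJ adm.
  have bd : bm (fun x => weight m x * (a (x, t) - a0 x) * stepn sg n y x).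
    by apply: bmM => //; apply: bmM => //; exact: bmB.
  have b1 : bm (fun x => A t x * (weight m x * stepn sg n y x)) by apply: bmM => //; exact: bmM.
  have b2 : bm (fun x => weight m x * (a0 x * stepn sg n y x)) by apply: bmM => //; exact: bmM.
  rewrite -(Rintegral_itv_closed false true _ _ bd).
  transitivity (\int[leb]_(x in `]-1, 1[) (A t x * (weight m x * stepn sg n y x)) -
    \int[leb]_(x in `]-1, 1[) (weight m x * (a0 x * stepn sg n y x))); last exact: mass_combine E.
  rewrite -itvB//; apply: itv_ae_eq => //; first exact: bmB.
  by apply: ae1 aAt _ => x h /=; rewrite in_itv/= => x1; rewrite h//; ring.
exists a, f, z, D, good, a0, A.
split => //.
- move=> i; have [bz pz _] := zP i; split => //.
  + exact: zE.
  + by exists a0.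
  + by move=> t /mass[].
  + by move=> t /mass[].
- by move=> t [].
- move=> t gt; have [tJ _ _ ua [c [tr gr]]] := gt.
  exists (fun i => varphi_inv (m i) (c i)); split => // i.
  have [c1 c2 c3 c4 c5] := phP i; have [_ pz _] := zP i.
  have x0lr : left_end R i <= 0 <= right_end R i.
    by rewrite /left_end /right_end ler0n andbT subr_le0 lern1 -ltnS.
  exact: (trace_value (end_lt R i) x0lr c1 c2 c3 c5 (fun x => a01 (x, t)) (varE i t ua) (zE i t gt) (pz t) (tr i)).
Qed.

End extraction.

(** * Comparison of two weak solutions *)

Section comparison.
Context (R : realType).
Local Notation leb := (@lebesgue_measure R).
Variables (m : 'I_2 -> medium R) (T : R) (T0 : 0 < T).
Variable ph : 'I_2 -> R -> R.
Hypothesis phP : forall i, [/\ continuous (ph i), {homo ph i : x y / x <= y},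
  {in `[0, 1] &, {homo ph i : x y / x < y}}, ph i 0 = 0 & {in `[0, 1], varphi (m i) =1 ph i}].

(** A strict order of the transformed saturations on one side of the interface
    is a strict order of capillary pressures, which excludes the reverse
    strict order on the other side. *)
Lemma interface_order (i j : 'I_2) (zu zv ru rv : 'I_2 -> R) :
  (forall k, 0 <= ru k <= 1 /\ ph k (ru k) = zu k) -> (forall k, 0 <= rv k <= 1 /\ ph k (rv k) = zv k) ->
  (\bigcap_k capillary_graph (m k) (ru k)) !=set0 -> (\bigcap_k capillary_graph (m k) (rv k)) !=set0 ->
  0 < zu i - zv i -> 0 <= zu j - zv j.
Proof.
move=> hu hv [pu Hu] [pv Hv]; rewrite subr_gt0 subr_ge0 => zi; rewrite leNgt; apply/negP => zj.
have order k (x y : R) : ph k x < ph k y -> x < y.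
  have [_ mono _ _ _] := phP k.
  by move=> h; rewrite ltNge; apply/negP => /mono; rewrite leNgt h.
have [ui01 uiE] := hu i; have [vi01 viE] := hv i.
have [uj01 ujE] := hu j; have [vj01 vjE] := hv j.
have h1 : pv < pu.
  by apply: (capillary_graph_lt ui01 vi01 (Hu i I) (Hv i I)); apply: (order i); rewrite uiE viE.
have h2 : pu < pv.
  by apply: (capillary_graph_lt vj01 uj01 (Hv j I) (Hu j I)); apply: (order j); rewrite ujE vjE.
by have := lt_trans h1 h2; rewrite ltxx.
Qed.

Lemma reduced_contraction (u0 v0 : R -> R) (uc vc : R -> R -> R) (a f b g : R * R -> R)
    (z zb : 'I_2 -> R * R -> R) (D Db : R * R -> R) (gu gv : R -> Prop) (a0 b0 : R -> R) (A B : R -> R -> R) :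
  reduced m ph T u0 uc a f z D gu a0 A -> reduced m ph T v0 vc b g zb Db gv b0 B ->
  forall t, 0 <= t <= T ->
  \int[leb]_(x in `]-1, 1[) (weight m x * Order.max (A t x - B t x) 0) <=
  \int[leb]_(x in `]-1, 1[) (weight m x * Order.max (a0 x - b0 x) 0).
Proof.
move=> ru rv t tJ.
have su0 := rd_side ru ord0; have su1 := rd_side ru ord_max.
have sv0 := rd_side rv ord0; have sv1 := rd_side rv ord_max.
rewrite left_end0 right_end0 in su0 sv0; rewrite left_end1 right_end1 in su1 sv1.
have compat r s : gu r -> gv s ->
    (0 < z ord0 (0, r) - zb ord0 (0, s) -> 0 <= z ord_max (0, r) - zb ord_max (0, s)) /\
    (0 < z ord_max (0, r) - zb ord_max (0, s) -> 0 <= z ord0 (0, r) - zb ord0 (0, s)).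
  move=> gr gs; have [rhou [hu Hu]] := rd_graph ru gr; have [rhov [hv Hv]] := rd_graph rv gs.
  split.
    exact: (interface_order (i := ord0) ord_max hu hv Hu Hv).
  exact: (interface_order (i := ord_max) ord0 hu hv Hu Hv).
have por i : 0 <= porosity (m i) by have /andP[/ltW] := porosity_itv (m i).
have w0 x : -1 < x < 0 -> weight m x = porosity (m ord0).
  by move=> h; apply: weightE; rewrite left_end0 right_end0.
have w1 x : 0 < x < 1 -> weight m x = porosity (m ord_max).
  by move=> h; apply: weightE; rewrite left_end1 right_end1.
have [c0 _ i0 _ _] := phP ord0; have [c1 _ i1 _ _] := phP ord_max.
exact: (contraction T0 (por ord0) (por ord_max) (weight_bm m) (weight_ge0 m) w0 w1 c0 i0 c1 i1
  su0 sv0 su1 sv1 compat (rd_bm0 ru) (rd_itv0 ru) (rd_D ru) (rd_bm0 rv) (rd_itv0 rv) (rd_D rv)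
  (rd_bmA ru) (rd_bmA rv) (rd_cA ru) (rd_cA rv) (rd_aA ru) (rd_aA rv) tJ).
Qed.

(** Passage to bounded representatives and from the two subdomains to the
    whole domain. *)
Lemma sum_excess (p q P Q : R -> R) : Lp_on leb +oo%E `]-1, 1[ p -> Lp_on leb +oo%E `]-1, 1[ q ->
  bm P -> bm Q -> {ae leb, forall x, -1 < x < 1 -> p x = P x} ->
  {ae leb, forall x, -1 < x < 1 -> q x = Q x} ->
  \sum_(i < 2) \int[leb]_(x in Omega R i) (porosity (m i) * Order.max (p x - q x) 0) =
  \int[leb]_(x in `]-1, 1[) (weight m x * Order.max (P x - Q x) 0).
Proof.
move=> pL qL bP bQ pP qQ.
rewrite -sum_Omega_weight; last by apply: bm_max0; exact: bmB.
apply: eq_bigr => i _.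
have mO : measurable (Omega R i : set (measurableTypeR R)) by exact: measurable_itv.
have mI : measurable (`]-1, 1[%classic : set (measurableTypeR R)) by exact: measurable_itv.
have OI : Omega R i `<=` `]-1, 1[ by move=> x /Omega_sub; rewrite /= in_itv.
have mp := measurable_funS mI OI (Lp_on_measurable_on mI pL).
have mq := measurable_funS mI OI (Lp_on_measurable_on mI qL).
have mPQ : measurable_fun (Omega R i : set (measurableTypeR R)) (fun x => porosity (m i) * Order.max (P x - Q x) 0).
  apply: (measurable_funS measurableT) => //.
  by apply: (bmM (bm_cst _ _) _).1; apply: bm_max0; exact: bmB.
apply: ae_eq_Rintegral => //.
  apply: measurable_funM; first exact: measurable_cst.
  by apply: measurable_maxr; [exact: measurable_funB|exact: measurable_cst].
by apply: ae2 pP qQ _ => x h1 h2 /Omega_sub x1; rewrite h1// h2.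
Qed.

End comparison.

Unset Implicit Arguments.

Theorem theorem5p1 (R : realType) (m : 'I_2 -> medium R) (T : R) (T_gt0 : 0 < T)
    (u0 v0 : R -> R) (u v : R * R -> R) (uc vc : R -> R -> R)
    (u0_sat : saturation (@lebesgue_measure R) `]-1, 1[ u0)
    (v0_sat : saturation (@lebesgue_measure R) `]-1, 1[ v0)
    (u_sol : weak_solution m T u0 u)
    (v_sol : weak_solution m T v0 v)
    (u_flux : bounded_flux m T u)
    (v_flux : bounded_flux m T v)
    (uc_rep : weak_star_representative T u uc)
    (vc_rep : weak_star_representative T v vc)
    (t : R) (t_itv : 0 <= t <= T) :
  \sum_(i < 2) \int[@lebesgue_measure R]_(x in Omega R i)
      (porosity (m i) * (uc t \- vc t)^\+ x)
    <= \sum_(i < 2) \int[@lebesgue_measure R]_(x in Omega R i)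
      (porosity (m i) * (u0 \- v0)^\+ x)
  /\
  \sum_(i < 2) \int[@lebesgue_measure R]_(x in Omega R i)
      (porosity (m i) * (uc t \- vc t)^\- x)
    <= \sum_(i < 2) \int[@lebesgue_measure R]_(x in Omega R i)
      (porosity (m i) * (u0 \- v0)^\- x).
Proof.
have [ph phP] := choice (fun i => varphi_primitive (m i)).
have [a [f [z [D [gu [a0 [A ru]]]]]]] := extraction T_gt0 u0_sat u_sol u_flux uc_rep phP.
have [b [g [zb [Db [gv [b0 [B rv]]]]]]] := extraction T_gt0 v0_sat v_sol v_flux vc_rep phP.
have tJ : t \in `[0, T] by rewrite in_itv.
have [ucL _ _] := uc_rep; have [vcL _ _] := vc_rep.
have {}ucL := ucL t tJ; have {}vcL := vcL t tJ.
have [u0L _] := u0_sat; have [v0L _] := v0_sat.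
have bA := rd_bmA ru t_itv; have bB := rd_bmA rv t_itv.
have ucA := rd_uc ru t_itv; have vcB := rd_uc rv t_itv.
split.
  have := reduced_contraction T_gt0 phP ru rv t_itv.
  rewrite -(sum_excess m ucL vcL bA bB ucA vcB).
  by rewrite -(sum_excess m u0L v0L (rd_bm0 ru) (rd_bm0 rv) (rd_u0 ru) (rd_u0 rv)).
have := reduced_contraction T_gt0 phP rv ru t_itv.
rewrite -(sum_excess m vcL ucL bB bA vcB ucA).
rewrite -(sum_excess m v0L u0L (rd_bm0 rv) (rd_bm0 ru) (rd_u0 rv) (rd_u0 ru)).
have neg (p q : R -> R) : \sum_(i < 2) \int[@lebesgue_measure R]_(x in Omega R i)
    (porosity (m i) * Order.max (q x - p x) 0) =
  \sum_(i < 2) \int[@lebesgue_measure R]_(x in Omega R i) (porosity (m i) * (p \- q)^\- x).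
  apply: eq_bigr => i _; apply: eq_Rintegral => x _.
  by rewrite /funrneg /= opprB.
by rewrite (neg (uc t) (vc t)) (neg u0 v0).
Qed.
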